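(* Let $(M,J,\omega)$ be a compact connected Kähler manifold of complex dimension $n\ge1$, and consider the inclusion $\iota_{\mathcal H}:\mathcal H\hookrightarrow\mathcal M$. Then $\iota_{\mathcal H}^\star\, g_{\mathrm E}=2\,g_{\mathrm C}$; that is, for all $\varphi\in\mathcal H_\omega$ and $\nu,\eta\in C^\infty(M)$, $$g_{\mathrm E}(\nabla^{1,1}\nu,\nabla^{1,1}\eta)|_{g_\varphi}=2\,g_{\mathrm C}(\nu,\eta)|_\varphi .$$
   Context: $\mathcal M$ is the space of all smooth Riemannian metrics on $M$, with $T_g\mathcal M$ the space of smooth symmetric $(0,2)$-tensor fields. The Ebin metric is $g_{\mathrm E}(h,k)|_g=\int_M\mathrm{tr}(g^{-1}h\,g^{-1}k)\,dV_g$. $\mathcal H_\omega=\{\varphi\in C^\infty(M):\omega_\varphi:=\omega+\sqrt{-1}\,\partial\bar\partial\varphi>0\}$, $g_\varphi(\cdot,\cdot)=\omega_\varphi(\cdot,J\cdot)$, $\mathcal H=\{g_\varphi:\varphi\in\mathcal H_\omega\}\cong\mathcal H_\omega/\mathbb R$. A tangent vector $\nu\in T_\varphi\mathcal H_\omega\cong C^\infty(M)$ maps to $\nabla^{1,1}\nu:=\frac{d}{dt}\big|_{t=0}g_{\varphi+t\nu}=(\sqrt{-1}\,\partial\bar\partial\nu)(\cdot,J\cdot)\in T_{g_\varphi}\mathcal M$. The Calabi metric is $g_{\mathrm C}(\nu,\eta)|_\varphi=\int_M\Delta_\varphi\nu\,\Delta_\varphi\eta\,\frac{\omega_\varphi^n}{n!}$,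 where $\Delta_\varphi\nu=g_\varphi^{i\bar j}\nu_{i\bar j}$ in local holomorphic coordinates with $\omega_\varphi=\sqrt{-1}(g_\varphi)_{i\bar j}dz^i\wedge d\overline{z^j}$; the same symbol denotes the induced metric on $\mathcal H$. *)

(* Defs.v *)
From HB Require Import structures.
From mathcomp Require Import all_boot all_order all_algebra all_fingroup.
From mathcomp Require Import all_classical all_reals all_analysis.
From mathcomp Require Import complex.

Set Implicit Arguments.
Unset Strict Implicit.
Unset Printing Implicit Defensive.

Import Order.TTheory GRing.Theory Num.Theory.
Import numFieldNormedType.Exports.

Local Open Scope classical_set_scope.
Local Open Scope ring_scope.
Local Open Scope complex_scope.

(** Calculus on real coordinate spaces *)

Definition partial (R : realType) (m : nat) (k : 'I_m)
    (f : 'rV[R]_m -> R) : 'rV[R]_m -> R :=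
  fun x => 'D_(delta_mx 0 k) f x.

(* Every iterated partial derivative is Frechet differentiable at each point of
   the open set U; this is the same as being C^oo on U, since differentiability
   gives both the continuity and the next partial derivatives. *)
Definition smooth_on (R : realType) (m : nat) (U : set 'rV[R]_m)
    (f : 'rV[R]_m -> R) : Prop :=
  forall (s : seq 'I_m) (x : 'rV[R]_m), U x ->
    differentiable (foldr (@partial R m) f s) x.

(* Iterated one-dimensional Lebesgue integral. By Tonelli it is the integral
   against Lebesgue measure on R^m for nonnegative Borel functions f, the only
   ones to which it is applied. *)
Fixpoint integral_rV (R : realType) (m : nat) :
    ('rV[R]_m -> \bar R) -> \bar R :=
  match m with
  | 0%N => fun f => f 0
  | m'.+1 => fun f =>
      (\int[@lebesgue_measure R]_(t in [set: R])
         integral_rV (fun v : 'rV[R]_m' => f (row_mx (t%:M : 'rV[R]_1) v)))%E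
  end.

(** Complex manifolds.
    C^n is R^(n + n) with coordinates (x_1, .., x_n, y_1, .., y_n) and
    z_k = x_k + i y_k; tangent vectors are row vectors, on which linear maps
    and the complex structure act by right multiplication. *)

(* J d/dx_k = d/dy_k and J d/dy_k = - d/dx_k *)
Definition Jmx (R : realType) (n : nat) : 'M[R]_(n + n) :=
  block_mx 0 1%:M (- 1%:M) 0.

(* The commutation with J is the system of Cauchy-Riemann equations. *)
Definition holomorphic_on (R : realType) (n : nat) (U : set 'rV[R]_(n + n))
    (f : 'rV[R]_(n + n) -> 'rV[R]_(n + n)) : Prop :=
  (forall k, smooth_on U (fun x => f x 0 k)) /\
  (forall x, U x -> Jmx R n *m 'J f x = 'J f x *m Jmx R n).

(* chart_map and chart_inv are total functions that are only meaningful on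
   chart_dom c and on its image. *)
Record complex_atlas (R : realType) (n : nat) (M : topologicalType) : Type :=
ComplexAtlas {
  chart : Type;
  chart_dom : chart -> set M;
  chart_map : chart -> M -> 'rV[R]_(n + n);
  chart_inv : chart -> 'rV[R]_(n + n) -> M;
  chart_cover : forall p, exists c, chart_dom c p;
  chart_dom_open : forall c, open (chart_dom c);
  chart_im_open : forall c, open (chart_map c @` chart_dom c);
  chart_mapK : forall c p, chart_dom c p -> chart_inv c (chart_map c p) = p;
  chart_map_continuous : forall c p, chart_dom c p ->
    {for p, continuous (chart_map c)};
  chart_inv_continuous : forall c p, chart_dom c p ->
    {for chart_map c p, continuous (chart_inv c)};
  chart_transition : forall c d,
    holomorphic_on (chart_map c @` (chart_dom c `&` chart_dom d))
      (chart_map d \o chart_inv c)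
}.

Section Manifold.
Context (R : realType) (n : nat) (M : ptopologicalType).
Context (A : complex_atlas R n M).

Let V : Type := 'rV[R]_(n + n).

Definition chart_im (c : chart A) : set V := chart_map c @` chart_dom c.

Definition transition (c d : chart A) : V -> V := chart_map d \o chart_inv c.

Definition smooth_fun (f : M -> R) : Prop :=
  forall c : chart A, smooth_on (chart_im c) (f \o chart_inv c).

(* Objects given in local coordinates: X c x is the expression in the chart c
   at the point with coordinates x, and is only meaningful for x in
   chart_im c. *)
Definition local (X : Type) : Type := chart A -> V -> X.

Definition chart_at (p : M) : chart A := projT1 (cid (chart_cover A p)).

(* Value at p of a local expression that does not depend on the chart. *)
Definition at_point (X : Type) (F : local X) (p : M) : X :=
  F (chart_at p) (chart_map (chart_at p) p).

(* (0,2)-tensor fields, as the matrices T (d/du_a, d/du_b) where u are the 2n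
   real coordinates of a chart. *)
Definition smooth_tensor (T : local 'M[R]_(n + n)) : Prop :=
  (forall c a b, smooth_on (chart_im c) (fun x => T c x a b)) /\
  (forall c d x, (chart_map c @` (chart_dom c `&` chart_dom d)) x ->
     T c x = 'J (transition c d) x *m T d (transition c d x)
               *m ('J (transition c d) x)^T).

Definition closed_2form (w : local 'M[R]_(n + n)) : Prop :=
  forall c x, chart_im c x -> forall a b k : 'I_(n + n),
    partial a (fun y => w c y b k) x + partial b (fun y => w c y k a) x
      + partial k (fun y => w c y a b) x = 0.

(* w (., J .) *)
Definition form_metric (w : local 'M[R]_(n + n)) : local 'M[R]_(n + n) :=
  fun c x => w c x *m (Jmx R n)^T.

Definition positive_form (w : local 'M[R]_(n + n)) : Prop :=
  forall c x, chart_im c x -> forall u : V, u != 0 ->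
    0 < (u *m form_metric w c x *m u^T) 0 0.

Definition kahler_form (w : local 'M[R]_(n + n)) : Prop :=
  [/\ smooth_tensor w,
      forall c x, chart_im c x -> (w c x)^T = - w c x,
      forall c x, chart_im c x -> Jmx R n *m w c x *m (Jmx R n)^T = w c x,
      closed_2form w
    & positive_form w].

(** Complex coordinates *)

Local Notation iC := (0 +i* 1 : R[i]).

Definition cpartial (a : 'I_(n + n)) (F : V -> R[i]) : V -> R[i] :=
  fun x => partial a (fun y => complex.Re (F y)) x
             +i* partial a (fun y => complex.Im (F y)) x.

(* d/dz_k and d/d(zbar)_k *)
Definition dz (k : 'I_n) (F : V -> R[i]) : V -> R[i] :=
  fun x => (cpartial (lshift n k) F x - iC * cpartial (rshift n k) F x) / 2%:R.

Definition dzbar (k : 'I_n) (F : V -> R[i]) : V -> R[i] :=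
  fun x => (cpartial (lshift n k) F x + iC * cpartial (rshift n k) F x) / 2%:R.

(* f_{i jbar} *)
Definition complex_hessian (f : M -> R) : local 'M[R[i]]_n :=
  fun c x => \matrix_(i, j) dz i (dzbar j (fun y => (f (chart_inv c y))%:C)) x.

(* The value of the covector dz^i on the a-th real coordinate vector. *)
Definition dz_covector (i : 'I_n) (a : 'I_(n + n)) : R[i] :=
  (a == lshift n i)%:R + iC * (a == rshift n i)%:R.

(* The components of sqrt(-1) h_{i jbar} dz^i /\ d(zbar)^j on the real
   coordinate vectors; they are real when h is Hermitian. *)
Definition form_of_hermitian (h : 'M[R[i]]_n) : 'M[R]_(n + n) :=
  \matrix_(a, b) complex.Re (iC * \sum_i \sum_j h i j *
    (dz_covector i a * conjc (dz_covector j b)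
       - dz_covector i b * conjc (dz_covector j a))).

(* The tangent vector d/dz_i. *)
Definition dz_vector (i : 'I_n) : 'rV[R[i]]_(n + n) :=
  \row_a (((a == lshift n i)%:R - iC * (a == rshift n i)%:R) / 2%:R).

(* The h_{i jbar} with w = sqrt(-1) h_{i jbar} dz^i /\ d(zbar)^j for a real
   (1,1)-form w, that is - sqrt(-1) w (d/dz_i, d/d(zbar)_j). *)
Definition hermitian_of_form (w : 'M[R]_(n + n)) : 'M[R[i]]_n :=
  \matrix_(i, j) (- iC * (dz_vector i *m map_mx (real_complex R) w
                           *m (map_mx (@conjc R) (dz_vector j))^T) 0 0).

(** Measures and integrals on M *)

Definition borel : measurableType _ := g_sigma_algebraType (@open M).

Definition has_density (dens : local R)
    (mu : {measure set borel -> \bar R}) : Prop :=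
  forall (c : chart A) (B : set borel), measurable B -> B `<=` chart_dom c ->
    mu B = integral_rV (fun x => ((dens c \_ (chart_map c @` B)) x)%:E).

(* The Borel measure given in every chart by (dens c x) dx, for a nonnegative
   density; it is unique when M is compact. It exists when dens transforms by
   the absolute value of the Jacobian determinant, so that the default value 0
   plays no role for the densities used below. *)
Definition density_measure (dens : local R) : {measure set borel -> \bar R} :=
  match pselect (exists mu, has_density dens mu) with
  | left mu_dens => projT1 (cid mu_dens)
  | right _ => mzero
  end.

(* dV_g *)
Definition riemannian_volume (g : local 'M[R]_(n + n)) :
    {measure set borel -> \bar R} :=
  density_measure (fun c x => Num.sqrt (\det (g c x))).

(* The value of w^n / n! on the positively oriented frame
   (d/dx_1, d/dy_1, .., d/dx_n, d/dy_n), as the n-fold wedge product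
     w^n (v_1, .., v_2n) = 2^-n \sum_s sgn(s) \prod_k w (v_s(2k-1), v_s(2k)).
   The positions 2k-1 and 2k of the frame are labelled by lshift n k and
   rshift n k, which does not affect the signature of s. *)
Definition top_power (w : 'M[R]_(n + n)) : R :=
  (\sum_(s : 'S_(n + n)) (-1) ^+ s *
     \prod_(k < n) w (s (lshift n k)) (s (rshift n k)))
  / (2 ^ n * n`!)%:R.

(* w^n / n! *)
Definition kahler_volume (w : local 'M[R]_(n + n)) :
    {measure set borel -> \bar R} :=
  density_measure (fun c x => top_power (w c x)).

(** Kahler metrics in the class of w *)

(* w_phi = w + sqrt(-1) ddbar phi *)
Definition kahler_perturb (w : local 'M[R]_(n + n)) (phi : M -> R) :
    local 'M[R]_(n + n) :=
  fun c x => w c x + form_of_hermitian (complex_hessian phi c x).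

Definition kahler_potential (w : local 'M[R]_(n + n)) (phi : M -> R) : Prop :=
  smooth_fun phi /\ positive_form (kahler_perturb w phi).

(* g_phi *)
Definition kahler_metric (w : local 'M[R]_(n + n)) (phi : M -> R) :
    local 'M[R]_(n + n) :=
  form_metric (kahler_perturb w phi).

(* The derivative at t = 0 of g_(phi + t nu): the image of nu under the
   differential of phi |-> g_phi. *)
Definition nabla11 (w : local 'M[R]_(n + n)) (phi nu : M -> R) :
    local 'M[R]_(n + n) :=
  fun c x => \matrix_(a, b)
    derive1 (fun t : R =>
      kahler_metric w (fun p => phi p + t * nu p) c x a b) 0.

(* g_phi^{i jbar} nu_{i jbar}, where g^{i jbar} g_{k jbar} = delta_ik, so that
   g^{i jbar} is the (j, i) entry of the inverse matrix; this is a real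
   number. *)
Definition laplacian (w : local 'M[R]_(n + n)) (phi nu : M -> R) : local R :=
  fun c x => complex.Re (\sum_i \sum_j
    invmx (hermitian_of_form (kahler_perturb w phi c x)) j i
      * complex_hessian nu c x i j).

Definition ebin (g h k : local 'M[R]_(n + n)) : R :=
  \int[riemannian_volume g]_(p in [set: borel])
    at_point (fun c x =>
      \tr (invmx (g c x) *m h c x *m invmx (g c x) *m k c x)) p.

Definition calabi (w : local 'M[R]_(n + n)) (phi nu eta : M -> R) : R :=
  \int[kahler_volume (kahler_perturb w phi)]_(p in [set: borel])
    (at_point (laplacian w phi nu) p * at_point (laplacian w phi eta) p).

End Manifold.

(* Main.v *)
From HB Require Import structures.
From mathcomp Require Import all_boot all_order all_algebra all_fingroup.
From mathcomp Require Import finmap.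
From mathcomp Require Import all_classical all_reals all_analysis.
From mathcomp Require Import measurable_realfun complex ring lra.
Require Import Defs.

Set Implicit Arguments.
Unset Strict Implicit.
Unset Printing Implicit Defensive.

Import Order.TTheory GRing.Theory Num.Theory.
Import numFieldNormedType.Exports.
Local Open Scope classical_set_scope.
Local Open Scope ring_scope.

(** In a chart, let w be the matrix of omega_phi, W its inverse and D the
    density of omega_phi^n / n!. For a function f let alpha_f be the matrix of
    sqrt(-1) ddbar f; it is the exterior derivative of theta_f = (df J) / 2.

    Three facts are pointwise. The metric is g = w J^T and the variation
    nabla^{1,1} nu is alpha_nu J^T, so the integrand of the Ebin metric is
    tr (W alpha_nu W alpha_eta) ([nabla11E], [ebin_integrandE]). The Laplacian
    is tr (W alpha_nu) / 2 ([laplacianE]). The two volume densities D and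
    sqrt (det g) agree ([top_powerE], [volumeE]). The claim becomes

      int tr (W alpha_nu W alpha_eta) = int tr (W alpha_nu) tr (W alpha_eta) / 2.

    The reason is that alpha_nu /\ alpha_eta /\ omega_phi^(n-2) is exact, the
    difference of the two sides being, up to a constant, the integral of this
    form. In coordinates the closed form alpha_eta /\ omega_phi^(n-2) is dual to
    the bivector

      Psi = tr (W alpha_eta) / 2 W - W alpha_eta W,

    and its closedness reads sum_a d_a (D Psi_ab) = 0 ([divergence_bivector]);
    this follows from omega_phi and alpha_eta being closed and from D^2 being
    the determinant of w. Contracting Psi with theta_nu gives a vector field X with
    sum_a d_a (D X_a) = D F, where F = - tr (Psi alpha_nu) / 2 and
    2 F = tr (W alpha_nu W alpha_eta) - tr (W alpha_nu) tr (W alpha_eta) / 2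
    ([divergence_flux], [trace_bivector]). Hence everything follows from
    int F = 0, the divergence theorem on the compact manifold M
    ([divergence_theorem]).

    The divergence theorem is proved with a C^1 partition of unity, which
    reduces it to compactly supported fields on R^(2n); there it is the
    fundamental theorem of calculus and Fubini. The measure on R^(2n) is
    constructed together with the properties that serve here: it computes
    the iterated Lebesgue integral of nonnegative functions, is finite on bounded
    sets, and annihilates
    partial derivatives of compactly supported functions ([ex_lebesgue_like]).
    To know that a nonnegative top power D is the square root of det w, one
    needs the Pfaffian of a J-invariant form: its square is computed by
    reducing w to a standard form over the complex numbers, and its sign by
    deforming w to the standard form ([sqr_pfaffian_sum], [top_powerE]). *)

(** * The Pfaffian *)

Section Pfaffian.
Variable K : comNzRingType.

Definition pfaffian_sum n (w : 'M[K]_(n + n)) : K :=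
  \sum_(s : 'S_(n + n)) (-1) ^+ s *
     \prod_(k < n) w (s (lshift n k)) (s (rshift n k)).

Definition std_form n : 'M[K]_(n + n) := block_mx 0 1%:M (- 1%:M) 0.

(** A choice of a pair of indices for each k, read as a function on all 2n
    indices: these choices index the expansion of a product of n entries of
    P w P^T. *)
Definition unpair_fun n (g : {ffun 'I_n -> 'I_(n + n) * 'I_(n + n)})
    (j : 'I_(n + n)) : 'I_(n + n) :=
  match fintype.split j with inl k => (g k).1 | inr k => (g k).2 end.

(** Multilinearity: summing over the permutations first turns the coefficient
    of each product of entries of w into the determinant of a matrix formed of
    columns of P, from which det P factors out. *)
Lemma pfaffian_sum_congr_expand n (P w : 'M[K]_(n + n)) :
  pfaffian_sum (P *m w *m P^T) = \det P *
    \sum_(g : {ffun 'I_n -> 'I_(n + n) * 'I_(n + n)})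
       \det (rowsub (unpair_fun g) 1%:M) * \prod_k w (g k).1 (g k).2.
Proof.
rewrite /pfaffian_sum big_distrr /=.
transitivity (\sum_(s : 'S_(n + n)) \sum_(g : {ffun 'I_n -> 'I_(n + n) * 'I_(n + n)})
   (-1) ^+ s * ((\prod_k (P (s (lshift n k)) (g k).1 * P (s (rshift n k)) (g k).2)) *
     \prod_k w (g k).1 (g k).2)).
  apply: eq_bigr => s _; rewrite -big_distrr /=; congr (_ * _).
  transitivity (\prod_(k < n) \sum_(ab : 'I_(n + n) * 'I_(n + n))
     (P (s (lshift n k)) ab.1 * P (s (rshift n k)) ab.2 * w ab.1 ab.2)).
    apply: eq_bigr => k _.
    rewrite -(pair_bigA _ (fun a b =>
      P (s (lshift n k)) a * P (s (rshift n k)) b * w a b)) /=.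
    rewrite mxE exchange_big /=; apply: eq_bigr => b _.
    rewrite !mxE big_distrl /=; apply: eq_bigr => a _.
    by rewrite [RHS]mulrAC.
  rewrite bigA_distr_bigA /=; apply: eq_bigr => g _.
  by rewrite -big_split.
rewrite exchange_big /=; apply: eq_bigr => g _.
rewrite mulrA; under eq_bigr do rewrite mulrA.
rewrite -big_distrl /=; congr (_ * _).
transitivity (\det (rowsub (unpair_fun g) P^T)); last first.
  by rewrite rowsubE det_mulmx det_tr mulrC.
apply: eq_bigr => s _; congr (_ * _).
rewrite big_split_ord [X in _ = X]/= -big_split /=; apply: eq_bigr => k _.
by rewrite !mxE /unpair_fun (unsplitK (inl k)) (unsplitK (inr k)).
Qed.

(** The sum in the expansion does not involve P, so the case P = 1 identifies
    it. *)
Lemma pfaffian_sum_congr n (P w : 'M[K]_(n + n)) :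
  pfaffian_sum (P *m w *m P^T) = \det P * pfaffian_sum w.
Proof.
rewrite pfaffian_sum_congr_expand; congr (_ * _).
rewrite -[in RHS](mulmx1 w) -[in RHS](mul1mx w) -[X in _ *m _ *m X]trmx1.
by rewrite pfaffian_sum_congr_expand det1 mul1r.
Qed.

Lemma det_block_swap n (A B : 'M[K]_n) :
  \det (block_mx A B B A) = \det (A + B) * \det (A - B).
Proof.
have detM : \det (block_mx 1%:M 1%:M 0 1%:M *m block_mx A B B A
    *m block_mx 1%:M (- 1%:M) 0 (1%:M : 'M[K]_n)) = \det (block_mx A B B A).
  by rewrite !det_mulmx !det_ublock !det1 !mul1r !mulr1.
rewrite -detM !mulmx_block !mul1mx !mul0mx !mulmx1 !mulmx0 !addr0 !mulmxN.
rewrite !mulmx1 !add0r [B + A]addrC addNr.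
by rewrite det_lblock [- B + A]addrC.
Qed.

Definition pair_label n (j : 'I_n) (e : bool) : 'I_(n + n) :=
  if e then rshift n j else lshift n j.

(** Each entry of the standard form as a signed sum over the pairs of conjugate
    labels; expanding a product of n entries then gives one term for each choice
    f of labels and e of orientations. *)
Lemma std_formE n (a b : 'I_(n + n)) :
  std_form n a b = \sum_(j : 'I_n) \sum_(e : bool) (-1) ^+ e *
    ((a == pair_label j e)%:R * (b == pair_label j (~~ e))%:R).
Proof.
under eq_bigr do rewrite big_bool /= expr1 expr0 mul1r mulN1r.
rewrite /std_form -[a]fintype.splitK -[b]fintype.splitK.
case: (fintype.split a) (fintype.split b) => i [] j /=;
  rewrite ?(block_mxEul, block_mxEur, block_mxEdl, block_mxEdr) !mxE.
- by rewrite big1 // => k _; rewrite !(eq_lrshift, eq_rlshift, eq_lshift, eq_rshift) mul0r mulr0 oppr0 addr0.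
- under eq_bigr => k _ do rewrite !(eq_lrshift, eq_rlshift, eq_lshift, eq_rshift) mul0r oppr0 add0r.
  rewrite (bigD1 i) //= eqxx mul1r big1 ?addr0 1?eq_sym //.
  by move=> k; rewrite eq_sym => /negPf->; rewrite mul0r.
- under eq_bigr => k _ do rewrite !(eq_lrshift, eq_rlshift, eq_lshift, eq_rshift) mul0r addr0.
  rewrite (bigD1 i) //= eqxx mul1r big1 ?addr0 1?eq_sym //.
  by move=> k; rewrite eq_sym => /negPf->; rewrite mul0r oppr0.
- by rewrite big1 // => k _; rewrite !(eq_lrshift, eq_rlshift, eq_lshift, eq_rshift) mulr0 mul0r oppr0 addr0.
Qed.

(** The matrix of f is a permutation matrix, or has two equal rows. *)
Lemma sqr_det_fun_mx n (f : {ffun 'I_n -> 'I_n}) :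
  \det (\matrix_(i, j) (f i == j)%:R : 'M[K]_n) ^+ 2 = (injectiveb f)%:R.
Proof.
case: (boolP (injectiveb f)) => [/injectiveP finj | /injectivePn [i [j ij fij]]].
  have -> : (\matrix_(i, j) (f i == j)%:R) = perm_mx (perm finj) :> 'M[K]_n.
    by apply/matrixP => i j; rewrite !mxE permE.
  by rewrite det_perm sqrr_sign.
rewrite (determinant_alternate ij) ?expr0n // => k.
by rewrite !mxE fij.
Qed.

(** In the expansion of the Pfaffian of the standard form, a choice of labels f
    and orientations e contributes the signs of e times the sign of the permutation
    that it defines, if any. This permutation moves both members of the pairs by
    f, which has no effect on its sign, and exchanges the members of the pairs
    where e is set, so its sign is the product of the signs of e. Hence each
    pair of a bijective f and an arbitrary e contributes 1, and there are 2^n n!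
    of them. *)
Lemma pfaffian_sum_std n : pfaffian_sum (std_form n) = (2 ^ n * n`!)%:R.
Proof.
rewrite /pfaffian_sum.
transitivity (\sum_(f : {ffun 'I_n -> 'I_n}) \sum_(e : {ffun 'I_n -> bool})
   \sum_(s : 'S_(n + n)) (-1) ^+ s * \prod_k ((-1) ^+ e k *
    ((s (lshift n k) == pair_label (f k) (e k))%:R *
     (s (rshift n k) == pair_label (f k) (~~ e k))%:R)) : K).
  under eq_bigr => s _.
    under eq_bigr do rewrite std_formE.
    rewrite bigA_distr_bigA big_distrr /=.
    under eq_bigr => f _ do rewrite bigA_distr_bigA big_distrr /=.
    over.
  by rewrite exchange_big; apply: eq_bigr => f _; rewrite exchange_big.
transitivity (\sum_(f : {ffun 'I_n -> 'I_n}) \sum_(e : {ffun 'I_n -> bool})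
   (injectiveb f)%:R : K); last first.
  under eq_bigr do rewrite sumr_const card_ffun card_bool card_ord.
  rewrite sumrMnl -natr_sum -mulrnA mulnC; congr (_ *+ (_ * _)).
  rewrite -big_mkcond /= sum1dep_card.
  by rewrite card_inj_ffuns card_ord ffactnn.
apply: eq_bigr => f _; apply: eq_bigr => e _.
pose E b : 'M[K]_n := diag_mx (\row_k (e k == b)%:R).
pose F : 'M[K]_n := \matrix_(i, j) (f i == j)%:R.
have EF b i j : (E b *m F) i j = (e i == b)%:R * (f i == j)%:R.
  by rewrite mul_diag_mx !mxE.
have detM : \det (block_mx (E false) (E true) (E true) (E false) *m
    block_mx F 0 0 F) = (\prod_k (-1) ^+ e k) * (injectiveb f)%:R.
  rewrite det_mulmx det_block_swap det_ublock -sqr_det_fun_mx -/F -expr2.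
  congr (_ * _); rewrite -linearD -linearB /= !det_diag -big_split /=.
  apply: eq_bigr => k _; rewrite !mxE.
  by case: (e k); rewrite ?add0r ?addr0 ?sub0r ?subr0 ?mul1r.
(* The permutations that match f and e are counted with sign by a determinant:
   this block matrix has a single 1 in each row, at the label prescribed by f
   and e. *)
transitivity ((\prod_k (-1) ^+ e k) * \det (block_mx (E false) (E true)
    (E true) (E false) *m block_mx F 0 0 F)); last first.
  rewrite detM mulrA -big_split big1 /= ?mul1r // => k _.
  by rewrite -expr2 sqrr_sign.
rewrite big_distrr /=; apply: eq_bigr => s _.
rewrite mulrCA; congr (_ * _); rewrite big_split /=; congr (_ * _).
rewrite big_split_ord [X in _ = X]/= -big_split /=; apply: eq_bigr => k _.
rewrite mulmx_block !mulmx0 !addr0 !add0r.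
have hs (j : 'I_(n + n)) b : (block_mx (E false *m F) (E true *m F)
    (E true *m F) (E false *m F)) (pair_label k b) j =
    (j == pair_label (f k) (e k (+) b))%:R.
  rewrite -[j]fintype.splitK /pair_label; case: (fintype.split j) => i /=; case: b.
  - rewrite block_mxEdl EF.
    by case: (e k); rewrite /= ?mul1r ?mul0r ?eq_lshift ?eq_lrshift // eq_sym.
  - rewrite block_mxEul EF.
    by case: (e k); rewrite /= ?mul1r ?mul0r ?eq_lshift ?eq_lrshift // eq_sym.
  - rewrite block_mxEdr EF.
    by case: (e k); rewrite /= ?mul1r ?mul0r ?eq_rshift ?eq_rlshift // eq_sym.
  - rewrite block_mxEur EF.
    by case: (e k); rewrite /= ?mul1r ?mul0r ?eq_rshift ?eq_rlshift // eq_sym.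
by rewrite (hs _ false) (hs _ true) addbF addbT.
Qed.

End Pfaffian.

Lemma pfaffian_sum_map (K L : comNzRingType) (f : {rmorphism K -> L}) n
    (w : 'M[K]_(n + n)) : pfaffian_sum (map_mx f w) = f (pfaffian_sum w).
Proof.
rewrite rmorph_sum; apply: eq_bigr => s _.
rewrite rmorphM rmorph_sign rmorph_prod; congr (_ * _).
by apply: eq_bigr => k _; rewrite mxE.
Qed.

(** * Complex matrices as J-invariant real matrices *)
Section Realification.
Local Open Scope complex_scope.
Variable R : realType.
Local Notation iC := (0 +i* 1 : R[i]).

Lemma sqr_iC : iC * iC = -1.
Proof. by apply/eqP; rewrite eq_complex /= !(mul0r, mulr0, mul1r, sub0r, addr0, oppr0) !eqxx. Qed.

Definition realify n (c : 'M[R[i]]_n) : 'M[R]_(n + n) :=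
  block_mx (map_mx (@complex.Re R) c) (map_mx (@complex.Im R) c)
           (- map_mx (@complex.Im R) c) (map_mx (@complex.Re R) c).

Lemma map_Re_mul n (c d : 'M[R[i]]_n) : map_mx (@complex.Re R) (c *m d) =
  map_mx (@complex.Re R) c *m map_mx (@complex.Re R) d -
  map_mx (@complex.Im R) c *m map_mx (@complex.Im R) d.
Proof.
apply/matrixP => i j; rewrite !mxE raddf_sum -sumrB; apply: eq_bigr => k _.
by rewrite !mxE; case: (c i k) (d k j) => [? ?] [? ?].
Qed.

Lemma map_Im_mul n (c d : 'M[R[i]]_n) : map_mx (@complex.Im R) (c *m d) =
  map_mx (@complex.Re R) c *m map_mx (@complex.Im R) d +
  map_mx (@complex.Im R) c *m map_mx (@complex.Re R) d.
Proof.
apply/matrixP => i j; rewrite !mxE raddf_sum -big_split; apply: eq_bigr => k _.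
by rewrite !mxE; case: (c i k) (d k j) => [? ?] [? ?] /=; rewrite addrC.
Qed.

Lemma realifyM n (c d : 'M[R[i]]_n) : realify (c *m d) = realify c *m realify d.
Proof.
rewrite /realify mulmx_block map_Re_mul map_Im_mul.
congr block_mx; rewrite ?mulmxN ?mulNmx ?opprD 1?addrC //.
Qed.

Lemma realify1 n : realify (1%:M : 'M[R[i]]_n) = 1%:M.
Proof.
rewrite [RHS]scalar_mx_block /realify; congr block_mx; apply/matrixP => i j;
  by rewrite !mxE ?mulrb; case: eqP; rewrite ?oppr0.
Qed.

Lemma realify_inj n : injective (@realify n).
Proof.
move=> c d /eq_block_mx[e1 e2 _ _]; apply/matrixP => i j.
move/matrixP/(_ i j): e1; move/matrixP/(_ i j): e2; rewrite !mxE.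
by case: (c i j) (d i j) => [? ?] [? ?] /= -> ->.
Qed.

Lemma trace_realify n (c : 'M[R[i]]_n) :
  \tr (realify c) = 2 * complex.Re (\tr c).
Proof.
rewrite /realify mxtrace_block -mulr2n [RHS]mulr_natl; congr (_ *+ _).
rewrite /mxtrace raddf_sum.
by apply: eq_bigr => i _; rewrite !mxE.
Qed.

Lemma Jmx_std n : Jmx R n = std_form R n. Proof. by []. Qed.

Lemma JmxT n : (Jmx R n)^T = - Jmx R n.
Proof. by rewrite /Jmx tr_block_mx opp_block_mx !trmx0 linearN /= trmx1 oppr0 opprK. Qed.

Lemma mul_JmxT n : Jmx R n *m (Jmx R n)^T = 1%:M.
Proof.
rewrite JmxT mulmxN /Jmx mulmx_block !mul0mx !mulmx0 !mul1mx !mulmx1 !add0r !addr0.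
by rewrite opp_block_mx opprK oppr0 -scalar_mx_block.
Qed.

Lemma mulT_Jmx n : (Jmx R n)^T *m Jmx R n = 1%:M.
Proof. exact/mulmx1C/mul_JmxT. Qed.

(** J-invariance is commutation with J, that is complex linearity. *)
Lemma Jinvariant_realify n (w : 'M[R]_(n + n)) :
  Jmx R n *m w *m (Jmx R n)^T = w -> exists c, w = realify c.
Proof.
rewrite JmxT -{1 2}[w]submxK /Jmx opp_block_mx !mulmx_block.
rewrite !(oppr0, opprK, mul0mx, mulmx0, mul1mx, mulmx1, mulmxN, mulNmx, addr0, add0r).
move=> /eq_block_mx[e1 e2 _ _].
exists (\matrix_(i, j) (ulsubmx w i j +i* ursubmx w i j)).
rewrite -[LHS]submxK /realify; congr block_mx; apply/matrixP => i j; rewrite !mxE //=.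
  by move/matrixP/(_ i j): e2; rewrite !mxE => <-; rewrite opprK.
by move/matrixP/(_ i j): e1; rewrite !mxE.
Qed.

(** The inverse of a complex linear map is complex linear, so the real inverse
    of [realify c] is again of the form [realify d]. *)
Lemma realify_unit n (c : 'M[R[i]]_n) : (realify c \in unitmx) -> c \in unitmx.
Proof.
move=> u; have [d hd] : exists d, invmx (realify c) = realify d.
  apply: Jinvariant_realify.
  have JJ : Jmx R n = realify ('i%C)%:M.
    rewrite /Jmx /realify; congr block_mx; apply/matrixP => i j;
     by rewrite !mxE ?mulrb; case: eqP; rewrite ?oppr0.
  have comm : Jmx R n *m realify c = realify c *m Jmx R n.
    by rewrite JJ -!realifyM mul_scalar_mx mul_mx_scalar.
  have : Jmx R n *m invmx (realify c) = invmx (realify c) *m Jmx R n.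
    by apply: (can_inj (mulKmx u)); rewrite mulmxA -comm -mulmxA mulmxV // mulmx1 mulKVmx.
  by move=> ->; rewrite -mulmxA mul_JmxT mulmx1.
suff : c *m d = 1%:M by case/mulmx1_unit.
by apply: realify_inj; rewrite realifyM -hd mulmxV // realify1.
Qed.

Lemma invmx_realify n (c : 'M[R[i]]_n) : realify c \in unitmx ->
  invmx (realify c) = realify (invmx c).
Proof.
move=> u; have cu := realify_unit u.
rewrite -[RHS]mul1mx -(mulVmx u) -mulmxA -realifyM mulmxV // realify1 mulmx1 //.
Qed.

Let rc : {rmorphism R -> R[i]} := real_complex R.

Lemma complexify_realify n (c : 'M[R[i]]_n) :
  exists a b : 'M[R[i]]_n, [/\ map_mx rc (realify c) = block_mx a b (- b) a,
     c = a + iC *: b, map_mx (@conjc R) a = a & map_mx (@conjc R) b = b].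
Proof.
exists (map_mx rc (map_mx (@complex.Re R) c)), (map_mx rc (map_mx (@complex.Im R) c)).
split.
- by rewrite map_block_mx !map_mxN.
- apply/matrixP => i j; rewrite !mxE; case: (c i j) => x y /=.
  by apply/eqP; rewrite eq_complex /= !(mul0r, mulr0, mul1r, sub0r, addr0, oppr0, add0r) !eqxx.
- by apply/matrixP => i j; rewrite !mxE /= oppr0.
- by apply/matrixP => i j; rewrite !mxE /= oppr0.
Qed.

Lemma hermitian_of_form_realify n (c : 'M[R[i]]_n) :
  hermitian_of_form (realify c) = (- iC / 2) *: c.
Proof.
have [a [b [eab ec ca cb]]] := complexify_realify c.
pose E : 'M[R[i]]_(n, n + n) := row_mx (2^-1)%:M (- iC / 2)%:M.
have dzE i : dz_vector R i = row i E.
  apply/rowP => k; rewrite /E; case: (fintype.split_ordP k) => j ->;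
    rewrite [LHS]mxE [RHS]mxE ?row_mxEl ?row_mxEr mxE;
    rewrite !(eq_lrshift, eq_rlshift, eq_lshift, eq_rshift) eq_sym;
    by case: (i == j); rewrite /= ?mulr0n ?mulr1n; field.
have cE : map_mx (@conjc R) E = row_mx (2^-1)%:M (iC / 2)%:M.
  rewrite /E map_row_mx !map_scalar_mx rmorphM rmorphN !fmorphV rmorph_nat.
  by congr (row_mx _ (_ / _)%:M); apply/eqP; rewrite eq_complex /= opprK oppr0 !eqxx.
apply/matrixP => i j; rewrite /hermitian_of_form mxE !dzE map_row -!row_mul.
transitivity (- iC * (E *m map_mx rc (realify c) *m (map_mx (@conjc R) E)^T) i j).
  by congr (_ * _); rewrite !mxE; apply: eq_bigr => k _; rewrite !mxE.
rewrite eab cE /E mul_row_block tr_row_mx mul_row_col !tr_scalar_mx.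
rewrite !mul_scalar_mx !mul_mx_scalar ec !mxE.
have := sqr_iC; set I := iC => hI.
transitivity (- I / 2 * (a i j * (1 - I * I) / 2 + I * b i j)); first by field.
by rewrite hI; field.
Qed.

(** For a Hermitian A the complex numbers in the definition of
    [form_of_hermitian A] have no imaginary part to discard. *)
Lemma form_of_hermitianE n (A : 'M[R[i]]_n) :
  (forall i j, A j i = conjc (A i j)) ->
  form_of_hermitian A = realify ((2 * iC) *: A).
Proof.
move=> hA; apply/matrixP => a b; rewrite mxE.
have sumE (x y z t : 'I_n -> R[i]) : \sum_i \sum_j A i j * (x i * y j - z i * t j) =
   \sum_i \sum_j A i j * (x i * y j) - \sum_i \sum_j A i j * (z i * t j).
  rewrite -sumrB; apply: eq_bigr => i _; rewrite -sumrB; apply: eq_bigr => j _.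
  by rewrite mulrBr.
have pick (x y : 'I_n -> R[i]) (s t : R[i]) (k l : 'I_n) :
    (forall i, x i = s * (k == i)%:R) -> (forall j, y j = t * (l == j)%:R) ->
    \sum_i \sum_j A i j * (x i * y j) = A k l * (s * t).
  move=> hx hy; rewrite (bigD1 k) //= (bigD1 l) //= hx hy !eqxx !mulr1.
  rewrite !big1 ?addr0 //.
    move=> i /negPf ik; rewrite big1 // => j _.
    by rewrite hx eq_sym ik mulr0 mul0r mulr0.
  by move=> j /negPf jl; rewrite hy eq_sym jl !mulr0.
have dzl k i : dz_covector R i (lshift n k) = 1 * (k == i)%:R.
  by rewrite /dz_covector eq_lshift eq_lrshift mulr0 addr0 mul1r.
have dzr k i : dz_covector R i (rshift n k) = iC * (k == i)%:R.
  by rewrite /dz_covector eq_rshift eq_rlshift add0r.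
have cdzl k i : conjc (dz_covector R i (lshift n k)) = 1 * (k == i)%:R.
  by rewrite dzl rmorphM rmorph1 rmorph_nat.
have cdzr k i : conjc (dz_covector R i (rshift n k)) = (- iC) * (k == i)%:R.
  rewrite dzr rmorphM rmorph_nat; congr (_ * _).
  by apply/eqP; rewrite eq_complex /= oppr0 !eqxx.

case: (fintype.split_ordP a) => k ->; case: (fintype.split_ordP b) => l ->;
  rewrite sumE.
- rewrite (pick _ _ _ _ _ _ (dzl k) (cdzl l)) (pick _ _ _ _ _ _ (dzl l) (cdzl k)).
  rewrite /realify block_mxEul !mxE.
  by rewrite (hA k l); case: (A k l) => x y /=; ring.
- rewrite (pick _ _ _ _ _ _ (dzl k) (cdzr l)) (pick _ _ _ _ _ _ (dzr l) (cdzl k)).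
  rewrite /realify block_mxEur !mxE.
  by rewrite (hA k l); case: (A k l) => x y /=; ring.
- rewrite (pick _ _ _ _ _ _ (dzr k) (cdzl l)) (pick _ _ _ _ _ _ (dzl l) (cdzr k)).
  rewrite /realify block_mxEdl !mxE.
  by rewrite (hA k l); case: (A k l) => x y /=; ring.
- rewrite (pick _ _ _ _ _ _ (dzr k) (cdzr l)) (pick _ _ _ _ _ _ (dzr l) (cdzr k)).
  rewrite /realify block_mxEdr !mxE.
  by rewrite (hA k l); case: (A k l) => x y /=; ring.
Qed.

(** Both w and the form of A are realifications. Their Hermitian matrices differ
    from the underlying complex matrices by the same scalar, which cancels in the
    product with the inverse, and the real trace of a realification is twice the real
    part of the complex trace. *)
Lemma laplacian_half_trace n (w : 'M[R]_(n + n)) (A : 'M[R[i]]_n) :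
  Jmx R n *m w *m (Jmx R n)^T = w -> w \in unitmx ->
  (forall i j, A j i = conjc (A i j)) ->
  complex.Re (\sum_i \sum_j invmx (hermitian_of_form w) j i * A i j)
    = \tr (invmx w *m form_of_hermitian A) / 2.
Proof.
move=> /Jinvariant_realify[c ->] u hA.
rewrite form_of_hermitianE // invmx_realify // -realifyM trace_realify.
rewrite mulrAC mulfV ?pnatr_eq0 // mul1r; congr complex.Re.
have nz : - iC / 2 \is a GRing.unit.
  by rewrite unitfE mulf_neq0 ?invr_neq0 ?pnatr_eq0 // oppr_eq0 eq_complex /= oner_eq0 andbF.
rewrite hermitian_of_form_realify invmxZ //; last by rewrite unitmxZ // realify_unit.
rewrite exchange_big; apply: eq_bigr => j _; rewrite !mxE; apply: eq_bigr => i _.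
rewrite !mxE.
have -> : (- iC / 2)^-1 = 2 * iC.
  apply: (mulrI nz); rewrite divrr //; have := sqr_iC; set I := iC => hI.
  by transitivity (- (I * I)); [rewrite hI opprK | field].
ring.
Qed.

(** J preserves the standard form, whose Pfaffian does not vanish. *)
Lemma det_Jmx n : \det (Jmx R n) = 1.
Proof.
have nz : pfaffian_sum (std_form R n) != 0.
  by rewrite pfaffian_sum_std pnatr_eq0 -lt0n muln_gt0 expn_gt0 fact_gt0.
apply: (mulIf nz); rewrite -pfaffian_sum_congr -Jmx_std mul1r.
by rewrite -mulmxA mul_JmxT mulmx1.
Qed.

(** The square of the Pfaffian is the determinant, up to the normalisation of
    [pfaffian_sum]. J-invariance provides an explicit reduction to the standard
    form: over the complex numbers S w S^T = P J P^T, where S changes the basis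
    to the eigenvectors of J. Taking Pfaffians and determinants on both sides
    and using that det J = 1 eliminates det P. *)
Lemma sqr_pfaffian_sum n (w : 'M[R]_(n + n)) :
  Jmx R n *m w *m (Jmx R n)^T = w -> w^T = - w ->
  pfaffian_sum w ^+ 2 = (2 ^ n * n`!)%:R ^+ 2 * \det w.
Proof.
move=> /Jinvariant_realify[c ->] wT; apply: (fmorph_inj rc).
rewrite rmorphXn rmorphM rmorphXn rmorph_nat /= -det_map_mx -pfaffian_sum_map.
have [a [b [eab ec _ _]]] := complexify_realify c.
have : (map_mx rc (realify c))^T = - map_mx rc (realify c).
  by rewrite map_trmx wT map_mxN.
rewrite eab tr_block_mx opp_block_mx => /eq_block_mx[aT _ bT _].
have := sqr_iC; move: iC ec => I ec hI.
pose S : 'M[R[i]]_(n + n) := block_mx 1%:M (- I)%:M 1%:M I%:M.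
pose T : 'M[R[i]]_(n + n) := block_mx 1%:M 1%:M I%:M (- I)%:M.
pose P : 'M[R[i]]_(n + n) := block_mx (2 *: c) 0 0 1%:M.
have detS : \det S != 0.
  suff : \det (S *m T) != 0 by rewrite det_mulmx mulf_eq0 negb_or => /andP[].
  have -> : S *m T = 2%:M.
    rewrite /S /T mulmx_block !mul1mx -!scalar_mxM !mulrN !mulNr hI !opprK.
    by rewrite (rmorphN (@scalar_mx _ n)) !addrN -raddfD -scalar_mx_block.
  by rewrite det_scalar expf_neq0 // pnatr_eq0.
have SPJ : S *m block_mx a b (- b) a *m S^T = P *m std_form _ n *m P^T.
  rewrite /S /P /std_form !tr_block_mx !tr_scalar_mx !trmx0 !mulmx_block.
  rewrite !(mul0mx, mulmx0, addr0, add0r, mul1mx, mulmx1, mulNmx, mulmxN).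
  rewrite !(mul_scalar_mx, mul_mx_scalar, scalerN, scaleNr, opprK, scalerDr, scalerA).
  have cT : (2 *: c)^T = 2 *: (- a + I *: b).
    by rewrite linearZ ec linearD linearZ /= aT bT opprK.
  rewrite cT ec mulrN hI opprK.
  by congr block_mx; apply/matrixP => i j; rewrite !mxE; ring.
have := congr1 (@pfaffian_sum _ n) SPJ; have := congr1 determinant SPJ.
rewrite !pfaffian_sum_congr pfaffian_sum_std !det_mulmx !det_tr.
have -> : \det (std_form R[i] n) = 1.
  by rewrite -[1]/(rc 1) -(det_Jmx n) -det_map_mx /Jmx map_block_mx !map_mx0 map_mxN !map_mx1.
rewrite mulr1 => hdet hpf; apply: (mulfI (expf_neq0 2 detS)).
rewrite -exprMn hpf exprMn [\det P ^+ 2]expr2 -hdet; ring.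
Qed.

Lemma top_power_sqr n (w : 'M[R]_(n + n)) :
  Jmx R n *m w *m (Jmx R n)^T = w -> w^T = - w -> top_power w ^+ 2 = \det w.
Proof.
move=> wJ wT; rewrite /top_power -/(pfaffian_sum w) expr_div_n sqr_pfaffian_sum //.
by rewrite mulrAC divff ?mul1r // expf_neq0 // pnatr_eq0 -lt0n muln_gt0 expn_gt0 fact_gt0.
Qed.

Lemma posdef_unitmx m (g : 'M[R]_m) :
  (forall u : 'rV_m, u != 0 -> 0 < (u *m g *m u^T) 0 0) -> g \in unitmx.
Proof.
move=> pos; rewrite -row_free_unit -kermx_eq0; apply/negPn/negP => /rowV0Pn[v].
rewrite sub_kermx => /eqP vg vn0; have := pos v vn0.
by rewrite vg mul0mx mxE ltxx.
Qed.

(** By [top_power_sqr] the two sides agree up to sign. On the segment from the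
    standard form to w the associated symmetric matrix stays positive definite,
    so the top power, a polynomial in the parameter, has no zero; it is positive
    at the standard form, hence at w. *)
Lemma top_powerE n (w : 'M[R]_(n + n)) :
  Jmx R n *m w *m (Jmx R n)^T = w -> w^T = - w ->
  (forall u : 'rV_(n + n), u != 0 -> 0 < (u *m (w *m (Jmx R n)^T) *m u^T) 0 0) ->
  top_power w = Num.sqrt (\det (w *m (Jmx R n)^T)).
Proof.
move=> wJ wT wpos.
rewrite det_mulmx det_tr det_Jmx mulr1 -top_power_sqr // sqrtr_sqr ger0_norm //.
rewrite leNgt; apply/negP => wneg.
pose wt (t : R) := (1 - t) *: Jmx R n + t *: w.
have wt_neq0 t : 0 <= t <= 1 -> top_power (wt t) != 0.
  move=> /andP[t0 t1].
  have : top_power (wt t) ^+ 2 != 0; last by rewrite expf_eq0.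
  rewrite top_power_sqr; last 2 first.
  - by rewrite /wt mulmxDr mulmxDl -!scalemxAr -!scalemxAl wJ -mulmxA mul_JmxT mulmx1.
  - by rewrite /wt linearD !linearZ /= wT JmxT !scalerN opprD.
  suff : wt t *m (Jmx R n)^T \in unitmx.
    by rewrite unitmxE det_mulmx det_tr det_Jmx mulr1 unitfE.
  apply: posdef_unitmx => u u0.
  rewrite /wt mulmxDl -!scalemxAl mul_JmxT mulmxDr mulmxDl -!scalemxAr -!scalemxAl.
  rewrite mulmx1 [X in 0 < X]mxE [X in 0 < X + _]mxE [X in 0 < _ + X]mxE.
  have uu : 0 < (u *m u^T) 0 0.
    rewrite mxE lt0r sumr_ge0 ?andbT; last by move=> k _; rewrite mxE -expr2 sqr_ge0.
    apply: contraNneq u0 => /eqP; rewrite psumr_eq0; last by move=> k _; rewrite mxE -expr2 sqr_ge0.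
    move=> /allP h; apply/eqP/rowP => k; apply/eqP.
    have := h k (mem_index_enum _); rewrite !mxE mulf_eq0 orbb //.
  have := wpos u u0; case: (ltgtP t 1) t1 => // t1 _ wp.
    by rewrite ltr_pwDl ?mulr_gt0 ?subr_gt0 // mulr_ge0 // ltW.
  by rewrite t1 subrr mul0r add0r mul1r.
pose p : {poly R} := pfaffian_sum
  (map_mx polyC (Jmx R n) + 'X *: map_mx polyC (w - Jmx R n)).
have pE t : p.[t] = (2 ^ n * n`!)%:R * top_power (wt t).
  rewrite /top_power mulrC divfK; last first.
    by rewrite pnatr_eq0 -lt0n muln_gt0 expn_gt0 fact_gt0.
  rewrite -/(pfaffian_sum (wt t)) -[p.[t]]/(horner_eval t p) -pfaffian_sum_map.
  congr pfaffian_sum; apply/matrixP => i j; rewrite !mxE /= /horner_eval.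
  by rewrite hornerD hornerM hornerX !hornerC; ring.
have cpos : 0 < (2 ^ n * n`!)%:R :> R by rewrite ltr0n muln_gt0 expn_gt0 fact_gt0.
have [|x /andP[x0 x1] rx] := @poly_ivt R (- p) 0 1 ler01.
- rewrite !hornerN !pE oppr_le0 oppr_ge0 (pmulr_rle0 _ cpos) (pmulr_rge0 _ cpos).
  rewrite /wt subr0 subrr !scale0r !scale1r addr0 add0r (ltW wneg) andbT.
  rewrite /top_power -/(pfaffian_sum _) Jmx_std pfaffian_sum_std divr_ge0 ?ler0n //.
- have := wt_neq0 x; rewrite x0 x1 => /(_ isT) /eqP; apply.
  move: rx; rewrite rootN /root pE mulf_eq0 gt_eqF //= => /eqP //.
Qed.

End Realification.

(** * Lebesgue measure on R^m *)
Section BorelMaps.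

Lemma continuous_borel (X Y : ptopologicalType) (f : X -> Y) :
  continuous f -> measurable_fun [set: borel X] (f : borel X -> borel Y).
Proof.
move=> cf; apply: (@measurability _ _ (borel X) (borel Y) _ _ (@open Y)) => //.
move=> _ [U oU <-]; rewrite setTI; apply: sub_sigma_algebra.
by move/continuousP : cf; apply.
Qed.

Lemma open_borel (X : ptopologicalType) (U : set X) :
  open U -> measurable (U : set (borel X)).
Proof. exact: sub_sigma_algebra. Qed.

Lemma continuous_borel_real (X : ptopologicalType) (R : realType) (f : X -> R) :
  continuous f -> measurable_fun [set: borel X] (f : borel X -> R).
Proof.
move=> cf; apply: (@measurability _ _ (borel X) R setT f _ (RGenOInfty.measurableE R)).
move=> _ [_ [a ->] <-]; rewrite setTI; apply: open_borel.
by move/continuousP : cf; apply; exact: rray_open.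
Qed.

End BorelMaps.

Section RealVectors.
Variable R : realType.

(** Second countability of R^m, which makes the Borel sets of a product of
    coordinate spaces measurable for the product sigma-algebra. *)
Lemma open_rV_bigcup m (U : set 'rV[R]_m) : open U ->
  U = \bigcup_(q in [set q : 'rV[rat]_m * nat |
        ball (map_mx (ratr : rat -> R) q.1) (q.2.+1%:R^-1) `<=` U])
       ball (map_mx (ratr : rat -> R) q.1) (q.2.+1%:R^-1).
Proof.
move=> oU; apply/seteqP; split; last by move=> x [q qU]; apply: qU.
move=> x Ux; have /nbhs_ballP[e /= e0 xeU] := open_nbhs_nbhs (conj oU Ux).
have [k ke] : exists k : nat, (k.+1%:R^-1 : R) < e / 2.
  have [k _ /(_ k (leqnn k))] := near_infty_natSinv_lt (PosNum (divr_gt0 e0 (ltr0n R 2))).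
  by exists k.
have k0 : 0 < k.+1%:R^-1 :> R by rewrite invr_gt0 ltr0n.
have h (j : 'I_m) : {q : rat | `|x 0 j - ratr q| < (k.+1%:R^-1 : R)}.
  have lt : x 0 j - k.+1%:R^-1 < x 0 j + k.+1%:R^-1 by rewrite ltrBlDr -addrA ltrDl addr_gt0.
  apply: cid; have [q] := rat_in_itvoo lt.
  by rewrite in_itv /= => /andP[q1 q2]; exists q; rewrite distrC ltr_distl q1 q2.
have xq : ball (map_mx ratr (\row_j sval (h j)) : 'rV[R]_m) (k.+1%:R^-1) x.
  split=> // i j; rewrite !mxE ord1 /ball /= distrC.
  exact: svalP (h j).
exists (\row_j sval (h j), k) => //= y yq; apply: xeU => //.
have -> : e = e / 2 + e / 2 by field.
apply: (ball_triangle (ball_sym (le_ball (ltW ke) xq))).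
exact: (le_ball (ltW ke) yq).
Qed.

Definition cons_rV m (p : R * 'rV[R]_m) : 'rV[R]_(1 + m) :=
  row_mx (p.1%:M : 'rV[R]_1) p.2.

Lemma cons_rV0 m (p : R * 'rV[R]_m) : cons_rV p 0 (lshift m 0) = p.1.
Proof. by rewrite /cons_rV row_mxEl mxE eqxx. Qed.

Lemma cons_rVS m (p : R * 'rV[R]_m) j : cons_rV p 0 (rshift 1 j) = p.2 0 j.
Proof. by rewrite /cons_rV row_mxEr. Qed.

Lemma measurable_cons_rV m : @measurable_fun _ _ (measurableTypeR R * borel 'rV[R]_m)%type
  (borel 'rV[R]_(1 + m)) setT (@cons_rV m).
Proof.
apply: (@measurability _ _ _ (borel 'rV[R]_(1 + m)) setT _ (@open _)) => //.
move=> _ [U oU <-]; rewrite setTI (open_rV_bigcup oU) preimage_bigcup.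
rewrite bigcup_mkcond; apply: countable_bigcupT_measurable; first exact: countableP.
move=> q; case: ifPn => // _.
set c : 'rV[R]_(1 + m) := map_mx _ _; set r := _^-1.
have -> : @cons_rV m @^-1` ball c r =
    (ball (c 0 (lshift m 0)) r) `*` (ball (rsubmx c) r).
  have r0 : 0 < r by rewrite invr_gt0 ltr0n.
  apply/seteqP; split => [[t v]|[t v]] /=.
    move=> [_ h]; split; first by have := h 0 (lshift m 0); rewrite cons_rV0.
    by split=> // i j; have := h i (rshift 1 j); rewrite ord1 cons_rVS !mxE.
  move=> [ht [_ hv]]; split=> // i j; rewrite ord1; case: (fintype.split_ordP j) => k ->.
    by rewrite ord1 cons_rV0.
  by have := hv 0 k; rewrite cons_rVS mxE.
apply: measurableX; first by apply: open_measurable; exact: ball_open.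
by apply: open_borel; exact: ball_open.
Qed.

Lemma measurable_comp_cons d (Y : measurableType d) m (f : 'rV[R]_(1 + m) -> Y) :
  measurable_fun [set: borel 'rV[R]_(1 + m)] (f : borel 'rV[R]_(1 + m) -> Y) ->
  @measurable_fun _ _ (measurableTypeR R * borel 'rV[R]_m)%type Y setT (f \o @cons_rV m).
Proof.
move=> mf; apply: (@measurableT_comp _ _ _ (measurableTypeR R * borel 'rV[R]_m)%type
  (borel 'rV[R]_(1 + m)) Y f) => //; exact: measurable_cons_rV.
Qed.

Definition box m (r : R) : set 'rV[R]_m := [set x | `|x| <= r].
Arguments box : clear implicits.

Lemma closed_box m r : closed (box m r).
Proof.
rewrite (_ : box m r = (fun x : 'rV[R]_m => `|x|) @^-1` [set y | y <= r]) //.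
apply: preimage_closed => [x _|]; first exact: norm_continuous.
exact: closed_le.
Qed.

Lemma compact_box m r : compact (box m r).
Proof.
apply: bounded_closed_compact (@closed_box m r).
exists r; split; first exact: num_real.
by move=> M rM x /= xr; apply: le_trans xr (ltW rM).
Qed.

Lemma measurable_box m r : measurable (box m r : set (borel 'rV[R]_m)).
Proof.
rewrite -[box m r]setCK; apply: measurableC; apply: open_borel.
by rewrite openC; exact: closed_box.
Qed.

Lemma norm_rV_le m (x : 'rV[R]_m) r : 0 <= r ->
  (`|x| <= r) <-> (forall j, `|x 0 j| <= r).
Proof.
move=> r0; rewrite [in X in X <-> _]/Num.Def.normr/= mx_normrE; split.
  move=> h j; apply: le_trans h.
  exact: (le_bigmax _ (fun ij : 'I_1 * 'I_m => `|x ij.1 ij.2|) (0, j)).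
by move=> h; rewrite (bigmax_le _ r0)//= => -[i j] _ /=; rewrite ord1.
Qed.

Lemma le_norm_coord m (x : 'rV[R]_m) j : `|x 0 j| <= `|x|.
Proof. by move: j; apply/norm_rV_le. Qed.

Lemma cons_rV_shift_r m (t h : R) (v : 'rV[R]_m) (a : 'I_m) :
  h *: delta_mx 0 (rshift 1 a) + cons_rV (t, v) = cons_rV (t, h *: delta_mx 0 a + v).
Proof.
apply/rowP => j; rewrite !mxE; case: (fintype.split_ordP j) => k ->.
  by rewrite eq_lrshift /= mulr0 add0r.
by rewrite !mxE eq_rshift.
Qed.

Lemma cons_rV_shift_l m (t h : R) (v : 'rV[R]_m) :
  h *: delta_mx 0 (lshift m 0) + cons_rV (t, v) = cons_rV (h + t, v).
Proof.
apply/rowP => j; rewrite !mxE; case: (fintype.split_ordP j) => k ->.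
  by rewrite ord1 !mxE !eqxx /= mulr1.
by rewrite eq_rlshift /= mulr0 add0r.
Qed.

Lemma partial_cons_r m (G : 'rV[R]_(1 + m) -> R) a t v :
  partial (rshift 1 a) G (cons_rV (t, v)) = partial a (fun u => G (cons_rV (t, u))) v.
Proof.
by rewrite /partial /derive; under eq_fun do rewrite /= cons_rV_shift_r.
Qed.

Lemma derivable_cons_r m (G : 'rV[R]_(1 + m) -> R) a t v :
  derivable G (cons_rV (t, v)) (delta_mx 0 (rshift 1 a)) ->
  derivable (fun u => G (cons_rV (t, u))) v (delta_mx 0 a).
Proof.
by rewrite /derivable; under eq_fun do rewrite /= cons_rV_shift_r.
Qed.

Lemma partial_cons_l m (G : 'rV[R]_(1 + m) -> R) t v :
  partial (lshift m 0) G (cons_rV (t, v)) = 'D_1 (fun s => G (cons_rV (s, v))) t.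
Proof.
rewrite /partial /derive; under eq_fun do rewrite /= cons_rV_shift_l.
by under [in RHS]eq_fun do rewrite /= [_%:A]mulr1.
Qed.

Lemma derivable_cons_l m (G : 'rV[R]_(1 + m) -> R) t v :
  derivable G (cons_rV (t, v)) (delta_mx 0 (lshift m 0)) ->
  derivable (fun s => G (cons_rV (s, v))) t 1.
Proof.
rewrite /derivable; under eq_fun do rewrite /= cons_rV_shift_l.
by under [in X in _ -> X]eq_fun do rewrite /= [_%:A]mulr1.
Qed.

Lemma partial_eq0 m (G : 'rV[R]_m -> R) a (U : set 'rV[R]_m) x :
  open U -> U x -> (forall y, U y -> G y = 0) -> partial a G x = 0.
Proof.
move=> oU Ux G0; rewrite /partial -[RHS](@derive_cst R _ _ 0 x (delta_mx 0 a)).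
apply: near_eq_derive => //.
by near=> y; apply: G0; near: y; exact: open_nbhs_nbhs.
Unshelve. all: by end_near. Qed.

Lemma continuous_cons_rV_r m (t : R) : continuous (fun v : 'rV[R]_m => cons_rV (t, v)).
Proof.
move=> v A /nbhs_ballP[e /= e0 eA]; apply/nbhs_ballP; exists e => // u [_ vu].
apply: eA; split=> // i j; rewrite ord1; case: (fintype.split_ordP j) => k ->.
  by rewrite ord1 !cons_rV0 /=; exact: ballxx.
by rewrite !cons_rVS.
Qed.

Lemma continuous_cons_rV_l m (v : 'rV[R]_m) : continuous (fun t : R => cons_rV (t, v)).
Proof.
move=> t A /nbhs_ballP[e /= e0 eA]; apply/nbhs_ballP; exists e => // s ts.
apply: eA; split=> // i j; rewrite ord1; case: (fintype.split_ordP j) => k ->.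
  by rewrite ord1 !cons_rV0.
by rewrite !cons_rVS /=; exact: ballxx.
Qed.

(** The fundamental theorem of calculus on an interval containing the
    support. *)
Lemma integral_derive_compact (f : R -> R) (r : R) :
  (forall t, derivable f t 1) -> continuous (fun t => 'D_1 f t) ->
  (forall t, r < `|t| -> f t = 0) ->
  (\int[lebesgue_measure]_t ('D_1 f t)%:E = 0)%E.
Proof.
move=> df cf f0; pose b := `|r| + 1.
have rb : r < b by rewrite ltr_pwDr // ler_norm.
have b0 : 0 < b by rewrite ltr_pwDr.
have D0 t : ~ (`[(-b), b]%classic t) -> 'D_1 f t = 0.
  rewrite /= in_itv /= => tb.
  have rt : r < `|t|.
    by rewrite (lt_le_trans rb) // leNgt; apply/negP => /ltW; rewrite ler_norml.
  rewrite -(@derive_cst R _ _ 0 t 1); apply: near_eq_derive.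
  near=> s; apply: f0; near: s.
  by apply: (@cvgr_gt _ _ _ _ _ `|t|) => //; exact: norm_continuous.
rewrite (_ : (fun t => _) = (fun t => ('D_1 f t)%:E) \_ `[(-b), b]); last first.
  apply/funext => t; rewrite patchE; case: ifPn => //.
  by rewrite notin_setE => /D0 ->.
rewrite -integral_mkcond (@continuous_FTC2 _ (fun t => 'D_1 f t) f).
- by rewrite !f0 ?subee ?normrN // (lt_le_trans rb) // ler_norm.
- by rewrite gtrN.
- exact/continuous_subspaceT.
- have cF t : {for t, continuous f}.
    exact/differentiable_continuous/derivable1_diffP.
  by split; [move=> t _|apply: cvg_at_right_filter; exact: cF|apply: cvg_at_left_filter; exact: cF].
- by move=> t _; rewrite derive1E.
Unshelve. all: by end_near. Qed.

Lemma integrable_bounded_support d (T : measurableType d)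
    (mu : {measure set T -> \bar R}) (f : T -> R) (A : set T) (C : R) :
  measurable A -> (mu A < +oo)%E -> measurable_fun setT f ->
  (forall x, `|f x| <= C) -> (forall x, ~ A x -> f x = 0) ->
  mu.-integrable setT (EFin \o f).
Proof.
move=> mA muA mf fC f0.
rewrite (_ : EFin \o f = (EFin \o f) \_ A); last first.
  apply/funext => x; rewrite patchE; case: ifPn => //.
  by rewrite notin_setE /= => /f0 ->.
apply/(integrable_mkcond _ mA).1/measurable_bounded_integrable => //.
  exact: measurable_funTS.
exists C; split; first exact: num_real.
by move=> M CM x _ /=; exact: le_trans (fC x) (ltW CM).
Qed.

Lemma continuous_box_bounded m (f : 'rV[R]_m -> R) r :
  continuous f -> exists C, forall x, box m r x -> `|f x| <= C.
Proof.
move=> cf; have : compact (f @` box m r).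
  by apply: continuous_compact (@compact_box m r); exact: continuous_subspaceT.
move=> /compact_bounded [C [_ hC]]; exists (C + 1) => x xr.
by apply: (hC (C + 1)); [rewrite ltrDl|exists x].
Qed.

Lemma partial_support m (G : 'rV[R]_m -> R) a (r : R) x :
  (forall y, r < `|y| -> G y = 0) -> r < `|x| -> partial a G x = 0.
Proof.
move=> G0 rx; apply: (@partial_eq0 _ _ _ (~` box m r)).
- by rewrite openC; exact: closed_box.
- by rewrite /box /= => /(lt_le_trans rx); rewrite ltxx.
- by move=> y /= /negP; rewrite -ltNge; exact: G0.
Qed.

(** The properties of Lebesgue measure on R^m that are used below. The last one
    is the divergence theorem for a compactly supported field with a single
    nonzero component. *)
Definition lebesgue_like m (lam : {sigma_finite_measure set (borel 'rV[R]_m) -> \bar R}) :=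
  [/\ forall f : 'rV[R]_m -> \bar R, measurable_fun [set: borel 'rV[R]_m] (f : borel 'rV[R]_m -> \bar R) ->
        (forall x, (0 <= f x)%E) -> integral_rV f = (\int[lam]_x f x)%E,
      forall r, (lam (box m r) < +oo)%E &
      forall (G : 'rV[R]_m -> R) a (r : R),
        (forall x, derivable G x (delta_mx 0 a)) -> continuous (partial a G) ->
        (forall x, r < `|x| -> G x = 0) ->
        (\int[lam]_x (partial a G x)%:E = 0)%E].

Section ConsMeasure.
Context m (lam : {sigma_finite_measure set (borel 'rV[R]_m) -> \bar R}).
Hypothesis lamb : forall r, (lam (box m r) < +oo)%E.

Let lebR : {sigma_finite_measure set (measurableTypeR R) -> \bar R} := @lebesgue_measure R.

(** Product measure, transported from R x R^m to R^(1 + m). *)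
Definition cons_measure (B : set (borel 'rV[R]_(1 + m))) : \bar R :=
  (lebR \x lam)%E (@cons_rV m @^-1` B).

Let cons_measure0 : cons_measure set0 = 0%E.
Proof. by rewrite /cons_measure preimage_set0 measure0. Qed.

Let cons_measure_ge0 A : (0 <= cons_measure A)%E.
Proof. exact: measure_ge0. Qed.

Let cons_measure_sigma_additive : semi_sigma_additive cons_measure.
Proof.
move=> F mF tF mUF; rewrite /cons_measure preimage_bigcup.
apply: measure_semi_sigma_additive.
- by move=> n; rewrite -[X in measurable X]setTI; exact: measurable_cons_rV.
- apply/trivIsetP => /= i j _ _ ij; rewrite -preimage_setI.
  by move/trivIsetP : tF => /(_ _ _ _ _ ij) ->//; rewrite preimage_set0.
- by rewrite -preimage_bigcup -[X in measurable X]setTI; exact: measurable_cons_rV.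
Qed.

HB.instance Definition _ := isMeasure.Build _ _ _
  cons_measure cons_measure0 cons_measure_ge0 cons_measure_sigma_additive.

Lemma cons_measure_box r : (cons_measure (box (1 + m) r) < +oo)%E.
Proof.
have [r0|r0] := ltP r 0.
  rewrite (_ : box _ _ = set0) ?measure0 //.
  by apply/seteqP; split => // x /= xr; have := le_lt_trans xr r0; rewrite normr_lt0.
apply: (@le_lt_trans _ _ ((lebR \x lam)%E (`[(- r), r]%classic `*` box m r))).
  rewrite /cons_measure; apply: (@le_measure _ _ _ (lebR \x lam)%E); rewrite ?inE.
  - by rewrite -[X in measurable X]setTI; apply: measurable_cons_rV => //; exact: measurable_box.
  - by apply: measurableX => //; exact: measurable_box.
  move=> [t v] /= /(norm_rV_le _ r0) h; split => /=.
    by have := h (lshift m 0); rewrite cons_rV0 in_itv /= ler_norml.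
  by apply/(norm_rV_le _ r0) => j; have := h (rshift 1 j); rewrite cons_rVS.
rewrite product_measure1E //; last exact: measurable_box.
apply: lte_mul_pinfty => //.
have h : lebesgue_measure (`[(- r), r]%classic : set R) \is a fin_num.
  by rewrite lebesgue_measure_itv /=; case: ifP.
exact: h.
Qed.

Lemma cons_measure_sigma_finite : sigma_finite setT cons_measure.
Proof.
exists (fun i => box (1 + m) i%:R).
  apply/seteqP; split => // x _; exists (Num.truncn `|x|).+1 => //.
  by rewrite /box /= ltW // truncnS_gt.
by move=> i; split; [exact: measurable_box|exact: cons_measure_box].
Qed.

HB.instance Definition _ :=
  @Measure_isSigmaFinite.Build _ _ _ cons_measure cons_measure_sigma_finite.

(** For the derivative along the first coordinate, integrate over this
    coordinate first; for the other ones, integrate over the last m coordinates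
    first and use the property of lam. *)
Lemma cons_lebesgue_like : lebesgue_like lam -> lebesgue_like cons_measure.
Proof.
move=> [lamE _ lamD]; split.
- move=> f mf f0; transitivity (\int[lebR]_t \int[lam]_v f (cons_rV (t, v)))%E.
    apply: eq_integral => t _; rewrite -lamE //.
    apply: (@measurableT_comp _ _ _ (borel 'rV[R]_m) (borel 'rV[R]_(1 + m)) _ f) => //.
    exact: (@continuous_borel 'rV[R]_m 'rV[R]_(1 + m) _ (@continuous_cons_rV_r m t)).
  have mfc : measurable_fun setT (f \o @cons_rV m : measurableTypeR R * borel 'rV[R]_m -> \bar R).
    exact: measurable_comp_cons.
  rewrite -(@fubini_tonelli1 _ _ _ _ _ lebR lam (f \o @cons_rV m)) //; last first.
    by move=> x; exact: f0.
  by rewrite (@ge0_integral_pushforward _ _ _ _ _ _ (@measurable_cons_rV m) (lebR \x lam)%E) // => y _.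
- exact: cons_measure_box.
move=> G a r dG cG G0.
have mG : measurable_fun [set: borel 'rV[R]_(1 + m)] (partial a G : borel 'rV[R]_(1 + m) -> R).
  exact: continuous_borel_real.
have mGc : measurable_fun setT (partial a G \o @cons_rV m : measurableTypeR R * borel 'rV[R]_m -> R).
  exact: measurable_comp_cons.
have [C hC] := continuous_box_bounded r cG.
have iG : (lebR \x lam)%E.-integrable setT (EFin \o (partial a G \o @cons_rV m)).
  apply: (@integrable_bounded_support _ _ (lebR \x lam)%E (partial a G \o @cons_rV m) (@cons_rV m @^-1` box (1 + m) r) (Num.max C 0)) => //.
  - by rewrite -[X in measurable X]setTI; apply: measurable_cons_rV => //; exact: measurable_box.
  - exact: cons_measure_box.
  - move=> x; rewrite le_max; have [h|h] := leP `|cons_rV x| r.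
      by rewrite (hC _ h).
    by rewrite /= (partial_support _ G0) // normr0 lexx orbT.
  - by move=> x /= /negP; rewrite -ltNge => h; rewrite (partial_support _ G0).
rewrite (@integral_pushforward _ _ _ _ _ _ (@measurable_cons_rV m) (lebR \x lam)%E) //; last first.
  exact/measurable_EFinP.
rewrite preimage_setT.
case: (fintype.split_ordP a) => k ka; rewrite ka in dG cG iG mG mGc *.
  rewrite (ord1 k) in dG cG iG mG mGc *.
  rewrite -integral21_prod_meas1 //; apply: integral0_eq => v _.
  rewrite /fubini_G /=; under eq_integral do rewrite partial_cons_l.
  apply: (@integral_derive_compact _ r).
  - by move=> t; exact: derivable_cons_l.
  - rewrite (_ : (fun t => _) = partial (lshift m 0) G \o (fun t => cons_rV (t, v))).
      move=> t; apply: continuous_comp; first exact: continuous_cons_rV_l.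
      exact: cG.
    by apply/funext => t; rewrite /= partial_cons_l.
  - move=> t rt; apply: G0; apply: lt_le_trans rt _.
    by have := le_norm_coord (cons_rV (t, v)) (lshift m 0); rewrite cons_rV0.
rewrite -integral12_prod_meas1 //; apply: integral0_eq => t _.
rewrite /fubini_F /=; under eq_integral do rewrite partial_cons_r.
apply: (lamD _ _ r).
- by move=> v; exact: derivable_cons_r.
- rewrite (_ : partial k _ = partial (rshift 1 k) G \o (fun v => cons_rV (t, v))).
    move=> v; apply: continuous_comp; first exact: continuous_cons_rV_r.
    exact: cG.
  by apply/funext => v; rewrite /= partial_cons_r.
- move=> v rv; apply: G0; apply: lt_le_trans rv _.
  by apply/norm_rV_le => // j; have := le_norm_coord (cons_rV (t, v)) (rshift 1 j); rewrite cons_rVS.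
Qed.

End ConsMeasure.

(** R^0 is a point. *)
Lemma dirac_lebesgue_like : lebesgue_like (@dirac _ (borel 'rV[R]_0) 0 R).
Proof.
split.
- by move=> f mf _; rewrite integral_dirac // diracT mul1e.
- by move=> r; rewrite /dirac ltry.
- by move=> G [].
Qed.

Lemma ex_lebesgue_like m :
  exists lam : {sigma_finite_measure set (borel 'rV[R]_m) -> \bar R}, lebesgue_like lam.
Proof.
elim: m => [|m [lam lamP]]; first by exists (@dirac _ (borel 'rV[R]_0) 0 R); exact: dirac_lebesgue_like.
have [_ lamb _] := lamP.
exists (cons_measure lam).
exact: cons_lebesgue_like.
Unshelve. exact: lamb.
Qed.

End RealVectors.

(** * Calculus on coordinate spaces *)
Section Calculus.
Context (R : realType) (m : nat).
Local Notation V := 'rV[R]_m.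
Implicit Types (U : set V) (f g : V -> R) (k : 'I_m).

Lemma open_near U (P : V -> Prop) x : open U -> U x -> (forall y, U y -> P y) ->
  \forall y \near x, P y.
Proof. by move=> oU Ux h; apply: filterS h _; exact: open_nbhs_nbhs. Qed.

Lemma near_eq_differentiable f g x : (\forall y \near x, f y = g y) ->
  differentiable f x -> differentiable g x.
Proof.
move=> fg /diff_locallyP[cdf /eqaddoP o].
have gx : f x = g x := nbhs_singleton fg.
have o' : g \o shift x = cst (g x) + 'd f x +o_ 0 id.
  apply/eqaddoP => e e0; have := o e e0; move/nbhs0P: fg.
  apply: filterS2 => y fgy /=.
  by rewrite !fctE /= [y + x]addrC -fgy -gx.
apply/diff_locallyP; have dE : 'd g x = 'd f x :> (V -> R) by exact: diff_unique.
by split; rewrite dE.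
Qed.

Lemma continuous_eq_on U f g x : open U -> U x -> (forall y, U y -> f y = g y) ->
  {for x, continuous g} -> {for x, continuous f}.
Proof.
move=> oU Ux fg cg A; rewrite (fg _ Ux) => gA.
by apply: filterS2 (open_near oU Ux fg) (cg A gA) => y /= ->.
Qed.

Lemma partial_eq_on U f g k x : open U -> U x -> (forall y, U y -> f y = g y) ->
  partial k f x = partial k g x.
Proof.
by move=> oU Ux fg; apply: near_eq_derive; apply: (open_near oU Ux) => y /fg.
Qed.

(** The derivative of f exists and is continuous. On open sets this local form
    is stable under all the operations below, and unlike smoothness it holds for
    the bump functions of the partition of unity. *)
Definition C1_on U f := forall x, U x ->
  differentiable f x /\ forall k, {for x, continuous (partial k f)}.

Lemma partialD f g k x : differentiable f x -> differentiable g x ->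
  partial k (fun y => f y + g y) x = partial k f x + partial k g x.
Proof. by move=> df dg; apply: deriveD; exact: diff_derivable. Qed.

Lemma partialB f g k x : differentiable f x -> differentiable g x ->
  partial k (fun y => f y - g y) x = partial k f x - partial k g x.
Proof. by move=> df dg; apply: deriveB; exact: diff_derivable. Qed.

Lemma partialZ (c : R) f k x : differentiable f x ->
  partial k (fun y => c * f y) x = c * partial k f x.
Proof. by move=> df; apply: deriveZ; exact: diff_derivable. Qed.

Lemma partialM f g k x : differentiable f x -> differentiable g x ->
  partial k (fun y => f y * g y) x = f x * partial k g x + g x * partial k f x.
Proof. by move=> df dg; apply: deriveM; exact: diff_derivable. Qed.

Lemma partialV f k x : f x != 0 -> differentiable f x ->
  partial k (fun y => (f y)^-1) x = - (f x) ^- 2 * partial k f x.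
Proof. by move=> f0 df; apply: deriveV => //; exact: diff_derivable. Qed.

Lemma partial_cst (c : R) k x : partial k (fun _ : V => c) x = 0.
Proof. exact: derive_cst. Qed.

Lemma C1_cst U (c : R) : C1_on U (fun _ => c).
Proof.
move=> x Ux; split; first exact: differentiable_cst.
move=> k; rewrite (_ : partial k _ = cst 0); first exact: cst_continuous.
by apply/funext => y; rewrite partial_cst.
Qed.

Lemma C1_eq_on U f g : open U -> (forall y, U y -> f y = g y) -> C1_on U f -> C1_on U g.
Proof.
move=> oU fg Cf x Ux; have [df cf] := Cf x Ux; split.
  by apply: near_eq_differentiable df; exact: open_near oU Ux fg.
move=> k; apply: (continuous_eq_on oU Ux _ (cf k)) => y Uy.
by rewrite (partial_eq_on _ oU Uy fg).
Qed.

Lemma C1_continuous U f x : C1_on U f -> U x -> {for x, continuous f}.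
Proof. by move=> Cf /Cf[df _]; exact: differentiable_continuous. Qed.

Lemma C1D U f g : open U -> C1_on U f -> C1_on U g -> C1_on U (fun y => f y + g y).
Proof.
move=> oU Cf Cg x Ux; have [df cf] := Cf x Ux; have [dg cg] := Cg x Ux; split.
  exact: differentiableD.
move=> k; apply: (@continuous_eq_on U _ (fun y => partial k f y + partial k g y)) => //.
  by move=> y Uy; rewrite partialD //; [exact: (Cf y Uy).1|exact: (Cg y Uy).1].
exact: continuousD (cf k) (cg k).
Qed.

Lemma C1M U f g : open U -> C1_on U f -> C1_on U g -> C1_on U (fun y => f y * g y).
Proof.
move=> oU Cf Cg x Ux; have [df cf] := Cf x Ux; have [dg cg] := Cg x Ux; split.
  exact: differentiableM.
move=> k; apply: (@continuous_eq_on U _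
    (fun y => f y * partial k g y + g y * partial k f y)) => //.
  by move=> y Uy; rewrite partialM //; [exact: (Cf y Uy).1|exact: (Cg y Uy).1].
by apply: continuousD; apply: continuousM => //; exact: differentiable_continuous.
Qed.

Lemma C1V U f : open U -> C1_on U f -> (forall x, U x -> f x != 0) ->
  C1_on U (fun y => (f y)^-1).
Proof.
move=> oU Cf f0 x Ux; have [df cf] := Cf x Ux; split.
  by apply: differentiableV => //; exact: f0.
move=> k; apply: (@continuous_eq_on U _
    (fun y => - (f y)^-1 ^+ 2 * partial k f y)) => //.
  by move=> y Uy; rewrite partialV ?exprVn // ?f0 //; exact: (Cf y Uy).1.
have cfV : {for x, continuous (fun y => (f y)^-1)}.
  by apply: continuousV; [exact: f0|exact: differentiable_continuous].
by apply: continuousM; [apply: continuousN; exact: continuousM|exact: cf].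
Qed.

Lemma C1N U f : open U -> C1_on U f -> C1_on U (fun y => - f y).
Proof.
move=> oU Cf; apply: (@C1_eq_on U (fun y => -1 * f y)) => //.
  by move=> y _; rewrite mulN1r.
by apply: C1M => //; exact: C1_cst.
Qed.

Lemma C1_sum (I : Type) (r : seq I) (P : pred I) U (F : I -> V -> R) : open U ->
  (forall i, C1_on U (F i)) -> C1_on U (fun y => \sum_(i <- r | P i) F i y).
Proof.
move=> oU CF; elim: r => [|i r IH].
  by under eq_fun do rewrite big_nil; exact: C1_cst.
under eq_fun do rewrite big_cons.
case: (P i); last exact: IH.
by apply: C1D; [exact: oU|exact: CF|exact: IH].
Qed.

Lemma C1_prod (I : Type) (r : seq I) (P : pred I) U (F : I -> V -> R) : open U ->
  (forall i, C1_on U (F i)) -> C1_on U (fun y => \prod_(i <- r | P i) F i y).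
Proof.
move=> oU CF; elim: r => [|i r IH].
  by under eq_fun do rewrite big_nil; exact: C1_cst.
under eq_fun do rewrite big_cons.
case: (P i); last exact: IH.
by apply: C1M; [exact: oU|exact: CF|exact: IH].
Qed.

Lemma partial_sum (I : Type) (r : seq I) (P : pred I) (F : I -> V -> R) k x :
  (forall i, differentiable (F i) x) ->
  partial k (fun y => \sum_(i <- r | P i) F i y) x = \sum_(i <- r | P i) partial k (F i) x.
Proof.
move=> dF.
suff [] : differentiable (fun y => \sum_(i <- r | P i) F i y) x /\
  partial k (fun y => \sum_(i <- r | P i) F i y) x = \sum_(i <- r | P i) partial k (F i) x by [].
elim: r => [|i r [IH1 IH2]].
  under eq_fun do rewrite big_nil.
  by rewrite big_nil partial_cst; split => //; exact: differentiable_cst.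
under eq_fun do rewrite big_cons.
rewrite big_cons; case: (P i) => //; split; first exact: differentiableD.
by rewrite partialD // IH2.
Qed.

Lemma smooth_C1 U f : open U -> smooth_on U f -> C1_on U f.
Proof.
move=> oU sf x Ux; split; first exact: (sf [::]).
by move=> k; apply: differentiable_continuous; exact: (sf [:: k]).
Qed.

Lemma smooth_partial U f k : smooth_on U f -> smooth_on U (partial k f).
Proof. by move=> sf s x Ux; have := sf (rcons s k) x Ux; rewrite foldr_rcons. Qed.

Lemma derive_line f (k : 'I_m) y (s : R) : differentiable f (s *: delta_mx 0 k + y) ->
  is_derive s (1 : R) (fun t : R => f (t *: delta_mx 0 k + y))
    (partial k f (s *: delta_mx 0 k + y)).
Proof.
move=> df; have e : (fun h : R => h^-1 *: ((f \o shift (s *: delta_mx 0 k + y))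
      (h *: delta_mx 0 k) - f (s *: delta_mx 0 k + y))) =
  (fun h => h^-1 *: (((fun t : R => f (t *: delta_mx 0 k + y)) \o shift s) (h *: (1 : R))
      - f (s *: delta_mx 0 k + y))).
  by apply/funext => h /=; rewrite addrA -scalerDl [_%:A]mulr1.
have := diff_derivable (v := delta_mx 0 k) df; rewrite /derivable e => dl.
by apply: DeriveDef => //; rewrite /partial /derive e.
Qed.

Lemma mvt_line f (k : 'I_m) y (h : R) : 0 < h ->
  (forall s, 0 <= s <= h -> differentiable f (s *: delta_mx 0 k + y)) ->
  exists2 c, 0 < c < h & f (h *: delta_mx 0 k + y) - f y =
     h * partial k f (c *: delta_mx 0 k + y).
Proof.
move=> h0 df; have [||c ch E] := @MVT R (fun t => f (t *: delta_mx 0 k + y))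
    (fun t => partial k f (t *: delta_mx 0 k + y)) 0 h h0.
- move=> s; rewrite in_itv /= => /andP[s0 sh].
  by apply: derive_line; apply: df; rewrite !ltW.
- apply: derivable_within_continuous => s; rewrite in_itv /= => sh.
  by have [] := derive_line (df s sh).
exists c; first by move: ch; rewrite in_itv.
by move: E; rewrite scale0r add0r subr0 mulrC.
Qed.

Lemma partial_shift f (k : 'I_m) (v y : V) :
  partial k (fun u => f (v + u)) y = partial k f (v + y).
Proof.
by rewrite /partial /derive; under eq_fun do rewrite /= addrCA.
Qed.

Lemma differentiable_shift f (v y : V) :
  differentiable f (v + y) -> differentiable (fun u => f (v + u)) y.
Proof.
move=> df; apply: (@differentiable_comp _ _ _ _ (fun u => v + u) f) => //.
Qed.

(** The mean value theorem, once in each direction. The increments u and v are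
    variables with equations, so that the same second difference is recognised
    when the roles of a and b are exchanged. *)
Lemma second_difference f (a b : 'I_m) (x u v : V) (h : R) : 0 < h ->
  u = h *: delta_mx 0 a -> v = h *: delta_mx 0 b ->
  (forall s t, 0 <= s <= h -> 0 <= t <= h ->
     differentiable f (t *: delta_mx 0 b + (s *: delta_mx 0 a + x)) /\
     differentiable (partial a f) (t *: delta_mx 0 b + (s *: delta_mx 0 a + x))) ->
  exists s t, [/\ 0 < s < h, 0 < t < h &
    f (v + (u + x)) - f (u + x) - f (v + x) + f x =
    h * (h * partial b (partial a f) (t *: delta_mx 0 b + (s *: delta_mx 0 a + x)))].
Proof.
move=> h0 hu hv df; rewrite hu hv; have hh : 0 <= h <= h by rewrite lexx ltW.
have h00 : 0 <= (0 : R) <= h by rewrite lexx ltW.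
pose g u := f (h *: delta_mx 0 b + u) - f u.
have [|s sh Es] := @mvt_line g a x h h0.
  move=> s sh; apply: differentiableB.
    by apply: differentiable_shift; exact: (df s h sh hh).1.
  by have := (df s 0 sh h00).1; rewrite scale0r add0r.
have s01 : 0 <= s <= h by case/andP: sh => ? ?; rewrite !ltW.
have [|t th Et] := @mvt_line (partial a f) b (s *: delta_mx 0 a + x) h h0.
  by move=> t th; exact: (df s t s01 th).2.
exists s, t; split => //; rewrite -Et.
have <- : partial a g (s *: delta_mx 0 a + x) = partial a f (h *: delta_mx 0 b + (s *: delta_mx 0 a + x)) -
    partial a f (s *: delta_mx 0 a + x).
  rewrite -(partial_shift f a (h *: delta_mx 0 b)); apply: partialB.
    by apply: differentiable_shift; exact: (df s h s01 hh).1.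
  by have := (df s 0 s01 h00).1; rewrite scale0r add0r.
rewrite -Es /g; lra.
Qed.

(** The second difference is symmetric in the two directions, so it expresses
    both mixed derivatives, at two points of the same small square. *)
Lemma schwarz_points f (a b : 'I_m) (x : V) (h : R) : 0 < h ->
  (forall i j s t, 0 <= s <= h -> 0 <= t <= h ->
     differentiable f (t *: delta_mx 0 j + (s *: delta_mx 0 i + x)) /\
     forall k, differentiable (partial k f) (t *: delta_mx 0 j + (s *: delta_mx 0 i + x))) ->
  exists s t s' t', [/\ 0 <= s <= h, 0 <= t <= h, 0 <= s' <= h, 0 <= t' <= h &
    partial b (partial a f) (t *: delta_mx 0 b + (s *: delta_mx 0 a + x)) =
    partial a (partial b f) (t' *: delta_mx 0 a + (s' *: delta_mx 0 b + x))].
Proof.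
move=> h0 df.
have [u hu] : exists u : V, u = h *: delta_mx 0 a by eexists.
have [v hv] : exists v : V, v = h *: delta_mx 0 b by eexists.
have [|s [t [sd td E]]] := second_difference h0 hu hv (x := x) (f := f).
  by move=> s t sh th; have [? ?] := df a b s t sh th.
have [|s' [t' [sd' td' E']]] := second_difference h0 hv hu (x := x) (f := f).
  by move=> s' t' sh th; have [? ?] := df b a s' t' sh th.
have wd w : 0 < w < h -> 0 <= w <= h by move=> /andP[? ?]; rewrite !ltW.
exists s, t, s', t'; split; [exact: wd|exact: wd|exact: wd|exact: wd|].
apply: (mulfI (lt0r_neq0 h0)); apply: (mulfI (lt0r_neq0 h0)).
move: E E'; move: (partial b _ _) (partial a _ _) => p q <- <-.
by rewrite (addrCA v u x); congr (_ + _); exact: addrAC.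
Qed.

Lemma dist_le_common (p q z e : R) :
  `|p - z| < e / 2 -> `|q - z| < e / 2 -> `|q - p| <= e.
Proof.
by rewrite !ltr_norml ler_norml => /andP[? ?] /andP[? ?]; apply/andP; split; lra.
Qed.

(** Symmetry of second derivatives: let the squares of [schwarz_points] shrink
    to x. *)
Lemma schwarz U f (a b : 'I_m) x : open U -> U x -> smooth_on U f ->
  partial a (partial b f) x = partial b (partial a f) x.
Proof.
move=> oU Ux sf.
have /nbhs_ballP[r /= r0 rU] := open_nbhs_nbhs (conj oU Ux).
have c1 : {for x, continuous (partial a (partial b f))}.
  by apply: differentiable_continuous; exact: (sf [:: a; b]).
have c2 : {for x, continuous (partial b (partial a f))}.
  by apply: differentiable_continuous; exact: (sf [:: b; a]).
apply/eqP; rewrite -subr_eq0 -normr_eq0; apply/eqP/le_anti; rewrite normr_ge0 andbT.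
apply/ler_addgt0Pr => e e0; rewrite add0r.
have e2 : 0 < e / 2 by rewrite divr_gt0.
have /nbhs_ballP[r1 /= r10 h1] := c1 _ (nbhsx_ballx _ _ e2).
have /nbhs_ballP[r2 /= r20 h2] := c2 _ (nbhsx_ballx _ _ e2).
pose d := Num.min r (Num.min r1 r2) / 3.
have d0 : 0 < d by rewrite divr_gt0 // !lt_min r0 r10.
have near (i j : 'I_m) s t : 0 <= s <= d -> 0 <= t <= d ->
    ball x (Num.min r (Num.min r1 r2)) (t *: delta_mx 0 j + (s *: delta_mx 0 i + x)).
  move=> /andP[s0 sd] /andP[t0 td]; split; first by rewrite !lt_min r0 r10.
  move=> k l; rewrite ord1 !mxE /ball /= distrC addrA addrK.
  have bnd (u : R) (c : bool) : 0 <= u <= d -> `|u * c%:R| <= d.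
    by move=> /andP[u0 ud]; case: c; rewrite ?mulr1 ?mulr0 ?normr0 ?ger0_norm // ltW.
  apply: le_lt_trans (ler_normD _ _) _; apply: (@le_lt_trans _ _ (d + d)).
    by apply: lerD; apply: bnd; apply/andP.
  have -> : Num.min r (Num.min r1 r2) = d * 3 by rewrite /d divfK.
  lra.
have sub y : ball x (Num.min r (Num.min r1 r2)) y -> [/\ U y, ball x r1 y & ball x r2 y].
  move=> xy; split; [apply: rU|idtac|idtac]; apply: (le_ball _ xy);
    by rewrite !ge_min lexx ?orbT.
clearbody d.
have [|s [t [s' [t' [sd td sd' td' E]]]]] := @schwarz_points f a b x d d0.
  move=> i j s t sd td; have [Uy _ _] := sub _ (near i j s t sd td).
  by split; [exact: (sf [::])|move=> k; exact: (sf [:: k])].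
have [_ _ y2] := sub _ (near a b s t sd td).
have [_ y1 _] := sub _ (near b a s' t' sd' td').
have := h1 _ y1; have := h2 _ y2; rewrite /ball /= E.
exact: dist_le_common.
Qed.

End Calculus.

(** * Matrix-valued functions and closed forms *)
Section MatrixCalculus.
Context (R : realType) (m : nat).
Local Notation V := 'rV[R]_m.
Implicit Types (U : set V) (k : 'I_m).

Definition pmx p q k (F : V -> 'M[R]_(p, q)) x : 'M[R]_(p, q) :=
  \matrix_(i, j) partial k (fun y => F y i j) x.

Definition diffmx p q (F : V -> 'M[R]_(p, q)) x :=
  forall i j, differentiable (fun y => F y i j) x.

Definition C1mx p q U (F : V -> 'M[R]_(p, q)) :=
  forall i j, C1_on U (fun y => F y i j).

Lemma C1mx_diff p q U (F : V -> 'M[R]_(p, q)) x : C1mx U F -> U x -> diffmx F x.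
Proof. by move=> CF Ux i j; have [] := CF i j x Ux. Qed.

Lemma C1mx_mul p q r U (F : V -> 'M[R]_(p, q)) (G : V -> 'M[R]_(q, r)) :
  open U -> C1mx U F -> C1mx U G -> C1mx U (fun y => F y *m G y).
Proof.
move=> oU CF CG i j; under eq_fun do rewrite mxE.
by apply: C1_sum => // k; apply: C1M; [exact: oU|exact: CF|exact: CG].
Qed.

Lemma C1_trace p U (F : V -> 'M[R]_p) : open U -> C1mx U F ->
  C1_on U (fun y => \tr (F y)).
Proof. by move=> oU CF; apply: C1_sum => // i; exact: CF. Qed.

Lemma C1_det p U (F : V -> 'M[R]_p) : open U -> C1mx U F ->
  C1_on U (fun y => \det (F y)).
Proof.
move=> oU CF; apply: C1_sum => // s; apply: C1M => //; first exact: C1_cst.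
by apply: C1_prod => // i; exact: CF.
Qed.

Lemma C1mx_adj p U (F : V -> 'M[R]_p) : open U -> C1mx U F ->
  C1mx U (fun y => \adj (F y)).
Proof.
move=> oU CF i j; under eq_fun do rewrite mxE.
apply: C1M => //; first exact: C1_cst.
apply: C1_det => // a b; under eq_fun do rewrite !mxE.
exact: CF.
Qed.

Lemma C1mx_inv p U (F : V -> 'M[R]_p) : open U -> C1mx U F ->
  (forall x, U x -> F x \in unitmx) -> C1mx U (fun y => invmx (F y)).
Proof.
move=> oU CF uF i j.
apply: (@C1_eq_on _ _ U (fun y => (\det (F y))^-1 * (\adj (F y)) i j)) => //.
  by move=> y Uy; rewrite /invmx uF // [RHS]mxE.
apply: C1M => //; last exact: C1mx_adj.
apply: C1V => //; first exact: C1_det.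
by move=> x /uF; rewrite unitmxE unitfE.
Qed.

Lemma pmxM p q r k (F : V -> 'M[R]_(p, q)) (G : V -> 'M[R]_(q, r)) x :
  diffmx F x -> diffmx G x ->
  pmx k (fun y => F y *m G y) x = pmx k F x *m G x + F x *m pmx k G x.
Proof.
move=> dF dG; apply/matrixP => i j; rewrite !mxE.
under [X in partial k X]eq_fun do rewrite mxE.
rewrite partial_sum; last by move=> l; apply: differentiableM; [exact: dF|exact: dG].
rewrite -big_split; apply: eq_bigr => l _ /=.
rewrite partialM; [|exact: dF|exact: dG].
by rewrite !mxE addrC; congr (_ + _); rewrite mulrC.
Qed.

Lemma pmxZ p q k (s : V -> R) (F : V -> 'M[R]_(p, q)) x :
  differentiable s x -> diffmx F x ->
  pmx k (fun y => s y *: F y) x = partial k s x *: F x + s x *: pmx k F x.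
Proof.
move=> ds dF; apply/matrixP => i j; rewrite !mxE.
under [X in partial k X]eq_fun do rewrite mxE.
rewrite partialM; [|exact: ds|exact: dF].
by rewrite addrC; congr (_ + _); rewrite mulrC.
Qed.

Lemma pmxB p q k (F G : V -> 'M[R]_(p, q)) x : diffmx F x -> diffmx G x ->
  pmx k (fun y => F y - G y) x = pmx k F x - pmx k G x.
Proof.
move=> dF dG; apply/matrixP => i j; rewrite !mxE.
under [X in partial k X]eq_fun do rewrite !mxE.
by rewrite partialB; [|exact: dF|exact: dG].
Qed.

Lemma partial_trace p k (F : V -> 'M[R]_p) x : diffmx F x ->
  partial k (fun y => \tr (F y)) x = \tr (pmx k F x).
Proof.
move=> dF; rewrite /mxtrace partial_sum; last by move=> i; exact: dF.
by apply: eq_bigr => i _; rewrite mxE.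
Qed.

Lemma partial_prod (I : finType) k (F : I -> V -> R) x :
  (forall i, differentiable (F i) x) ->
  partial k (fun y => \prod_i F i y) x =
    \sum_j partial k (F j) x * \prod_(i | i != j) F i x.
Proof.
move=> dF.
have gen (r : seq I) : uniq r ->
  differentiable (fun y => \prod_(i <- r) F i y) x /\
  partial k (fun y => \prod_(i <- r) F i y) x =
    \sum_(j <- r) partial k (F j) x * \prod_(i <- r | i != j) F i x.
  elim: r => [_|i r IH /= /andP[ir ur]].
    under eq_fun do rewrite big_nil.
    by rewrite big_nil partial_cst; split => //; exact: differentiable_cst.
  have [d1 e1] := IH ur.
  under eq_fun do rewrite big_cons.
  split; first exact: differentiableM.
  rewrite partialM // e1 big_cons addrC; congr (_ + _).
    rewrite mulrC; congr (_ * _); rewrite big_cons eqxx /=.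
    rewrite big_seq [RHS]big_seq_cond; apply: eq_bigl => j /=.
    by case: (boolP (j \in r)) => //= jr; apply/esym; apply: contraNneq ir => <-.
  rewrite big_distrr big_seq [RHS]big_seq; apply: eq_bigr => j jr /=.
  rewrite big_cons ifT; last by apply: contraNneq ir => ->.
  by rewrite mulrCA.
by have [] := gen (index_enum I) (index_enum_uniq I).
Qed.

(** Jacobi's formula. *)
Lemma partial_det p k (F : V -> 'M[R]_p) x : diffmx F x ->
  partial k (fun y => \det (F y)) x = \tr (\adj (F x) *m pmx k F x).
Proof.
move=> dF.
have dprod (s : 'S_p) : differentiable (fun y => \prod_i F y i (s i)) x.
  rewrite (_ : (fun y => _) = fun y => \big[*%R/1]_(i <- index_enum 'I_p) F y i (s i)) //.
  elim: (index_enum _) => [|i r IH].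
    by under eq_fun do rewrite big_nil; exact: differentiable_cst.
  by under eq_fun do rewrite big_cons; apply: differentiableM; [exact: dF|exact: IH].
rewrite /determinant partial_sum; last first.
  by move=> s; apply: differentiableM; [exact: differentiable_cst|exact: dprod].
pose M j : 'M[R]_p := \matrix_(i, l) if i == j then pmx k F x j l else F x i l.
transitivity (\sum_j \det (M j)).
  rewrite exchange_big; apply: eq_bigr => s _ /=.
  rewrite partialZ; last exact: dprod.
  rewrite -big_distrr partial_prod /=; last by move=> i; exact: dF.
  congr (_ * _); apply: eq_bigr => j _; rewrite [RHS](bigD1 j) //= !mxE eqxx.
  by congr (_ * _); apply: eq_bigr => i ij; rewrite mxE (negPf ij).
rewrite /mxtrace; under [RHS]eq_bigr do rewrite mxE.
rewrite [RHS]exchange_big; apply: eq_bigr => j _.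
rewrite (expand_det_row (M j) j); apply: eq_bigr => l _.
rewrite [X in X * _]mxE eqxx mulrC [\adj _ _ _]mxE; congr (_ * _).
rewrite /cofactor; congr (_ * \det _); apply/matrixP => a b; rewrite !mxE.
by rewrite eq_sym (negPf (neq_lift _ _)).
Qed.

Lemma pmx_inv p k U (F : V -> 'M[R]_p) x : open U -> C1mx U F ->
  (forall x, U x -> F x \in unitmx) -> U x ->
  pmx k (fun y => invmx (F y)) x = - (invmx (F x) *m pmx k F x *m invmx (F x)).
Proof.
move=> oU CF uF Ux.
have CG := C1mx_inv oU CF uF.
have : pmx k (fun y => invmx (F y) *m F y) x = 0.
  apply/matrixP => i j; rewrite !mxE.
  rewrite (@partial_eq_on _ _ U _ (fun _ => (1%:M : 'M[R]_p) i j)) ?partial_cst //.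
  by move=> y Uy; rewrite mulVmx // uF.
rewrite pmxM; [|exact: (C1mx_diff CG)|exact: (C1mx_diff CF)].
move=> /(congr1 (mulmx^~ (invmx (F x)))); rewrite mul0mx mulmxDl mulmxK ?uF //.
by move=> /eqP; rewrite addr_eq0 => /eqP.
Qed.

(** Logarithmic derivative of the square root of a determinant, obtained by
    differentiating D^2 so that no sign has to be known. *)
Lemma partial_sqrt_det p k U (F : V -> 'M[R]_p) (D : V -> R) x : open U ->
  C1mx U F -> (forall x, U x -> F x \in unitmx) -> C1_on U D ->
  (forall x, U x -> D x ^+ 2 = \det (F x)) -> U x ->
  partial k D x = D x * (\tr (invmx (F x) *m pmx k F x) / 2).
Proof.
move=> oU CF uF CD D2 Ux; have dD : differentiable D x by have [] := CD x Ux.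
have D0 : D x != 0.
  by have := uF x Ux; rewrite unitmxE unitfE -D2 // expf_eq0.
have : partial k (fun y => D y * D y) x = \det (F x) * \tr (invmx (F x) *m pmx k F x).
  rewrite (@partial_eq_on _ _ U _ (fun y => \det (F y))) //.
  rewrite partial_det; last exact: (C1mx_diff CF).
  rewrite /invmx uF // -scalemxAl linearZ /= mulrA mulfV ?mul1r //.
  by have := uF x Ux; rewrite unitmxE unitfE.
rewrite partialM // -D2 //; set t := \tr _ => E.
by apply: (mulfI D0); lra.
Qed.

(** Contracting the cyclic identity of a closed 2-form with a bivector W: two of
    the three terms coincide by antisymmetry. This is how closedness enters all
    the divergence computations. *)
Lemma closed_contraction (c : 'I_m -> 'M[R]_m) (W : 'M[R]_m) q :
  (forall a, (c a)^T = - c a) ->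
  (forall a b k, c a b k + c b k a + c k a b = 0) -> W^T = - W ->
  \sum_a (W *m c a) a q = \tr (W *m c q) / 2.
Proof.
move=> cT cc WT.
have cA a i j : c a i j = - c a j i by have /matrixP/(_ j i) := cT a; rewrite !mxE.
have WA i j : W i j = - W j i by have /matrixP/(_ j i) := WT; rewrite !mxE.
have e1 : \sum_a (W *m c a) a q = \sum_a \sum_p W a p * c a p q.
  by apply: eq_bigr => a _; rewrite mxE.
have e2 : \sum_a (W *m c a) a q = \sum_a \sum_p W a p * c p q a.
  rewrite e1 exchange_big; apply: eq_bigr => a _; apply: eq_bigr => p _.
  by rewrite WA (cA p) mulrNN.
have e3 : \tr (W *m c q) = - \sum_a \sum_p W a p * c q a p.
  rewrite /mxtrace -sumrN; apply: eq_bigr => a _; rewrite mxE -sumrN.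
  by apply: eq_bigr => p _; rewrite (cA q p) mulrN.
apply: (mulIf (_ : 2 != 0 :> R)); first by rewrite pnatr_eq0.
rewrite divfK ?pnatr_eq0 // mulr_natr mulr2n {1}e1 e2 e3.
apply/eqP; rewrite -addr_eq0 -big_split -big_split big1 //= => a _.
rewrite -!big_split big1 //= => p _.
by rewrite -!mulrDr cc mulr0.
Qed.

Lemma antisym_inv (w : 'M[R]_m) : w \in unitmx -> w^T = - w ->
  (invmx w)^T = - invmx w.
Proof.
move=> uw wT; rewrite trmx_inv wT -scaleN1r invmxZ ?invrN1 ?scaleN1r //.
by rewrite -scaleN1r unitmxZ ?unitrN1.
Qed.

(** The bivector Psi that is dual, up to a constant, to b /\ w^(n-2) with respect
    to the volume form w^n / n!. *)
Definition bivector (w b : 'M[R]_m) : 'M[R]_m :=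
  (\tr (invmx w *m b) / 2) *: invmx w - invmx w *m b *m invmx w.

Lemma C1mx_bivector U (F B : V -> 'M[R]_m) : open U -> C1mx U F -> C1mx U B ->
  (forall x, U x -> F x \in unitmx) -> C1mx U (fun y => bivector (F y) (B y)).
Proof.
move=> oU CF CB uF i j; have CW := C1mx_inv oU CF uF.
rewrite (_ : (fun y => _) = fun y => \tr (invmx (F y) *m B y) * 2^-1 * invmx (F y) i j
  + - (invmx (F y) *m B y *m invmx (F y)) i j); last by apply/funext => y; rewrite !mxE.
apply: C1D => //.
  apply: C1M => //; apply: C1M => //; last exact: C1_cst.
  by apply: (C1_trace oU); exact: (C1mx_mul oU CW CB).
apply: (C1N oU); exact: (C1mx_mul oU (C1mx_mul oU CW CB) CW).
Qed.

Lemma pmx_bivector U (F B : V -> 'M[R]_m) k x : open U -> C1mx U F -> C1mx U B ->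
  (forall x, U x -> F x \in unitmx) -> U x ->
  let W := invmx (F x) in let b := B x in
  let w' := pmx k F x in let b' := pmx k B x in
  pmx k (fun y => bivector (F y) (B y)) x =
    ((\tr (W *m b') - \tr (W *m b *m W *m w')) / 2) *: W
    - (\tr (W *m b) / 2) *: (W *m w' *m W)
    + W *m w' *m (W *m b *m W) - W *m b' *m W + W *m b *m W *m w' *m W.
Proof.
move=> oU CF CB uF Ux W b w' b'.
have CW := C1mx_inv oU CF uF; have CWB := C1mx_mul oU CW CB.
have dW := C1mx_diff CW Ux; have dWB := C1mx_diff CWB Ux.
have dB := C1mx_diff CB Ux.
have CT : C1_on U (fun y => \tr (invmx (F y) *m B y)) by exact: C1_trace.
have dT : differentiable (fun y => \tr (invmx (F y) *m B y)) x by have [] := CT x Ux.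
have CT2 : C1_on U (fun y => \tr (invmx (F y) *m B y) / 2).
  by apply: C1M => //; exact: C1_cst.
have CTW : C1mx U (fun y => (\tr (invmx (F y) *m B y) / 2) *: invmx (F y)).
  by move=> i j; under eq_fun do rewrite mxE; exact: C1M.
have CWBW := C1mx_mul oU CWB CW.
have eW : pmx k (fun y => invmx (F y)) x = - (W *m w' *m W) := pmx_inv k oU CF uF Ux.
have eWB : pmx k (fun y => invmx (F y) *m B y) x = - (W *m w' *m W *m b) + W *m b'.
  by rewrite pmxM // eW mulNmx.
rewrite pmxB; [|exact: C1mx_diff CTW Ux|exact: C1mx_diff CWBW Ux].
rewrite pmxM // pmxZ //; last by have [] := CT2 x Ux.
have -> : partial k (fun y => \tr (invmx (F y) *m B y) / 2) x =
   (\tr (W *m b') - \tr (W *m b *m W *m w')) / 2.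
  rewrite partialM ?partial_cst ?mulr0 ?add0r //.
  rewrite partial_trace // eWB mulrC linearD linearN /= addrC; congr ((_ - _) / _).
  by rewrite -mulmxA mxtrace_mulC mulmxA.
rewrite eWB eW -/W -/b scalerN mulmxDl mulmxN !mulNmx !mulmxA !opprD !opprK !addrA.
by rewrite addrAC.
Qed.

(** The closedness of b /\ w^(n-2), in coordinates. Differentiating D Psi gives
    traces tr (W d_a w) from D and from Psi, and products such as W d_a w W b W.
    By [closed_contraction], applied to the derivatives of w and of b and to the
    bivectors W and W b W, the products sum to multiples of traces as well, and
    everything cancels. *)
Lemma divergence_bivector U (F B : V -> 'M[R]_m) (D : V -> R) x q : open U ->
  C1mx U F -> C1mx U B -> (forall x, U x -> F x \in unitmx) ->
  (forall x, U x -> (F x)^T = - F x) -> (forall x, U x -> (B x)^T = - B x) ->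
  C1_on U D -> (forall x, U x -> D x ^+ 2 = \det (F x)) -> U x ->
  (forall a b k, pmx a F x b k + pmx b F x k a + pmx k F x a b = 0) ->
  (forall a b k, pmx a B x b k + pmx b B x k a + pmx k B x a b = 0) ->
  \sum_a partial a (fun y => D y * bivector (F y) (B y) a q) x = 0.
Proof.
move=> oU CF CB uF FT BT CD D2 Ux Fc Bc.
have dD : differentiable D x by have [] := CD x Ux.
have CP := C1mx_bivector oU CF CB uF.
have dP := C1mx_diff CP Ux.
pose W := invmx (F x); pose b := B x.
have WT : W^T = - W by apply: antisym_inv; [exact: uF|exact: FT].
have bT : b^T = - b by exact: BT.
have WbWT : (W *m b *m W)^T = - (W *m b *m W).
  by rewrite !trmx_mul WT bT !(mulNmx, mulmxN, opprK) mulmxA.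
have pT (G : V -> 'M[R]_m) a : C1mx U G -> (forall x, U x -> (G x)^T = - G x) ->
    (pmx a G x)^T = - pmx a G x.
  move=> CG GT; apply/matrixP => i j; rewrite !mxE -mulN1r -partialZ; last by have [] := CG i j x Ux.
  apply: (@partial_eq_on _ _ U) => // y Uy; rewrite mulN1r.
  by have /matrixP/(_ i j) := GT y Uy; rewrite !mxE.
have contr (c : 'I_m -> 'M[R]_m) (A Z : 'M[R]_m) :
    (forall a, (c a)^T = - c a) -> (forall a b k, c a b k + c b k a + c k a b = 0) ->
    A^T = - A ->
    \sum_a (A *m c a *m Z) a q = \sum_a (\tr (A *m c a) / 2) * Z a q.
  move=> cT cc AT.
  under eq_bigr do rewrite mxE; rewrite exchange_big; apply: eq_bigr => l _ /=.
  by rewrite -big_distrl (closed_contraction l cT cc AT).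
pose w' a := pmx a F x; pose b' a := pmx a B x.
have wT a : (w' a)^T = - w' a by exact: pT.
have b'T a : (b' a)^T = - b' a by exact: pT.
pose t a := \tr (W *m w' a) / 2.
transitivity (D x * \sum_a (t a * bivector (F x) (B x) a q +
     pmx a (fun y => bivector (F y) (B y)) x a q)).
  rewrite big_distrr; apply: eq_bigr => a _ /=.
  rewrite partialM //.
  rewrite (partial_sqrt_det a oU CF uF CD D2 Ux) -/W -/(w' a) -/(t a) [X in _ + X]mulrA.
  by rewrite [pmx _ _ _ _ _]mxE; ring.
apply/eqP; rewrite mulf_eq0; apply/orP; right; apply/eqP.
have e1 := contr w' W W wT Fc WT.
have e2 := contr w' W (W *m b *m W) wT Fc WT.
have e3 := contr b' W W b'T Bc WT.
have e4 := contr w' (W *m b *m W) W wT Fc WbWT.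
transitivity (\sum_a (t a * ((\tr (W *m b) / 2) * W a q - (W *m b *m W) a q) +
   (\tr (W *m b' a) - \tr (W *m b *m W *m w' a)) / 2 * W a q)
   - (\tr (W *m b) / 2) * \sum_a (W *m w' a *m W) a q
   + \sum_a (W *m w' a *m (W *m b *m W)) a q - \sum_a (W *m b' a *m W) a q
   + \sum_a (W *m b *m W *m w' a *m W) a q).
  rewrite big_distrr -!sumrB -!big_split -sumrB -big_split; apply: eq_bigr => a _ /=.
  rewrite (pmx_bivector a oU CF CB uF Ux) -/W -/b -/(w' a) -/(b' a).
  rewrite /bivector -/W -/b.
  have addE (X Y : 'M[R]_m) i j : (X + Y) i j = X i j + Y i j by rewrite mxE.
  have oppE (X : 'M[R]_m) i j : (- X) i j = - X i j by rewrite mxE.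
  have scaleE c (X : 'M[R]_m) i j : (c *: X) i j = c * X i j by rewrite mxE.
  by rewrite !(addE, oppE, scaleE) !addrA.
rewrite e1 e2 e3 e4 big_distrr -!sumrB -!big_split -sumrB -big_split /=.
rewrite big1 // => a _; rewrite -/(t a).
move: (t a) (\tr _) (\tr _) (\tr _) (W a q) ((W *m b *m W) a q) => ? ? ? ? ? ?; ring.
Qed.

End MatrixCalculus.

(** * The chain rule *)
Section ChainRule.
Context (R : realType) (m p : nat).
Local Notation V := 'rV[R]_m.
Local Notation W := 'rV[R]_p.
Implicit Types (U : set V) (k : 'I_m) (tau : V -> W).

Lemma differentiable_rV tau x :
  (forall l, differentiable (fun y => tau y 0 l) x) -> differentiable tau x.
Proof.
move=> dt; rewrite (_ : tau = \sum_(l < p) (fun y => tau y 0 l *: delta_mx 0 l)); last first.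
  apply/funext => y; rewrite fct_sumE; exact: row_sum_delta.
by apply: differentiable_sum => l; apply: differentiableZl.
Qed.

Lemma diff_rV_partial tau k x : (forall l, differentiable (fun y => tau y 0 l) x) ->
  'd tau x (delta_mx 0 k) = \row_l partial k (fun y => tau y 0 l) x.
Proof.
move=> dt; have dtau := differentiable_rV dt.
rewrite -deriveE // derive_mx; last exact: diff_derivable.
by apply/rowP => l; rewrite !mxE.
Qed.

Lemma jacobianE tau k l x : (forall l, differentiable (fun y => tau y 0 l) x) ->
  'J tau x k l = partial k (fun y => tau y 0 l) x.
Proof.
by move=> dt; rewrite /jacobian mxE diff_rV_partial // mxE.
Qed.

Lemma partial_comp (f : W -> R) tau k x :
  (forall l, differentiable (fun y => tau y 0 l) x) -> differentiable f (tau x) ->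
  partial k (f \o tau) x = \sum_l partial k (fun y => tau y 0 l) x * partial l f (tau x).
Proof.
move=> dt df; have dtau := differentiable_rV dt.
rewrite /partial deriveE; last exact: differentiable_comp.
rewrite diff_comp //= diff_rV_partial // [X in 'd f _ X]row_sum_delta linear_sum.
by apply: eq_bigr => l _; rewrite linearZ /= mxE -deriveE.
Qed.

Lemma continuous_sum_at (I : Type) (r : seq I) (F : I -> V -> R) x :
  (forall i, {for x, continuous (F i)}) ->
  {for x, continuous (fun y => \sum_(i <- r) F i y)}.
Proof.
move=> cF; elim: r => [|i r IH].
  rewrite (_ : (fun y => _) = cst 0); first exact: cst_continuous.
  by apply/funext => y; rewrite big_nil.
rewrite (_ : (fun y => _) = fun y => F i y + \sum_(i <- r) F i y).
  by apply: continuousD; [exact: cF|exact: IH].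
by apply/funext => y; rewrite big_cons.
Qed.

Lemma C1_comp U (Y : set W) (f : W -> R) tau : open U ->
  (forall l, C1_on U (fun y => tau y 0 l)) -> C1_on Y f ->
  (forall x, U x -> Y (tau x)) -> C1_on U (f \o tau).
Proof.
move=> oU Ct Cf UY x Ux.
have dt y : U y -> forall l, differentiable (fun y => tau y 0 l) y.
  by move=> Uy l; have [] := Ct l y Uy.
have df y : U y -> differentiable f (tau y) by move=> /UY /Cf[].
split.
  by apply: differentiable_comp; [exact/differentiable_rV/dt|exact: df].
move=> k; apply: (@continuous_eq_on _ _ U _ (fun y => \sum_l
    partial k (fun y => tau y 0 l) y * partial l f (tau y))) => //.
  by move=> y Uy; apply: partial_comp; [exact: dt|exact: df].
apply: continuous_sum_at => l; apply: continuousM; first by have [_ h] := Ct l x Ux; exact: h.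
apply: continuous_comp; last by have [_ h] := Cf _ (UY x Ux); exact: h.
exact/differentiable_continuous/differentiable_rV/dt.
Qed.

End ChainRule.

(** * Measures with a density *)
Section Density.
Local Open Scope ereal_scope.
Context d1 d2 (T1 : measurableType d1) (T2 : measurableType d2) (R : realType).
Variables (mu : {measure set T1 -> \bar R}) (lam : {measure set T2 -> \bar R}).
Variables (D : set T1) (E : set T2) (psi : T2 -> T1) (rho : T2 -> R).
Hypotheses (mD : measurable D) (mE : measurable E) (mpsi : measurable_fun E psi).
Hypotheses (mrho : measurable_fun E rho) (rho0 : forall x, E x -> (0 <= rho x)%R).
Hypothesis psiD : forall x, E x -> D (psi x).
Hypothesis muE : forall B, measurable B -> B `<=` D ->
  mu B = \int[lam]_(x in E `&` psi @^-1` B) (rho x)%:E.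

Import HBNNSimple.

(** Change of variables along psi, for a measure that has density rho in the
    sense that it agrees on sets with an integral over their preimages. *)
Lemma integral_density_nnsfun (h : {nnsfun T1 >-> R}) :
  \int[mu]_(p in D) (h p)%:E = \int[lam]_(x in E) ((h (psi x))%:E * (rho x)%:E).
Proof.
have mind (k : R) : measurable_fun E (fun x => (\1_(h @^-1` [set k]) (psi x) : R)).
  apply: (@measurableT_comp _ _ _ _ _ _ (\1_(h @^-1` [set k]) : T1 -> R)) => //.
transitivity (\sum_(k \in range h) (k%:E * mu (h @^-1` [set k] `&` D))).
  under eq_integral do rewrite fimfunE -fsumEFin//.
  rewrite ge0_integral_fsum//; last 2 first.
  - by move=> k; apply/measurable_EFinP/measurable_funM => //; exact: measurable_funTS.
  - by move=> k y _; rewrite lee_fin; exact: nnfun_muleindic_ge0.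
  apply: eq_fsbigr => k _; rewrite (integralZl_indic _ (fun k => h @^-1` [set k])) //.
    by rewrite integral_indic.
  by move=> k0; rewrite preimage_nnfun0.
under [RHS]eq_integral => x xE.
  rewrite fimfunE -fsumEFin// ge0_mule_fsuml; last first.
    by move=> k; rewrite lee_fin; exact: nnfun_muleindic_ge0.
  over.
rewrite ge0_integral_fsum//; last 2 first.
- move=> k; apply: emeasurable_funM; apply/measurable_EFinP => //.
  exact: measurable_funM.
- move=> k x Ex; rewrite mule_ge0 ?lee_fin ?rho0 //; exact: nnfun_muleindic_ge0.
apply: eq_fsbigr => k; rewrite inE => -[p _ <-].
under [RHS]eq_integral do rewrite EFinM -muleA.
rewrite ge0_integralZl//; last 3 first.
- apply: emeasurable_funM; exact/measurable_EFinP.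
- by move=> x Ex; rewrite mule_ge0 ?lee_fin ?rho0.
- by rewrite lee_fin.
congr (_ * _); rewrite muE; last 2 first.
- exact: measurableI.
- by move=> q [].
rewrite integral_mkcondr; apply: eq_integral => x; rewrite inE => Ex.
rewrite patchE /indic; case: ifPn; rewrite ?inE ?notin_setE /= => hx.
  by rewrite mem_set ?mul1e //; case: hx.
rewrite memNset ?mul0e //= => hk; apply: hx; split => //; exact: psiD.
Qed.

Lemma integral_density (f : T1 -> \bar R) : measurable_fun setT f -> (forall p, 0 <= f p) ->
  \int[mu]_(p in D) f p = \int[lam]_(x in E) (f (psi x) * (rho x)%:E).
Proof.
move=> mf f0; pose f_ := nnsfun_approx measurableT mf.
transitivity (lim (\int[mu]_(p in D) (f_ n p)%:E @[n --> \oo])).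
  rewrite -monotone_convergence//=.
  - apply: eq_integral => p _; apply/esym/cvg_lim => //=.
    exact: cvg_nnsfun_approx.
  - by move=> n; exact/measurable_EFinP/measurable_funTS.
  - by move=> n ? _; rewrite lee_fin.
  - by move=> ? _ ? ? mn; rewrite lee_fin; exact/lefP/nd_nnsfun_approx.
transitivity (lim (\int[lam]_(x in E) ((f_ n (psi x))%:E * (rho x)%:E) @[n --> \oo])).
  by apply: congr_lim; apply/funext => n; exact: integral_density_nnsfun.
rewrite -monotone_convergence//=.
- apply: eq_integral => x _; apply/cvg_lim => //=.
  apply: cvgeZr => //; exact: cvg_nnsfun_approx.
- move=> n; apply: emeasurable_funM; apply/measurable_EFinP => //.
  exact: measurableT_comp.
- by move=> n x Ex; rewrite mule_ge0 ?lee_fin ?rho0.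
- move=> x Ex i j ij; apply: lee_wpmul2r; first by rewrite lee_fin rho0.
  by rewrite lee_fin; exact/lefP/nd_nnsfun_approx.
Qed.

Lemma integral_density_real (f : T1 -> R) : measurable_fun setT f ->
  \int[mu]_(p in D) (f p)%:E = \int[lam]_(x in E) (f (psi x) * rho x)%:E.
Proof.
move=> mf; have mfE : measurable_fun setT (EFin \o f) by exact/measurable_EFinP.
rewrite integralE [RHS]integralE; congr (_ - _).
  rewrite integral_density; last 2 first.
  - exact: measurable_funepos.
  - by move=> p; exact: funepos_ge0.
  apply: eq_integral => x; rewrite inE => Ex.
  rewrite !funeposE /= -!EFin_max -EFinM; congr EFin.
  by rewrite maxr_pMl ?rho0 // mul0r.
rewrite integral_density; last 2 first.
- exact: measurable_funeneg.
- by move=> p; exact: funeneg_ge0.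
apply: eq_integral => x; rewrite inE => Ex.
rewrite !funenegE /= -!EFin_max -EFinM; congr EFin.
by rewrite maxr_pMl ?rho0 // mul0r mulNr.
Qed.

End Density.

(** * Charts *)
Section ManifoldTopology.
Context (R : realType) (n : nat) (M : ptopologicalType) (A : complex_atlas R n M).
Local Notation V := 'rV[R]_(n + n).
Implicit Types (c d : chart A) (x : V) (p : M).

Definition overlap c d : set V := chart_map c @` (chart_dom c `&` chart_dom d).

Lemma chart_im_map c p : chart_dom c p -> chart_im c (chart_map c p).
Proof. by move=> cp; exists p. Qed.

Lemma chart_inv_dom c x : chart_im c x -> chart_dom c (chart_inv c x).
Proof. by move=> [p cp <-]; rewrite chart_mapK. Qed.

Lemma chart_invK c x : chart_im c x -> chart_map c (chart_inv c x) = x.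
Proof. by move=> [p cp <-]; rewrite chart_mapK. Qed.

Lemma chart_inv_continuous_at c x : chart_im c x -> {for x, continuous (chart_inv c)}.
Proof. by move=> [p cp <-]; exact: chart_inv_continuous. Qed.

Lemma open_chart_im c : open (chart_im c).
Proof. exact: chart_im_open. Qed.

Lemma open_chart_preimage c (U : set M) : open U ->
  open (chart_im c `&` chart_inv c @^-1` U).
Proof.
move=> oU; rewrite openE => x [cx Ux]; rewrite /interior.
apply: filterI; first exact: open_nbhs_nbhs (conj (@open_chart_im c) cx).
exact: (chart_inv_continuous_at cx (open_nbhs_nbhs (conj oU Ux))).
Qed.

Lemma overlapE c d : overlap c d = chart_im c `&` chart_inv c @^-1` (chart_dom d).
Proof.
apply/seteqP; split => [_ [p [cp dp] <-]|x [cx dx]].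
  by split; [exact: chart_im_map|rewrite /= chart_mapK].
by exists (chart_inv c x); [split => //; exact: chart_inv_dom|exact: chart_invK].
Qed.

Lemma open_overlap c d : open (overlap c d).
Proof. by rewrite overlapE; apply: open_chart_preimage; exact: chart_dom_open. Qed.

Lemma transition_im c d x : overlap c d x -> chart_im d (transition c d x).
Proof. by rewrite overlapE => -[cx dx]; exact: chart_im_map. Qed.

Lemma transition_inv c d x : overlap c d x ->
  chart_inv d (transition c d x) = chart_inv c x.
Proof. by rewrite overlapE => -[cx dx]; rewrite /transition /= chart_mapK. Qed.

(** The local expressions of a function on M. *)
Definition invariant (X : Type) (F : local A X) :=
  forall c d x, overlap c d x -> F c x = F d (transition c d x).

Lemma chart_at_dom p : chart_dom (chart_at A p) p.
Proof. by rewrite /chart_at; case: cid. Qed.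

Lemma at_point_chart (X : Type) (F : local A X) c x : invariant F ->
  chart_im c x -> at_point F (chart_inv c x) = F c x.
Proof.
move=> FI cx; rewrite /at_point (FI c (chart_at A (chart_inv c x))) //.
by rewrite overlapE; split => //; exact: chart_at_dom.
Qed.

Lemma continuous_chartwise (f : M -> R) :
  (forall c x, chart_im c x -> {for x, continuous (f \o chart_inv c)}) ->
  continuous f.
Proof.
move=> cf p; set c := chart_at A p; have cp : chart_dom c p := chart_at_dom p.
have cc := cf c _ (chart_im_map cp).
move=> B; rewrite -{1}[p](chart_mapK cp) => fB.
have := chart_map_continuous cp (cc B fB).
move=> h; have od := open_nbhs_nbhs (conj (chart_dom_open c) cp).
by apply: filterS2 od h => q cq /=; rewrite chart_mapK.
Qed.

Lemma measurable_chart_dom c : measurable (chart_dom c : set (borel M)).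
Proof. by apply: open_borel; exact: chart_dom_open. Qed.

Lemma measurable_chart_im c : measurable (chart_im c : set (borel V)).
Proof. by apply: open_borel; exact: open_chart_im. Qed.

Lemma measurable_chart_inv c : @measurable_fun _ _ (borel V) (borel M)
  (chart_im c) (chart_inv c).
Proof.
apply: (@measurability _ _ (borel V) (borel M) _ _ (@open M)) => //.
move=> _ [U oU <-]; apply: open_borel; exact: open_chart_preimage.
Qed.

Lemma continuous_on_measurable (f : V -> R) (U : set V) : open U ->
  (forall x, U x -> {for x, continuous f}) -> measurable_fun (U : set (borel V)) (f : borel V -> R).
Proof.
move=> oU cf; apply: (@measurability _ _ (borel V) R _ f _ (RGenOInfty.measurableE R)).
move=> _ [_ [a ->] <-].
suff o : open (U `&` f @^-1` `]a, +oo[) by exact: open_borel o.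
rewrite openE => x [Ux fx].
apply: filterI; first exact: open_nbhs_nbhs (conj oU Ux).
apply: (cf x Ux); apply: open_nbhs_nbhs; split => //; exact: rray_open.
Qed.

Section ChartIntegral.
Variables (dens : local A R) (mu : {measure set (borel M) -> \bar R}).
Hypothesis mudens : has_density dens mu.
Variable lam : {sigma_finite_measure set (borel V) -> \bar R}.
Hypothesis lamP : lebesgue_like lam.
Hypothesis dens_cont : forall c x, chart_im c x -> {for x, continuous (dens c)}.
Hypothesis dens_ge0 : forall c x, chart_im c x -> 0 <= dens c x.

Lemma measurable_dens c : measurable_fun (chart_im c : set (borel V)) (dens c : borel V -> R).
Proof. by apply: continuous_on_measurable; [exact: open_chart_im|exact: dens_cont]. Qed.

Lemma density_chart c (B : set (borel M)) : measurable B -> B `<=` chart_dom c ->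
  (mu B = \int[lam]_(x in chart_im c `&` chart_inv c @^-1` B) (dens c x)%:E)%E.
Proof.
move=> mB Bc; rewrite (mudens mB Bc).
have im : chart_map c @` B = chart_im c `&` chart_inv c @^-1` B.
  apply/seteqP; split => [_ [p Bp <-]|x [cx Bx]].
    by split; [exact: chart_im_map (Bc _ Bp)|rewrite /= chart_mapK //; exact: Bc].
  by exists (chart_inv c x) => //; exact: chart_invK.
have mim : measurable (chart_im c `&` chart_inv c @^-1` B : set (borel V)).
  by apply: measurable_chart_inv => //; exact: measurable_chart_im.
have [lamE _ _] := lamP.
rewrite lamE; last 2 first.
- apply/measurable_EFinP; rewrite im; apply/(measurable_restrictT _ mim).
  apply: measurable_funS (measurable_dens (c := c)) => //; exact: measurable_chart_im.
- move=> x; rewrite lee_fin patchE; case: ifPn => //; rewrite inE im => -[cx _].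
  exact: dens_ge0.
rewrite im [RHS]integral_mkcond; apply: eq_integral => x _.
by rewrite !patchE; case: ifP.
Qed.

Lemma integral_chart c (f : M -> R) :
  measurable_fun [set: borel M] (f : borel M -> R) ->
  (\int[mu]_(p in chart_dom c) (f p)%:E =
   \int[lam]_(x in chart_im c) (f (chart_inv c x) * dens c x)%:E)%E.
Proof.
move=> mf; apply: (@integral_density_real _ _ (borel M) (borel V)) => //.
- exact: measurable_chart_dom.
- exact: measurable_chart_im.
- exact: measurable_chart_inv.
- exact: measurable_dens.
- by move=> x; exact: dens_ge0.
- by move=> x; exact: chart_inv_dom.
- by move=> B; exact: density_chart.
Qed.

(** A continuous density is bounded on a compact subset of a chart. *)
Lemma compact_chart_finite c (Q : set V) (B : set (borel M)) : compact Q ->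
  Q `<=` chart_im c -> measurable B -> B `<=` chart_inv c @` Q -> (mu B < +oo)%E.
Proof.
move=> cQ Qc mB BQ.
have Bc : B `<=` chart_dom c by move=> p /BQ [x /Qc cx <-]; exact: chart_inv_dom.
have BQ' x : chart_im c x -> B (chart_inv c x) -> Q x.
  move=> cx /BQ [y Qy e]; rewrite -(chart_invK cx) -e chart_invK //; exact: Qc.
have [C hC] : exists C, forall x, Q x -> dens c x <= C.
  have : compact (dens c @` Q).
    apply: continuous_compact cQ; apply: continuous_in_subspaceT => x.
    by rewrite inE => /Qc /dens_cont.
  move=> /compact_bounded [C [_ h]]; exists (C + 1) => x Qx.
  by rewrite (le_trans (ler_norm _)) //; apply: (h (C + 1)); [rewrite ltrDl|exists x].
have [r Qr] : exists r, Q `<=` box r.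
  move: cQ => /compact_bounded [r [_ h]]; exists (r + 1) => x Qx.
  by apply: (h (r + 1)); rewrite ?ltrDl.
rewrite (density_chart mB Bc).
have mim : measurable (chart_im c `&` chart_inv c @^-1` B : set (borel V)).
  by apply: measurable_chart_inv => //; exact: measurable_chart_im.
apply: (@le_lt_trans _ _ (\int[lam]_(x in chart_im c `&` chart_inv c @^-1` B) (cst C%:E) x)%E).
  apply: ge0_le_integral => //.
  - by move=> x [cx _]; rewrite lee_fin dens_ge0.
  - apply/measurable_EFinP; apply: measurable_funS (measurable_dens (c := c)) => //.
    exact: measurable_chart_im.
  - by move=> x [cx Bx]; rewrite lee_fin; apply: hC; exact: BQ'.
rewrite integral_cst //.
have [_ lamb _] := lamP.
have le : (lam (chart_im c `&` chart_inv c @^-1` B) <= lam (box r))%E.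
  apply: le_measure; rewrite ?inE //; first exact: measurable_box.
  by move=> x [cx Bx]; apply: Qr; exact: BQ'.
have fin : lam (chart_im c `&` chart_inv c @^-1` B) \is a fin_num.
  by rewrite ge0_fin_numE // (le_lt_trans le).
by have : (C%:E * lam (chart_im c `&` chart_inv c @^-1` B))%E \is a fin_num;
  [exact: fin_numM|rewrite fin_numElt => /andP[]].
Qed.

End ChartIntegral.

End ManifoldTopology.

(** * Partitions of unity *)
Section Ramp.
Context (R : realType).

(** One continuous derivative is enough to integrate by parts, so a quadratic
    ramp can replace the exponential of the usual smooth bump functions. *)
Definition ramp (s : R) : R := Num.max 0 s ^+ 2.

Lemma is_derive_ramp (s : R) : is_derive s (1 : R) ramp (2 * Num.max 0 s).
Proof.
have [s0|s0|s0] := ltgtP s 0.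
- apply: (@near_eq_is_derive _ _ _ (cst 0)); last by rewrite mulr0; exact: is_derive_cst.
  near=> t; rewrite /ramp max_l ?expr0n //; apply: ltW; by near: t; exact: lt_nbhsl.
- have d : is_derive s (1 : R) ((id : R -> R) * (id : R -> R)) (s *: (1 : R) + s *: (1 : R)).
    exact: is_deriveM.
  have -> : 2 * s = s *: (1 : R) + s *: (1 : R) by rewrite [_%:A]mulr1 mulr_natl mulr2n.
  apply: near_eq_is_derive d; near=> t; rewrite /ramp max_r //; apply: ltW.
  by near: t; exact: lt_nbhsr.
- rewrite s0 mulr0.
  have h : (fun h : R => h^-1 *: ((ramp \o shift 0) (h *: (1 : R)) - ramp 0)) @ 0^' --> 0.
    apply/cvgrPdist_le => e e0; near=> h.
    have h0 : h != 0 by near: h; exact: nbhs_dnbhs_neq.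
    rewrite /= addr0 sub0r normrN [_%:A]mulr1 /ramp maxxx expr0n subr0.
    rewrite normrM normfV ler_pdivrMl ?normr_gt0 // normrX.
    have le : `|Num.max 0 h| <= `|h|.
      by have [hp|hn] := leP 0 h; rewrite ?normr0.
    rewrite expr2; apply: ler_pM => //; apply: le_trans le _.
    by near: h; exact: dnbhs0_le.
  by apply: DeriveDef; [apply/cvg_ex; exists 0|exact/cvg_lim].
Unshelve. all: by end_near. Qed.

Lemma ramp_ge0 s : 0 <= ramp s. Proof. exact: sqr_ge0. Qed.

Lemma ramp_gt0 s : (0 < ramp s) = (0 < s).
Proof.
rewrite /ramp lt0r sqr_ge0 andbT expf_eq0 /=.
have [s0|s0] := ltP 0 s; first by rewrite gt_eqF.
by rewrite eqxx.
Qed.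

Lemma ramp_eq0 s : s <= 0 -> ramp s = 0.
Proof. by move=> s0; rewrite /ramp max_l ?expr0n. Qed.

Context (m : nat).
Local Notation V := 'rV[R]_m.

Lemma partial_ramp (g : V -> R) k x : differentiable g x ->
  partial k (ramp \o g) x = 2 * Num.max 0 (g x) * partial k g x.
Proof.
move=> dg; have [dr er] := is_derive_ramp (g x).
have dr' : differentiable ramp (g x) by exact/derivable1_diffP.
rewrite /partial deriveE; last exact: differentiable_comp.
rewrite diff_comp //= deriv1E // derive1E er -deriveE //.
exact: mulrC.
Qed.

Lemma C1_ramp (U : set V) (g : V -> R) : open U -> C1_on U g -> C1_on U (ramp \o g).
Proof.
move=> oU Cg x Ux; have [dg cg] := Cg x Ux; split.
  apply: differentiable_comp => //.
  by have [dr _] := is_derive_ramp (g x); exact/derivable1_diffP.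
move=> k; apply: (@continuous_eq_on _ _ U _ (fun y => 2 * Num.max 0 (g y) * partial k g y)) => //.
  by move=> y Uy; apply: partial_ramp; have [] := Cg y Uy.
apply: continuousM; last exact: cg.
apply: continuousM; first exact: cst_continuous.
apply: continuous_max; first exact: cst_continuous.
exact: differentiable_continuous.
Qed.

Definition bump (x0 : V) (r : R) (y : V) : R :=
  \prod_i ramp (1 - ((y 0 i - x0 0 i) / r) ^+ 2).

Lemma bump_ge0 x0 r y : 0 <= bump x0 r y.
Proof. by apply: prodr_ge0 => i _; exact: ramp_ge0. Qed.

Lemma bump_gt0 x0 r : 0 < bump x0 r x0.
Proof.
apply: prodr_gt0 => i _; rewrite ramp_gt0 subrr mul0r expr0n subr0 //.
Qed.

Lemma bump_eq0 x0 r y : 0 < r -> r < `|y - x0| -> bump x0 r y = 0.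
Proof.
move=> r0 ry; have [i ri] : exists i, r < `|(y - x0) 0 i|.
  apply/not_existsP => h; move: ry; rewrite ltNge => /negP; apply.
  by apply/norm_rV_le; [exact: ltW|move=> j; rewrite leNgt; apply/negP/h].
rewrite /bump (bigD1 i) //= ramp_eq0 ?mul0r // subr_le0.
rewrite -real_normK ?num_real // normrM normfV (gtr0_norm r0).
rewrite exprn_ege1 // ler_pdivlMr // mul1r; apply: ltW.
by move: ri; rewrite !mxE.
Qed.

Lemma C1_coord (U : set V) i : C1_on U (fun y => y 0 i).
Proof.
move=> x Ux; split; first exact: differentiable_coord.
move=> k; rewrite (_ : partial k _ = cst ((delta_mx 0 k : V) 0 i)); first exact: cst_continuous.
apply/funext => y; rewrite /partial deriveE; last exact: differentiable_coord.
have lin : linear (fun y : V => y 0 i : R) by move=> a u v; rewrite !mxE.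
pose f := HB.pack_for {linear V -> R} (fun y : V => y 0 i : R) (GRing.isLinear.Build _ _ _ _ _ lin).
rewrite (_ : (fun y : V => y 0 i) = f) // diff_lin //.
exact: coord_continuous.
Qed.

Lemma C1_bump (U : set V) x0 r : open U -> C1_on U (bump x0 r).
Proof.
move=> oU; apply: C1_prod => // i.
apply: (@C1_ramp U (fun y => 1 - ((y 0 i - x0 0 i) / r) ^+ 2)) => //.
apply: C1D => //; first exact: C1_cst.
apply: C1N => //.
have h : C1_on U (fun y => (y 0 i - x0 0 i) / r).
  by apply: C1M => //; [apply: C1D => //; [exact: C1_coord|exact: C1_cst]|exact: C1_cst].
exact: (C1M oU h h).
Qed.

End Ramp.

Section Partition.
Context (R : realType) (n : nat) (M : ptopologicalType) (A : complex_atlas R n M).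
Local Notation V := 'rV[R]_(n + n).
Implicit Types (c d : chart A) (x : V) (p : M).

Definition C1_fun (f : M -> R) := forall c, C1_on (chart_im c) (f \o chart_inv c).

Lemma C1_fun_continuous f : C1_fun f -> continuous f.
Proof. by move=> Cf; apply: continuous_chartwise => c x cx; exact: C1_continuous (Cf c) cx. Qed.

Lemma transition_smooth c d l : smooth_on (overlap c d) (fun x => transition c d x 0 l).
Proof. by have [h _] := chart_transition c d; exact: h. Qed.

Lemma C1_transition c d (Y : set V) (f : V -> R) : C1_on Y f -> chart_im d `<=` Y ->
  C1_on (overlap c d) (f \o transition c d).
Proof.
move=> Cf dY; apply: (@C1_comp _ _ _ (overlap c d) Y f (transition c d)) => //; first exact: open_overlap.
  by move=> l; apply: smooth_C1; [exact: open_overlap|exact: transition_smooth].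
by move=> x /transition_im /dY.
Qed.

(** Extension by zero, since [chart_map c] has no meaning outside
    [chart_dom c]. *)
Definition chart_bump c (x0 : V) (r : R) p : R :=
  if `[< chart_dom c p >] then bump x0 r (chart_map c p) else 0.

Lemma chart_bump_ge0 c x0 r p : 0 <= chart_bump c x0 r p.
Proof. by rewrite /chart_bump; case: ifP => // _; exact: bump_ge0. Qed.

Definition ball_box (x0 : V) (r : R) : set V := [set y | `|y - x0| <= r].

Lemma compact_ball_box x0 r : compact (ball_box x0 r).
Proof.
have -> : ball_box x0 r = (fun y => y + x0) @` box r.
  apply/seteqP; split => [y yr|_ [y yr <-]]; first by exists (y - x0); rewrite ?subrK.
  by rewrite /ball_box /= addrK.
apply: continuous_compact (@compact_box _ _ r).
apply: continuous_subspaceT => y; apply: continuousD => //; exact: cst_continuous.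
Qed.

(** Near a point outside the chart the function vanishes, because the compact
    support of the bump is closed in the Hausdorff space M. Near a point of the
    chart it is a bump composed with a transition. *)
Lemma C1_chart_bump c x0 r : hausdorff_space M -> 0 < r -> ball_box x0 r `<=` chart_im c ->
  C1_fun (chart_bump c x0 r).
Proof.
move=> hM r0 Kc d x dx.
have closedK : closed (chart_inv c @` ball_box x0 r).
  apply: (compact_closed hM); apply: continuous_compact (@compact_ball_box x0 r).
  apply: continuous_in_subspaceT => y; rewrite inE => /Kc.
  exact: chart_inv_continuous_at.
case: (pselect (chart_dom c (chart_inv d x))) => cdx.
  have ox : overlap d c x by rewrite overlapE.
  suff C : C1_on (overlap d c) (chart_bump c x0 r \o chart_inv d) by exact: C.
  apply: (@C1_eq_on _ _ _ (bump x0 r \o transition d c)); first exact: open_overlap.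
    move=> y; rewrite overlapE => -[_ cy].
    by rewrite /chart_bump /transition /=; case: asboolP.
  by apply: (@C1_transition _ _ setT) => //; apply: C1_bump; exact: openT.
have oU := open_chart_preimage (c := d) (closed_openC closedK).
suff C : C1_on (chart_im d `&` chart_inv d @^-1` (~` (chart_inv c @` ball_box x0 r)))
    (chart_bump c x0 r \o chart_inv d).
  by apply: C; split => //= -[y /Kc cy e]; apply: cdx; rewrite -e; exact: chart_inv_dom.
apply: (@C1_eq_on _ _ _ (fun=> 0)) => //; last exact: C1_cst.
move=> y [dy ny]; rewrite /chart_bump /=; case: asboolP => // cy.
rewrite bump_eq0 // ltNge; apply/negP => le; apply: ny.
by exists (chart_map c (chart_inv d y)) => //; exact: chart_mapK.
Qed.

Lemma chart_box_ex c p : chart_dom c p ->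
  exists2 r : R, 0 < r & ball_box (chart_map c p) r `<=` chart_im c.
Proof.
move=> cp; have /nbhs_ballP[e /= e0 h] := open_nbhs_nbhs (conj (open_chart_im (c := c)) (chart_im_map cp)).
exists (e / 2); first by rewrite divr_gt0.
move=> y ye; apply: h; rewrite -ball_normE /ball_ /= distrC.
by apply: le_lt_trans ye _; rewrite ltr_pdivrMr // ltr_pMr // ltr1n.
Qed.

(** [pu_supp i] is a compact set of coordinates in the chart [pu_chart i] whose
    image in M contains the support of [pu_fun i]. *)
Record partition := Partition {
  pu_size : nat;
  pu_chart : 'I_pu_size -> chart A;
  pu_fun : 'I_pu_size -> M -> R;
  pu_supp : 'I_pu_size -> set V;
  pu_C1 : forall i, C1_fun (pu_fun i);
  pu_sum : forall p, \sum_i pu_fun i p = 1;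
  pu_compact : forall i, compact (pu_supp i);
  pu_supp_im : forall i, pu_supp i `<=` chart_im (pu_chart i);
  pu_eq0 : forall i p, ~ (chart_inv (pu_chart i) @` pu_supp i) p -> pu_fun i p = 0
}.

(** Finitely many bumps have a positive sum everywhere, by compactness; divide
    them by this sum. *)
Lemma partition_exists : hausdorff_space M -> compact [set: M] -> inhabited partition.
Proof.
move=> hM cM.
have rad p : {r : R | 0 < r /\ ball_box (chart_map (chart_at A p) p) r `<=` chart_im (chart_at A p)}.
  by apply: cid; have [r r0 h] := chart_box_ex (chart_at_dom A p); exists r.
pose r p := sval (rad p); have r0 p : 0 < r p by case: (svalP (rad p)).
have rK p : ball_box (chart_map (chart_at A p) p) (r p) `<=` chart_im (chart_at A p).
  by case: (svalP (rad p)).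
pose b p := chart_bump (chart_at A p) (chart_map (chart_at A p) p) (r p).
have Cb p : C1_fun (b p) by apply: C1_chart_bump => //; exact: rK.
pose O p := b p @^-1` [set t | 0 < t].
have oO p : open (O p).
  by move: (C1_fun_continuous (Cb p)) => /continuousP; apply; exact: open_gt.
have cov : [set: M] `<=` cover setT O.
  move=> p _; exists p => //; rewrite /O /= /b /chart_bump.
  by case: asboolP => [_|/(_ (chart_at_dom A p))//]; exact: bump_gt0.
move: cM; rewrite compact_cover => /(_ M setT O (fun p _ => oO p) cov) [D' _ hD'].
pose s : seq M := enum_fset D'.
pose S p := \sum_(q <- s) b q p.
have S0 p : 0 < S p.
  have [q qD bq] := hD' p I.
  have qs : q \in s by exact: qD.
  rewrite /S (big_rem q) //= ltr_pwDl //; apply: sumr_ge0 => i _.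
  exact: chart_bump_ge0.
have CS : C1_fun S.
  move=> c; rewrite (_ : S \o _ = fun y => \sum_(q <- s) (b q \o chart_inv c) y) //.
  by apply: C1_sum; [exact: open_chart_im|move=> q; exact: Cb].
pose q (i : 'I_(size s)) := nth point s i.
apply: inhabits.
apply: (@Partition (size s) (fun i => chart_at A (q i)) (fun i p => b (q i) p / S p)
  (fun i => ball_box (chart_map (chart_at A (q i)) (q i)) (r (q i)))).
- move=> i c; apply: (@C1M _ _ _ (b (q i) \o chart_inv c) (fun y => (S (chart_inv c y))^-1)).
  + exact: open_chart_im.
  + exact: Cb.
  + apply: (@C1V _ _ _ (S \o chart_inv c)); [exact: open_chart_im|exact: CS|].
    by move=> x _; apply: lt0r_neq0; exact: S0.
- move=> p; rewrite -big_distrl /= -[X in X / _](big_mkord xpredT (fun i => b (nth point s i) p)).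
  have -> : \sum_(0 <= i < size s) b (nth point s i) p = S p.
    by rewrite /S [RHS](big_nth point).
  by rewrite divff //; apply: lt0r_neq0; exact: S0.
- by move=> i; exact: compact_ball_box.
- by move=> i; exact: rK.
- move=> i p np; rewrite /b /chart_bump; case: asboolP => [cp|_]; last by rewrite mul0r.
  rewrite bump_eq0 ?mul0r // ltNge; apply/negP => le; apply: np.
  by exists (chart_map (chart_at A (q i)) p) => //; exact: chart_mapK.
Qed.

End Partition.

(** * The divergence theorem *)
Section DivergenceRV.
Context (R : realType) (m : nat).
Local Notation V := 'rV[R]_m.
Variable lam : {sigma_finite_measure set (borel V) -> \bar R}.
Hypothesis lamP : lebesgue_like lam.

Lemma hausdorff_rV : hausdorff_space V.
Proof. exact: norm_hausdorff. Qed.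

Lemma C1_continuous_partial (G : V -> R) a : C1_on setT G -> continuous (partial a G).
Proof. by move=> CG x; have [_] := CG x I; apply. Qed.

Lemma integrable_partial (G : V -> R) a r : C1_on setT G ->
  (forall x, r < `|x| -> G x = 0) ->
  lam.-integrable setT (fun x => (partial a G x)%:E).
Proof.
move=> CG G0; have cG := C1_continuous_partial (a := a) CG.
have [C hC] := continuous_box_bounded r cG.
have [_ lamb _] := lamP.
apply: (@integrable_bounded_support _ _ _ lam (partial a G) (box r) (Num.max C 0)) => //.
- exact: measurable_box.
- exact: lamb.
- exact: continuous_borel_real.
- move=> x; rewrite le_max; have [h|h] := leP `|x| r; first by rewrite (hC _ h).
  by rewrite /= (partial_support _ G0) // normr0 lexx orbT.
- by move=> x /= /negP; rewrite -ltNge => h; rewrite (partial_support _ G0).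
Qed.

Lemma integral_divergence (G : 'I_m -> V -> R) r : (forall a, C1_on setT (G a)) ->
  (forall a x, r < `|x| -> G a x = 0) ->
  (\int[lam]_x (\sum_a partial a (G a) x)%:E = 0)%E.
Proof.
move=> CG G0; under eq_integral do rewrite -sumEFin.
rewrite integral_sum //; last by move=> a; exact: integrable_partial (CG a) (G0 a).
have [_ _ div] := lamP.
apply: big1 => a _; apply: (div _ _ r) => //.
- by move=> x; apply: diff_derivable; have [] := CG a x I.
- exact: C1_continuous_partial.
- exact: G0.
Qed.

Lemma C1_extend (U Q : set V) (G : V -> R) : open U -> compact Q -> Q `<=` U ->
  C1_on U G -> (forall x, U x -> ~ Q x -> G x = 0) -> C1_on setT (G \_ U).
Proof.
move=> oU cQ QU CG G0 x _.
case: (pselect (U x)) => Ux.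
  suff C : C1_on U (G \_ U) by exact: C.
  by apply: C1_eq_on CG => // y Uy; rewrite patchE mem_set.
have oQ : open (~` Q) by rewrite openC; exact: compact_closed hausdorff_rV cQ.
suff C : C1_on (~` Q) (G \_ U) by apply: C => /QU.
apply: (@C1_eq_on _ _ _ (fun=> 0)) => //; last exact: C1_cst.
by move=> y Qy; rewrite patchE; case: ifPn => //; rewrite inE => Uy; rewrite G0.
Qed.

End DivergenceRV.

Section DivergenceManifold.
Context (R : realType) (n : nat) (M : ptopologicalType) (A : complex_atlas R n M).
Local Notation V := 'rV[R]_(n + n).
Implicit Types (c d : chart A) (x : V) (p : M).
Hypotheses (hM : hausdorff_space M) (cM : compact [set: M]).
Variables (dens : local A R) (mu : {measure set (borel M) -> \bar R}).
Hypothesis mudens : has_density dens mu.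
Hypothesis dens_C1 : forall c, C1_on (chart_im c) (dens c).
Hypothesis dens_ge0 : forall c x, chart_im c x -> 0 <= dens c x.

Let dens_cont c x : chart_im c x -> {for x, continuous (dens c)}.
Proof. exact: C1_continuous. Qed.

Lemma finite_density_measure : (mu setT < +oo)%E.
Proof.
have [P] := partition_exists A hM cM.
have [lam lamP] := ex_lebesgue_like R (n + n).
pose B (i : 'I_(pu_size P)) : set (borel M) := chart_inv (pu_chart i) @` (pu_supp i).
have cB (i : 'I_(pu_size P)) : closed (chart_inv (pu_chart i) @` pu_supp i : set M).
  apply: (compact_closed hM); apply: continuous_compact (@pu_compact _ _ _ _ P i).
  apply: continuous_in_subspaceT => y; rewrite inE => /pu_supp_im.
  exact: chart_inv_continuous_at.
have mB i : measurable (B i).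
  rewrite -[B i]setCK; apply: measurableC.
  exact: open_borel (closed_openC (cB i)).
have cov : [set: borel M] `<=` \big[setU/set0]_(i <- index_enum 'I_(pu_size P)) B i.
  move=> p _; apply: contrapT => np.
  have := pu_sum P p; rewrite big1; first by move/eqP; rewrite eq_sym oner_eq0.
  move=> i _; apply: pu_eq0 => Bp; apply: np.
  by rewrite -bigcup_seq; exists i => //=; exact: mem_index_enum.
have fin (r : seq 'I_(pu_size P)) : (mu (\big[setU/set0]_(i <- r) B i) < +oo)%E.
  elim: r => [|i r IH]; first by rewrite big_nil measure0.
  rewrite big_cons; apply: (@le_lt_trans _ _ (mu (B i) + mu (\big[setU/set0]_(j <- r) B j))%E).
    apply: measureU2 => //; exact: bigsetU_measurable.
  apply: lte_add_pinfty IH.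
  apply: (compact_chart_finite mudens lamP dens_cont dens_ge0 (@pu_compact _ _ _ _ P i)) => //.
  - exact: pu_supp_im.
  - by move=> p.
apply: le_lt_trans (fin (index_enum _)).
apply: le_measure; rewrite ?inE //; exact: bigsetU_measurable.
Qed.

Lemma integrable_continuous (f : M -> R) : continuous f ->
  mu.-integrable [set: borel M] (fun p => (f p)%:E).
Proof.
move=> cf; apply: measurable_bounded_integrable => //.
- exact: finite_density_measure.
- exact: continuous_borel_real.
- have : compact (f @` setT) by apply: continuous_compact => //; exact: continuous_subspaceT.
  move=> /compact_bounded [C [rC h]]; exists C; split => // e Ce p _.
  by apply: h => //; exists p.
Qed.

(** The derivative of rho along the vector field X. *)
Definition pairing (X : local A V) (rho : M -> R) : local A R :=
  fun c x => \sum_a partial a (rho \o chart_inv c) x * X c x 0 a.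

(* The transformation rule of the vector field X is expressed by its action on
   functions. *)
Variables (X : local A V) (F : local A R).
Hypothesis X_C1 : forall c a, C1_on (chart_im c) (fun x => X c x 0 a).
Hypothesis X_inv : forall rho, C1_fun A rho -> invariant (pairing X rho).
Hypothesis F_inv : invariant F.
Hypothesis F_cont : forall c x, chart_im c x -> {for x, continuous (F c)}.
Hypothesis divX : forall c x, chart_im c x ->
  \sum_a partial a (fun y => dens c y * X c y 0 a) x = dens c x * F c x.

Lemma continuous_at_point (G : local A R) : invariant G ->
  (forall c x, chart_im c x -> {for x, continuous (G c)}) -> continuous (at_point G).
Proof.
move=> GI cG; apply: continuous_chartwise => c x cx.
apply: (continuous_eq_on (open_chart_im (c := c)) cx _ (cG c x cx)) => y cy.
exact: at_point_chart.
Qed.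

Lemma continuous_pairing rho : C1_fun A rho ->
  forall c x, chart_im c x -> {for x, continuous (pairing X rho c)}.
Proof.
move=> Crho c x cx; apply: continuous_sum_at => a; apply: continuousM.
  by have [_] := Crho c x cx; apply.
exact: C1_continuous (@X_C1 c a) cx.
Qed.

(** The product rule shows that the integrand is the divergence of rho X. When
    rho is supported in a chart this is an integral on R^(2n) of the divergence
    of a compactly supported field. *)
Lemma integral_pairing_supported rho c (Q : set V) : C1_fun A rho -> compact Q ->
  Q `<=` chart_im c -> (forall p, ~ (chart_inv c @` Q) p -> rho p = 0) ->
  (\int[mu]_(p in [set: borel M])
     (at_point (pairing X rho) p + rho p * at_point F p)%:E = 0)%E.
Proof.
move=> Crho cQ Qc rho0.
have [lam lamP] := ex_lebesgue_like R (n + n).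
have closedQ : closed (chart_inv c @` Q : set M).
  apply: (compact_closed hM); apply: continuous_compact cQ.
  apply: continuous_in_subspaceT => y; rewrite inE => /Qc.
  exact: chart_inv_continuous_at.
have pair0 p : ~ (chart_inv c @` Q) p -> at_point (pairing X rho) p = 0.
  move=> np; set d := chart_at A p; have dp : chart_dom d p := chart_at_dom A p.
  rewrite -(chart_mapK dp) (at_point_chart (X_inv Crho) (chart_im_map dp)).
  apply: big1 => a _.
  have oU := open_chart_preimage (c := d) (closed_openC closedQ).
  rewrite (@partial_eq_on _ _ _ _ (fun=> 0) _ _ oU) ?partial_cst ?mul0r //.
    by split; [exact: chart_im_map|rewrite /= chart_mapK].
  by move=> y [_ ny]; exact: rho0.
pose H p := at_point (pairing X rho) p + rho p * at_point F p.
have H0 p : ~ chart_dom c p -> H p = 0.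
  move=> ncp; have np : ~ (chart_inv c @` Q) p.
    by move=> [x /Qc cx e]; apply: ncp; rewrite -e; exact: chart_inv_dom.
  by rewrite /H pair0 // rho0 // mul0r addr0.
have cH : continuous H.
  move=> p; apply: continuousD.
    exact: (continuous_at_point (X_inv Crho) (continuous_pairing Crho)).
  apply: continuousM; first exact: C1_fun_continuous.
  exact: continuous_at_point.
transitivity (\int[mu]_(p in chart_dom c) (H p)%:E)%E.
  rewrite [RHS]integral_mkcond; apply: eq_integral => p _; rewrite patchE.
  by case: ifPn => //; rewrite notin_setE => /H0 e; rewrite -/(H p) e.
rewrite (integral_chart mudens lamP dens_cont dens_ge0 c (continuous_borel_real cH)).
pose g a y := rho (chart_inv c y) * (dens c y * X c y 0 a).
have Cd a : C1_on (chart_im c) (fun y => dens c y * X c y 0 a).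
  by apply: C1M; [exact: open_chart_im|exact: dens_C1|exact: X_C1].
have Cg a : C1_on (chart_im c) (g a).
  by apply: C1M; [exact: open_chart_im|exact: Crho|exact: Cd].
have g0 a x : chart_im c x -> ~ Q x -> g a x = 0.
  move=> cx nQ; rewrite /g rho0 ?mul0r // => -[y Qy e]; apply: nQ.
  by rewrite -(chart_invK cx) -e chart_invK //; exact: Qc.
pose G a := g a \_ (chart_im c).
have CG a : C1_on setT (G a).
  exact: (C1_extend (open_chart_im (c := c)) cQ Qc (Cg a) (g0 a)).
have [r Qr] : exists r, Q `<=` box r.
  move: cQ => /compact_bounded [r [_ h]]; exists (r + 1) => x Qx.
  by apply: (h (r + 1)); rewrite ?ltrDl.
have G0 a x : r < `|x| -> G a x = 0.
  move=> rx; rewrite /G patchE; case: ifPn => //; rewrite inE => cx.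
  by apply: g0 => // /Qr; rewrite /box /= leNgt rx.
rewrite -(integral_divergence lamP CG G0) integral_mkcond.
apply: eq_integral => x _; rewrite patchE; case: ifPn; last first.
  rewrite notin_setE => ncx; rewrite big1 // => a _.
  have oQ : open (~` Q) by rewrite openC; exact: compact_closed (@hausdorff_rV _ _) cQ.
  apply: (partial_eq0 _ oQ); first by move=> /Qc.
  by move=> y nQ; rewrite /G patchE; case: ifPn => //; rewrite inE => cy; exact: g0.
rewrite inE => cx; congr EFin.
rewrite /H (at_point_chart (X_inv Crho) cx) (at_point_chart F_inv cx).
rewrite mulrDl -mulrA [F c x * _]mulrC -divX // big_distrr /= /pairing big_distrl -big_split /=.
apply: eq_bigr => a _.
have -> : partial a (G a) x = partial a (g a) x.
  apply: (partial_eq_on _ (open_chart_im (c := c)) cx) => y cy.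
  by rewrite /G patchE mem_set.
rewrite [RHS](@partialM _ _ (rho \o chart_inv c) (fun y => dens c y * X c y 0 a)).
- by rewrite addrC; congr (_ + _); rewrite [RHS]mulrC -mulrA; congr (_ * _); rewrite mulrC.
- by have [] := Crho c x cx.
- by have [] := Cd a x cx.
Qed.

(** Sum [integral_pairing_supported] over a partition of unity: the functions
    rho have sum 1, so the terms X rho have sum 0. *)
Lemma divergence_theorem : (\int[mu]_(p in [set: borel M]) (at_point F p)%:E = 0)%E.
Proof.
have [P] := partition_exists A hM cM.
pose H (i : 'I_(pu_size P)) p :=
  at_point (pairing X (pu_fun i)) p + pu_fun i p * at_point F p.
have cH i : continuous (H i).
  move=> p; apply: continuousD.
    exact: (continuous_at_point (X_inv (pu_C1 i)) (continuous_pairing (pu_C1 i))).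
  apply: continuousM; first exact: C1_fun_continuous (pu_C1 i) p.
  exact: continuous_at_point.
transitivity (\int[mu]_(p in [set: borel M]) (\sum_i (H i p)%:E))%E.
  apply: eq_integral => p _; rewrite sumEFin; congr EFin.
  rewrite big_split -big_distrl /= pu_sum mul1r -[LHS]add0r; congr (_ + _).
  rewrite exchange_big big1 // => a _; rewrite -big_distrl /=.
  set c := chart_at A p; set x := chart_map c p.
  have cx : chart_im c x by apply: chart_im_map; exact: chart_at_dom.
  rewrite -(@partial_sum _ _ _ (index_enum _) xpredT (fun i => pu_fun i \o chart_inv c)); last first.
    by move=> i; have [] := @pu_C1 _ _ _ _ P i c x cx.
  rewrite (_ : (fun y => _) = fun=> 1) ?partial_cst ?mul0r //.
  by apply/funext => y /=; exact: pu_sum.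
rewrite integral_sum //; last by move=> i; exact: integrable_continuous.
apply: big1 => i _.
apply: (@integral_pairing_supported _ (pu_chart i) (pu_supp i)).
- exact: pu_C1.
- exact: pu_compact.
- exact: pu_supp_im.
- by move=> p; exact: pu_eq0.
Qed.

End DivergenceManifold.

(** * The form sqrt(-1) ddbar f in real coordinates *)
Section Hessian.
Local Open Scope complex_scope.
Context (R : realType) (n : nat).
Local Notation V := 'rV[R]_(n + n).
Local Notation J := (Jmx R n).
Implicit Types (U : set V) (f : V -> R) (x : V).

Definition hessian f x : 'M[R]_(n + n) := \matrix_(a, b) partial a (partial b f) x.

Definition gradient f x : V := \row_a partial a f x.

(** The 1-form theta_f whose exterior derivative is sqrt(-1) ddbar f; it is half
    of the differential of f composed with J. *)
Definition dc_form f x : V := 2^-1 *: (gradient f x *m J).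

Definition ddc_form f x : 'M[R]_(n + n) := 2^-1 *: (hessian f x *m J + J *m hessian f x).

Lemma dzbar_real f (j : 'I_n) : dzbar j (fun y => (f y)%:C) =
  fun y => (partial (lshift n j) f y / 2) +i* (partial (rshift n j) f y / 2).
Proof.
apply/funext => y; rewrite /dzbar /cpartial /= !partial_cst.
set u := partial _ _ _; set v := partial _ _ _.
by apply/eqP; rewrite eq_complex /=; apply/andP; split; apply/eqP; field.
Qed.

Lemma dz_dzbar_real U f (i j : 'I_n) x : smooth_on U f -> U x ->
  dz i (dzbar j (fun y => (f y)%:C)) x =
  ((hessian f x (lshift n i) (lshift n j) + hessian f x (rshift n i) (rshift n j)) / 4)
  +i* ((hessian f x (lshift n i) (rshift n j) - hessian f x (rshift n i) (lshift n j)) / 4).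
Proof.
move=> sf Ux; have half k l : partial k (fun y => partial l f y / 2) x = partial k (partial l f) x / 2.
  under [X in partial k X]eq_fun do rewrite mulrC.
  by rewrite partialZ 1?mulrC //; exact: (sf [:: l]).
rewrite dzbar_real /dz /cpartial /= !half !mxE.
move: (partial _ _ x) (partial _ _ x) (partial _ _ x) (partial _ _ x) => a b c d.
by apply/eqP; rewrite eq_complex /=; apply/andP; split; apply/eqP; field.
Qed.

Lemma hessian_sym U f x : open U -> smooth_on U f -> U x -> (hessian f x)^T = hessian f x.
Proof.
by move=> oU sf Ux; apply/matrixP => a b; rewrite !mxE; exact: (schwarz _ _ oU Ux sf).
Qed.

Definition levi_form f x : 'M[R[i]]_n :=
  \matrix_(i, j) dz i (dzbar j (fun y => (f y)%:C)) x.

Lemma levi_form_hermitian U f x i j : open U -> smooth_on U f -> U x ->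
  levi_form f x j i = conjc (levi_form f x i j).
Proof.
move=> oU sf Ux; rewrite !mxE !(dz_dzbar_real _ _ sf Ux) /=.
have hS a b : hessian f x a b = hessian f x b a.
  by rewrite -{1}(hessian_sym oU sf Ux) mxE.
rewrite [X in X + _]hS [X in _ + X]hS [X in X - _]hS [X in _ - X]hS.
by rewrite -mulNr opprB.
Qed.

(** Comparison of the four blocks, the Hessian being symmetric. *)
Lemma form_of_levi U f x : open U -> smooth_on U f -> U x ->
  form_of_hermitian (levi_form f x) = ddc_form f x.
Proof.
move=> oU sf Ux; rewrite form_of_hermitianE; last first.
  by move=> i j; exact: levi_form_hermitian oU sf Ux.
have hS a b : hessian f x a b = hessian f x b a.
  by rewrite -{1}(hessian_sym oU sf Ux) mxE.
rewrite /ddc_form -[hessian f x]submxK.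
rewrite /Jmx !mulmx_block !(mul0mx, mulmx0, mul1mx, mulmx1, mulmxN, mulNmx, addr0, add0r).
rewrite add_block_mx scale_block_mx /realify.
have hL i j : levi_form f x i j = ((hessian f x (lshift n i) (lshift n j) +
    hessian f x (rshift n i) (rshift n j)) / 4) +i* ((hessian f x (lshift n i) (rshift n j) -
    hessian f x (rshift n i) (lshift n j)) / 4).
  by rewrite mxE (dz_dzbar_real _ _ sf Ux).
move: (levi_form f x) (hessian f x) hS hL => L H _ hL {sf Ux oU}.
congr block_mx; apply/matrixP => i j; rewrite !mxE hL /=;
  move: (H _ _) (H _ _) (H _ _) (H _ _) => p q r s; by field.
Qed.

Lemma pmx_cst p q (C : 'M[R]_(p, q)) k x : pmx k (fun=> C) x = 0.
Proof. by apply/matrixP => i j; rewrite !mxE partial_cst. Qed.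

Lemma pmxE p q (F : V -> 'M[R]_(p, q)) k x i j :
  pmx k F x i j = partial k (fun y => F y i j) x.
Proof. by rewrite mxE. Qed.

Lemma pmx_hessian f c d m x :
  pmx c (hessian f) x d m = partial c (partial d (partial m f)) x.
Proof.
transitivity (partial c (fun y => hessian f y d m) x); first exact: pmxE.
by under [X in partial c X]eq_fun do rewrite mxE.
Qed.

Lemma pmx_mulr p q r (F : V -> 'M[R]_(p, q)) (C : 'M[R]_(q, r)) k x : diffmx F x ->
  pmx k (fun y => F y *m C) x = pmx k F x *m C.
Proof.
move=> dF; rewrite pmxM // ?pmx_cst ?mulmx0 ?addr0 //.
Qed.

Lemma pmx_mull p q r (C : 'M[R]_(p, q)) (F : V -> 'M[R]_(q, r)) k x : diffmx F x ->
  pmx k (fun y => C *m F y) x = C *m pmx k F x.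
Proof.
move=> dF; rewrite pmxM // ?pmx_cst ?mul0mx ?add0r //.
Qed.

Lemma C1_hessian U f : open U -> smooth_on U f -> C1mx U (hessian f).
Proof.
move=> oU sf a b; under eq_fun do rewrite mxE.
exact: smooth_C1 oU (smooth_partial _ (smooth_partial _ sf)).
Qed.

Lemma pmx_ddc U f k x : open U -> smooth_on U f -> U x -> pmx k (ddc_form f) x =
  2^-1 *: (pmx k (hessian f) x *m J + J *m pmx k (hessian f) x).
Proof.
move=> oU sf Ux; have CH := C1_hessian oU sf.
have CJ : C1mx U (fun=> J) by move=> *; exact: C1_cst.
have dH := C1mx_diff CH Ux.
apply/matrixP => a b; rewrite mxE.
under [X in partial k X]eq_fun do rewrite mxE mxE.
have d1 := C1mx_diff (C1mx_mul oU CH CJ) Ux; have d2 := C1mx_diff (C1mx_mul oU CJ CH) Ux.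
have e1 := pmx_mulr J k dH; have e2 := pmx_mull J k dH.
rewrite partialZ; last by apply: differentiableD; [exact: d1|exact: d2].
rewrite (partialD _ (d1 a b) (d2 a b)) !mxE.
by move/matrixP/(_ a b): e1; move/matrixP/(_ a b): e2; rewrite !mxE => -> ->.
Qed.

(** The six terms cancel in pairs, because T is symmetric in its three indices
    and J is antisymmetric. *)
Lemma cyclic_sum_symmetric (T : 'I_(n + n) -> 'M[R]_(n + n)) a b k :
  (forall c d m, T c d m = T d c m) -> (forall c, (T c)^T = T c) ->
  (T a *m J + J *m T a) b k + (T b *m J + J *m T b) k a + (T k *m J + J *m T k) a b = 0.
Proof.
move=> hT T_sym; pose S a b k := (T a *m J) b k.
have hS c d l : S c d l = S d c l.
  by rewrite /S mxE [RHS]mxE; apply: eq_bigr => m _; rewrite hT.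
have e c i j : (T c *m J + J *m T c) i j = S c i j - S c j i.
  rewrite mxE; congr (_ + _).
  by rewrite -[J *m T c]trmxK trmx_mul JmxT T_sym mulmxN mxE [LHS]mxE.
rewrite !e (hS b a k) (hS k a b) (hS k b a).
move: (S a b k) (S a k b) (S b k a) => u v t; ring.
Qed.

Lemma ddc_closed U f x a b k : open U -> smooth_on U f -> U x ->
  pmx a (ddc_form f) x b k + pmx b (ddc_form f) x k a + pmx k (ddc_form f) x a b = 0.
Proof.
move=> oU sf Ux; rewrite !(pmx_ddc _ oU sf Ux).
have hP c d m : pmx c (hessian f) x d m = pmx d (hessian f) x c m.
  apply: (etrans (pmx_hessian f c d m x)); apply: (etrans _ (esym (pmx_hessian f d c m x))).
  exact: (schwarz c d oU Ux (smooth_partial m sf)).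
have hT c : (pmx c (hessian f) x)^T = pmx c (hessian f) x.
  apply/matrixP => i j; rewrite mxE.
  apply: (etrans (pmx_hessian f c j i x)); apply: (etrans _ (esym (pmx_hessian f c i j x))).
  by apply: (partial_eq_on _ oU Ux) => y Uy; exact: (schwarz _ _ oU Uy sf).
have := cyclic_sum_symmetric a b k hP hT.
move: (pmx a _ x) (pmx b _ x) (pmx k _ x) => Ta Tb Tk sum0.
have Z (C : 'M[R]_(n + n)) i j : (2^-1 *: C) i j = 2^-1 * C i j by rewrite mxE.
by rewrite !Z -!mulrDr sum0 mulr0.
Qed.

Lemma ddc_antisym U f x : open U -> smooth_on U f -> U x ->
  (ddc_form f x)^T = - ddc_form f x.
Proof.
move=> oU sf Ux; rewrite /ddc_form linearZ linearD /= !trmx_mul JmxT (hessian_sym oU sf Ux).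
by rewrite mulmxN mulNmx -opprD scalerN addrC.
Qed.

Lemma ddc_Jinvariant f x : J *m ddc_form f x *m J^T = ddc_form f x.
Proof.
rewrite /ddc_form -scalemxAr -scalemxAl mulmxDr mulmxDl.
rewrite -!mulmxA mul_JmxT mulmx1 addrC; congr (_ *: (_ + _)).
rewrite JmxT !mulmxN mulmxA mulmxA.
have -> : J *m J = - 1%:M by rewrite -{2}[J]opprK -JmxT mulmxN mul_JmxT.
by rewrite mulNmx mul1mx mulNmx opprK.
Qed.

Lemma C1_gradient U f : open U -> smooth_on U f -> C1mx U (gradient f).
Proof.
move=> oU sf i j; under eq_fun do rewrite mxE.
exact: smooth_C1 oU (smooth_partial _ sf).
Qed.

Lemma C1_dc U f : open U -> smooth_on U f -> C1mx U (dc_form f).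
Proof.
move=> oU sf i j; under eq_fun do rewrite mxE.
apply: C1M => //; first exact: C1_cst.
by apply: C1mx_mul => //; [exact: C1_gradient|move=> *; exact: C1_cst].
Qed.

Lemma C1_ddc U f : open U -> smooth_on U f -> C1mx U (ddc_form f).
Proof.
move=> oU sf i j; under eq_fun do rewrite mxE mxE.
have CH := C1_hessian oU sf.
apply: C1M => //; first exact: C1_cst.
by apply: C1D => //; apply: C1mx_mul => //; move=> *; exact: C1_cst.
Qed.

Lemma d_dc U f x a b : open U -> smooth_on U f -> U x ->
  partial a (fun y => dc_form f y 0 b) x - partial b (fun y => dc_form f y 0 a) x =
  ddc_form f x a b.
Proof.
move=> oU sf Ux.
have e c d : partial c (fun y => dc_form f y 0 d) x = 2^-1 * (hessian f x *m J) c d.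
  under [X in partial c X]eq_fun do rewrite mxE.
  have dg : diffmx (gradient f) x := C1mx_diff (C1_gradient oU sf) Ux.
  have dgJ : diffmx (fun y => gradient f y *m J) x.
    by apply: C1mx_diff Ux; apply: C1mx_mul => //; [exact: C1_gradient|move=> *; exact: C1_cst].
  rewrite partialZ //; congr (_ * _).
  have /matrixP/(_ 0 d) := pmx_mulr J c dg.
  rewrite mxE => ->; rewrite !mxE; apply: eq_bigr => k _.
  by congr (_ * _); rewrite pmxE mxE; under [X in partial c X]eq_fun do rewrite mxE.
rewrite !e -mulrBr /ddc_form; have := hessian_sym oU sf Ux; move: (hessian f x) => H HT.
rewrite [RHS]mxE; congr (_ * _); rewrite [RHS]mxE; congr (_ + _).
by rewrite -[J *m H]trmxK trmx_mul JmxT HT mulmxN [RHS]mxE [RHS]mxE.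
Qed.

End Hessian.

(** * Holomorphic changes of coordinates *)
Section ChangeOfCoordinates.
Context (R : realType) (n : nat).
Local Notation V := 'rV[R]_(n + n).
Local Notation J := (Jmx R n).
Variables (U Y : set V) (tau : V -> V).
Hypotheses (oU : open U) (oY : open Y).
Hypothesis smooth_tau : forall k, smooth_on U (fun x => tau x 0 k).
Hypothesis UY : forall x, U x -> Y (tau x).

Lemma gradient_comp (f g : V -> R) x : U x -> (forall y, U y -> g y = f (tau y)) ->
  differentiable f (tau x) -> gradient g x = gradient f (tau x) *m ('J tau x)^T.
Proof.
move=> Ux gf df; have dt l := @smooth_tau l [::] x Ux.
apply/rowP => a; rewrite mxE (partial_eq_on a oU Ux gf) mxE.
rewrite (partial_comp a dt df); apply: eq_bigr => l _.
by rewrite mulrC [gradient _ _ _ _]mxE [_^T _ _]mxE (jacobianE a l dt).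
Qed.

Hypothesis CR : forall x, U x -> J *m 'J tau x = 'J tau x *m J.

(** The Cauchy-Riemann equations allow J to cross the Jacobian matrix. *)
Lemma dc_comp (f g : V -> R) x : U x -> (forall y, U y -> g y = f (tau y)) ->
  differentiable f (tau x) -> dc_form g x = dc_form f (tau x) *m ('J tau x)^T.
Proof.
move=> Ux gf df; rewrite /dc_form (gradient_comp Ux gf df) -scalemxAl -!mulmxA.
congr (_ *: (_ *m _)); have := congr1 trmx (CR Ux).
by rewrite !trmx_mul JmxT mulmxN mulNmx => /oppr_inj.
Qed.

(** Differentiate the transformation rule of theta and antisymmetrise: the second
    derivatives of the change of coordinates are symmetric and drop out. This is
    the naturality of the exterior derivative. *)
Lemma ddc_comp (f g : V -> R) x : smooth_on Y f -> smooth_on U g -> U x ->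
  (forall y, U y -> g y = f (tau y)) ->
  ddc_form g x = 'J tau x *m ddc_form f (tau x) *m ('J tau x)^T.
Proof.
move=> sf sg Ux gf; have dt l y : U y -> differentiable (fun z => tau z 0 l) y.
  by move=> Uy; exact: (@smooth_tau l [::] y Uy).
have dt2 l k : differentiable (partial k (fun z => tau z 0 l)) x.
  exact: (@smooth_tau l [:: k] x Ux).
have Cth l : C1_on U (fun y => dc_form f (tau y) 0 l).
  apply: (@C1_comp _ _ _ U Y (fun z => dc_form f z 0 l) tau) => //.
    by move=> k; exact: smooth_C1.
  exact: C1_dc.
have theta b y : U y -> dc_form g y 0 b =
    \sum_l dc_form f (tau y) 0 l * partial b (fun z => tau z 0 l) y.
  move=> Uy; have df : differentiable f (tau y) := sf [::] _ (UY Uy).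
  rewrite (dc_comp Uy gf df) mxE; apply: eq_bigr => l _.
  by rewrite [X in _ * X]mxE (jacobianE b l (fun k => dt k y Uy)).
pose T l a b := partial a (partial b (fun z => tau z 0 l)) x.
pose P := 'J tau x; pose S m l := partial m (fun z => dc_form f z 0 l) (tau x).
have pth a b : partial a (fun y => dc_form g y 0 b) x =
    \sum_l (dc_form f (tau x) 0 l * T l a b + P b l * \sum_m P a m * S m l).
  rewrite (partial_eq_on a oU Ux (theta b)) partial_sum; last first.
    by move=> l; apply: differentiableM; [have [] := Cth l x Ux|exact: dt2].
  apply: eq_bigr => l _; rewrite partialM; [|by have [] := Cth l x Ux|exact: dt2].
  congr (_ + _ * _); first by rewrite /P (jacobianE b l (fun k => dt k x Ux)).
  have [dth _] := C1_dc oY sf 0 l (UY Ux).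
  rewrite (@partial_comp _ _ _ (fun z => dc_form f z 0 l) tau a x (fun k => dt k x Ux) dth).
  by apply: eq_bigr => m _; rewrite /P (jacobianE a m (fun k => dt k x Ux)).
have dd m l : S m l - S l m = ddc_form f (tau x) m l := d_dc m l oY sf (UY Ux).
have symT l a b : T l a b = T l b a := schwarz a b oU Ux (@smooth_tau l).
apply/matrixP => a b; rewrite -(d_dc a b oU sg Ux) !pth -/P.
clear pth; clearbody S T P.
move: (ddc_form f (tau x)) (dc_form f (tau x)) dd => D th dd; clear -symT dd.
rewrite -sumrB.
under eq_bigr => l _ do rewrite (symT l b a) opprD addrACA subrr add0r.
rewrite sumrB !mxE.
under [in RHS]eq_bigr => l _ do rewrite !mxE mulrC.
have -> : \sum_l P b l * (\sum_m P a m * D m l) =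
  \sum_l P b l * (\sum_m P a m * S m l) - \sum_l P b l * (\sum_m P a m * S l m).
  rewrite -sumrB; apply: eq_bigr => l _; rewrite -mulrBr -sumrB.
  by congr (_ * _); apply: eq_bigr => m _; rewrite -dd mulrBr.
congr (_ - _).
under eq_bigr => l _ do rewrite big_distrr.
under [in RHS]eq_bigr => l _ do rewrite big_distrr.
rewrite exchange_big; apply: eq_bigr => l _; apply: eq_bigr => m _ /=.
by rewrite mulrCA.
Qed.

End ChangeOfCoordinates.

(** * Bivectors under a change of basis *)
Section LinearAlgebra.
Context (R : realType) (m : nat).
Implicit Types (P W B C : 'M[R]_m).

Lemma invmx_congruence P W : P *m W *m P^T \in unitmx ->
  invmx (P *m W *m P^T) = invmx P^T *m invmx W *m invmx P.
Proof.
move=> u; have := u; rewrite !unitmx_mul unitmx_tr => /andP[/andP[uP uW] _].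
have e : (invmx P^T *m invmx W *m invmx P) *m (P *m W *m P^T) = 1%:M.
  rewrite -!mulmxA (mulKmx uP) (mulKmx uW) mulVmx ?unitmx_tr //.
by rewrite -[RHS]mulmx1 -(mulmxV u) mulmxA e mul1mx.
Qed.

Lemma trace_congruence P W B : P *m W *m P^T \in unitmx ->
  \tr (invmx (P *m W *m P^T) *m (P *m B *m P^T)) = \tr (invmx W *m B).
Proof.
move=> u; rewrite invmx_congruence //.
have := u; rewrite !unitmx_mul => /andP[/andP[uP uW] uPT].
rewrite -!mulmxA (mulKmx uP) mxtrace_mulC -!mulmxA mulmxV // mulmx1 //.
Qed.

Lemma bivector_congruence P W B : P *m W *m P^T \in unitmx ->
  bivector (P *m W *m P^T) (P *m B *m P^T) = invmx P^T *m bivector W B *m invmx P.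
Proof.
move=> u; rewrite /bivector trace_congruence // invmx_congruence //.
have := u; rewrite !unitmx_mul => /andP[/andP[uP uW] uPT].
rewrite mulmxBr mulmxBl -scalemxAr -scalemxAl; congr (_ - _).
by rewrite -!mulmxA !(mulKmx uP) !(mulKVmx uPT).
Qed.

Lemma bivector_antisym W B : W \in unitmx -> W^T = - W -> B^T = - B ->
  (bivector W B)^T = - bivector W B.
Proof.
move=> uW WT BT; rewrite /bivector linearB linearZ /= !trmx_mul (antisym_inv uW WT) BT.
by rewrite !(mulmxN, mulNmx) !opprK scalerN opprB mulmxA addrC.
Qed.

Lemma trace_bivector W B C : \tr (bivector W B *m C) =
  \tr (invmx W *m B) / 2 * \tr (invmx W *m C) - \tr (invmx W *m B *m invmx W *m C).
Proof. by rewrite /bivector mulmxBl linearB /= -scalemxAl linearZ. Qed.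

End LinearAlgebra.

(** * Affine paths of functions *)
Section SmoothLinear.
Context (R : realType) (m : nat).
Local Notation V := 'rV[R]_m.
Variables (U : set V) (f g : V -> R) (t : R).
Hypotheses (oU : open U) (sf : smooth_on U f) (sg : smooth_on U g).

Lemma partials_linear s x : U x -> foldr (@partial R m) (fun y => f y + t * g y) s x =
  foldr (@partial R m) f s x + t * foldr (@partial R m) g s x.
Proof.
elim: s x => //= k s IH x Ux; rewrite (partial_eq_on k oU Ux IH).
rewrite partialD; last by apply: differentiableM; [exact: differentiable_cst|exact: sg].
  by rewrite partialZ //; exact: sg.
exact: sf.
Qed.

Lemma smooth_linear : smooth_on U (fun y => f y + t * g y).
Proof.
move=> s x Ux.
apply: (@near_eq_differentiable _ _ (fun y => foldr (@partial R m) f s y + t * foldr (@partial R m) g s y)).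
  by apply: (open_near oU Ux) => y /(partials_linear s) ->.
apply: differentiableD; first exact: sf.
by apply: differentiableM; [exact: differentiable_cst|exact: sg].
Qed.

End SmoothLinear.

Lemma ddc_linear (R : realType) n (U : set 'rV[R]_(n + n)) f g t x : open U ->
  smooth_on U f -> smooth_on U g -> U x ->
  ddc_form (fun y => f y + t * g y) x = ddc_form f x + t *: ddc_form g x.
Proof.
move=> oU sf sg Ux; rewrite /ddc_form.
have -> : hessian (fun y => f y + t * g y) x = hessian f x + t *: hessian g x.
  by apply/matrixP => a b; rewrite !mxE; exact: (partials_linear t oU sf sg [:: a; b] Ux).
move: (hessian f x) (hessian g x) => F G.
rewrite mulmxDl mulmxDr -scalemxAl -scalemxAr.
rewrite [in RHS]scalerA [t * _]mulrC -[in RHS]scalerA -[RHS]scalerDr; congr (_ *: _).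
by rewrite addrACA scalerDr.
Qed.

(** * The form omega_phi *)
Section KahlerGeometry.
Context (R : realType) (n : nat) (M : ptopologicalType) (A : complex_atlas R n M).
Local Notation V := 'rV[R]_(n + n).
Local Notation J := (Jmx R n).
Implicit Types (c d : chart A) (x : V) (f : M -> R).

Definition ddc f : local A 'M[R]_(n + n) := fun c => ddc_form (f \o chart_inv c).

Definition covariant (T : local A 'M[R]_(n + n)) := forall c d x, overlap c d x ->
  T c x = 'J (transition c d) x *m T d (transition c d x) *m ('J (transition c d) x)^T.

Lemma overlap_im c d x : overlap c d x -> chart_im c x.
Proof. by rewrite overlapE => -[]. Qed.

Lemma smooth_overlap c d f : smooth_fun A f -> smooth_on (overlap c d) (f \o chart_inv c).
Proof. by move=> sf s x /overlap_im; exact: sf. Qed.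

Lemma ddcE f c x : smooth_fun A f -> chart_im c x ->
  form_of_hermitian (complex_hessian f c x) = ddc f c x.
Proof. by move=> sf cx; exact: (form_of_levi (open_chart_im (c := c)) (sf c) cx). Qed.

Lemma ddc_covariant f : smooth_fun A f -> covariant (ddc f).
Proof.
move=> sf c d x cdx.
apply: (@ddc_comp _ _ (overlap c d) (chart_im d) (transition c d) _ _ _ _ _
  (f \o chart_inv d) (f \o chart_inv c)) => //.
- exact: open_overlap.
- exact: open_chart_im.
- by move=> k; exact: transition_smooth.
- by move=> y; exact: transition_im.
- by have [_] := chart_transition c d.
- exact: smooth_overlap.
- by move=> y cdy /=; rewrite transition_inv.
Qed.

Lemma gradient_overlap rho c d x : C1_fun A rho -> overlap c d x ->
  gradient (rho \o chart_inv c) x =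
  gradient (rho \o chart_inv d) (transition c d x) *m ('J (transition c d) x)^T.
Proof.
move=> Crho cdx.
apply: (@gradient_comp _ _ (overlap c d) (transition c d) _ _
  (rho \o chart_inv d) (rho \o chart_inv c)) => //.
- exact: open_overlap.
- by move=> k; exact: transition_smooth.
- by move=> y cdy /=; rewrite transition_inv.
- by have [] := Crho d _ (transition_im cdx).
Qed.

Lemma dc_overlap f c d x : smooth_fun A f -> overlap c d x ->
  dc_form (f \o chart_inv c) x =
  dc_form (f \o chart_inv d) (transition c d x) *m ('J (transition c d) x)^T.
Proof.
move=> sf cdx.
apply: (@dc_comp _ _ (overlap c d) (transition c d) _ _ _
  (f \o chart_inv d) (f \o chart_inv c)) => //.
- exact: open_overlap.
- by move=> k; exact: transition_smooth.
- by have [_] := chart_transition c d.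
- by move=> y cdy /=; rewrite transition_inv.
- exact: (sf d [::] _ (transition_im cdx)).
Qed.

Variables (w : local A 'M[R]_(n + n)) (phi : M -> R).
Hypotheses (kw : kahler_form w) (kphi : kahler_potential w phi).
Local Notation wphi := (kahler_perturb w phi).

Lemma perturbE c x : chart_im c x -> wphi c x = w c x + ddc phi c x.
Proof. by have [sphi _] := kphi; move=> cx; rewrite -ddcE. Qed.

Lemma perturb_covariant : covariant wphi.
Proof.
have [[_ wT] _ _ _ _] := kw; have [sphi _] := kphi.
move=> c d x cdx; rewrite (perturbE (overlap_im cdx)) (perturbE (transition_im cdx)).
by rewrite mulmxDr mulmxDl -(wT c d x cdx) -(ddc_covariant sphi cdx).
Qed.

Lemma perturb_antisym c x : chart_im c x -> (wphi c x)^T = - wphi c x.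
Proof.
have [_ wT _ _ _] := kw; have [sphi _] := kphi.
move=> cx; rewrite perturbE // linearD /= wT // opprD; congr (_ + _).
exact: (ddc_antisym (open_chart_im (c := c)) (sphi c) cx).
Qed.

Lemma perturb_Jinvariant c x : chart_im c x -> J *m wphi c x *m J^T = wphi c x.
Proof.
have [_ _ wJ _ _] := kw => cx.
by rewrite perturbE // mulmxDr mulmxDl wJ // ddc_Jinvariant.
Qed.

Lemma perturb_positive c x : chart_im c x -> forall u : V, u != 0 ->
  0 < (u *m (wphi c x *m J^T) *m u^T) 0 0.
Proof. by have [_ pos] := kphi => cx; exact: pos. Qed.

(** The inverse of omega_phi exists because g_phi is positive definite. *)
Lemma perturb_unit c x : chart_im c x -> wphi c x \in unitmx.
Proof.
by move=> cx; have := posdef_unitmx (perturb_positive cx); rewrite unitmx_mul => /andP[].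
Qed.

Lemma C1_form c : C1mx (chart_im c) (w c).
Proof.
have [[sw _] _ _ _ _] := kw => a b.
by apply: smooth_C1; [exact: open_chart_im|exact: sw].
Qed.

Lemma C1_ddc_fun f c : smooth_fun A f -> C1mx (chart_im c) (ddc f c).
Proof. by move=> sf; apply: C1_ddc (sf c); exact: open_chart_im. Qed.

Lemma C1_perturb c : C1mx (chart_im c) (wphi c).
Proof.
have [sphi _] := kphi; have oc := open_chart_im (c := c) => a b.
apply: (@C1_eq_on _ _ _ (fun y => w c y a b + ddc phi c y a b)) => //.
  by move=> y cy; rewrite perturbE // [RHS]mxE.
by apply: C1D => //; [exact: C1_form|exact: C1_ddc_fun].
Qed.

Lemma perturb_closed c x a b k : chart_im c x ->
  pmx a (wphi c) x b k + pmx b (wphi c) x k a + pmx k (wphi c) x a b = 0.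
Proof.
have [sphi _] := kphi; have oc := open_chart_im (c := c) => cx.
have [_ _ _ wc _] := kw.
have e i j l : pmx i (wphi c) x j l = pmx i (w c) x j l + pmx i (ddc phi c) x j l.
  rewrite !pmxE.
  rewrite (@partial_eq_on _ _ _ _ (fun y => w c y j l + ddc phi c y j l) _ _ oc cx).
    apply: partialD; first by have [] := @C1_form c j l x cx.
    by have [] := C1_ddc_fun sphi j l cx.
  by move=> y cy; rewrite perturbE // [LHS]mxE.
have wc0 : pmx a (w c) x b k + pmx b (w c) x k a + pmx k (w c) x a b = 0.
  by have := wc c x cx a b k; rewrite (pmxE (w c) a x b k) (pmxE (w c) b x k a) (pmxE (w c) k x a b).
have sum3 (p q r p' q' r' u v t : R) : u = p + p' -> v = q + q' -> t = r + r' ->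
    p + q + r = 0 -> p' + q' + r' = 0 -> u + v + t = 0.
  by clear => -> -> -> e1 e2; lra.
apply: (sum3 _ _ _ _ _ _ _ _ _ (e a b k) (e b k a) (e k a b) wc0).
exact: ddc_closed oc (sphi c) cx.
Qed.

Lemma C1_top_power c : C1_on (chart_im c) (fun x => top_power (wphi c x)).
Proof.
have oc := open_chart_im (c := c); apply: C1M => //; last exact: C1_cst.
apply: C1_sum => // s; apply: C1M => //; first exact: C1_cst.
by apply: C1_prod => // i; exact: C1_perturb.
Qed.

Lemma volume_densityE c x : chart_im c x ->
  top_power (wphi c x) = Num.sqrt (\det (kahler_metric w phi c x)).
Proof.
move=> cx; apply: top_powerE; [exact: perturb_Jinvariant|exact: perturb_antisym|].
exact: perturb_positive.
Qed.

Lemma top_power_ge0 c x : chart_im c x -> 0 <= top_power (wphi c x).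
Proof. by move=> cx; rewrite volume_densityE // sqrtr_ge0. Qed.

Lemma sqr_top_power c x : chart_im c x -> top_power (wphi c x) ^+ 2 = \det (wphi c x).
Proof.
by move=> cx; apply: top_power_sqr; [exact: perturb_Jinvariant|exact: perturb_antisym].
Qed.

End KahlerGeometry.

(** * The vector field with divergence F *)
Section Flux.
Context (R : realType) (n : nat) (M : ptopologicalType) (A : complex_atlas R n M).
Local Notation V := 'rV[R]_(n + n).
Local Notation J := (Jmx R n).
Variables (w : local A 'M[R]_(n + n)) (phi nu eta : M -> R).
Hypotheses (kw : kahler_form w) (kphi : kahler_potential w phi).
Hypotheses (snu : smooth_fun A nu) (seta : smooth_fun A eta).
Local Notation wphi := (kahler_perturb w phi).
Implicit Types (c d : chart A) (x : V).

Definition half_trace (f : M -> R) : local A R :=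
  fun c x => \tr (invmx (wphi c x) *m ddc f c x) / 2.

(** X = Psi theta_nu, where Psi is the bivector of alpha_eta. *)
Definition flux : local A V :=
  fun c x => dc_form (nu \o chart_inv c) x *m (bivector (wphi c x) (ddc eta c x))^T.

Definition flux_divergence : local A R :=
  fun c x => - (\tr (bivector (wphi c x) (ddc eta c x) *m ddc nu c x) / 2).

Lemma congruence_unit_perturb c d x : overlap c d x ->
  'J (transition c d) x *m wphi d (transition c d x) *m ('J (transition c d) x)^T \in unitmx.
Proof.
by move=> cdx; rewrite -(perturb_covariant kw kphi cdx); exact: perturb_unit (overlap_im cdx).
Qed.

Lemma half_trace_invariant f : smooth_fun A f -> invariant (half_trace f).
Proof.
move=> sf c d x cdx; rewrite /half_trace (ddc_covariant sf cdx).
by rewrite (perturb_covariant kw kphi cdx) (trace_congruence _ (congruence_unit_perturb cdx)).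
Qed.

Lemma flux_divergence_invariant : invariant flux_divergence.
Proof.
move=> c d x cdx; rewrite /flux_divergence (ddc_covariant snu cdx) (ddc_covariant seta cdx).
have u := congruence_unit_perturb cdx.
rewrite (perturb_covariant kw kphi cdx) (bivector_congruence _ u).
have := u; rewrite !unitmx_mul => /andP[/andP[uP _] uPT].
by rewrite -!mulmxA (mulKmx uP) mxtrace_mulC -!mulmxA mulmxV // mulmx1.
Qed.

Lemma pairing_flux rho c x : pairing flux rho c x =
  (gradient (rho \o chart_inv c) x *m bivector (wphi c x) (ddc eta c x) *m
     (dc_form (nu \o chart_inv c) x)^T) 0 0.
Proof.
rewrite -mulmxA -[X in _ *m (X *m _)]trmxK -trmx_mul /pairing mxE.
by apply: eq_bigr => a _; rewrite [X in _ = X * _]mxE [X in _ = _ * X]mxE.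
Qed.

Lemma pairing_flux_invariant rho : C1_fun A rho -> invariant (pairing flux rho).
Proof.
move=> Crho c d x cdx; rewrite !pairing_flux (gradient_overlap Crho cdx) (dc_overlap snu cdx).
have u := congruence_unit_perturb cdx.
rewrite (perturb_covariant kw kphi cdx) (ddc_covariant seta cdx) (bivector_congruence _ u).
have := u; rewrite !unitmx_mul => /andP[/andP[uP _] uPT].
by rewrite trmx_mul trmxK -!mulmxA (mulKmx uP) (mulKVmx uPT).
Qed.

Lemma C1_bivector c : C1mx (chart_im c) (fun x => bivector (wphi c x) (ddc eta c x)).
Proof.
apply: C1mx_bivector; [exact: open_chart_im|exact: C1_perturb|exact: C1_ddc_fun|].
by move=> x; exact: perturb_unit.
Qed.

Lemma C1_flux c a : C1_on (chart_im c) (fun x => flux c x 0 a).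
Proof.
have oc := open_chart_im (c := c).
apply: (C1mx_mul oc (C1_dc oc (snu (c := c)))) => i j.
by under eq_fun do rewrite mxE; exact: C1_bivector.
Qed.

Lemma C1_half_trace f c : smooth_fun A f -> C1_on (chart_im c) (half_trace f c).
Proof.
move=> sf; have oc := open_chart_im (c := c); apply: C1M => //; last exact: C1_cst.
apply: C1_trace => //; apply: C1mx_mul => //; last exact: C1_ddc_fun.
by apply: C1mx_inv => //; [exact: C1_perturb|move=> x; exact: perturb_unit].
Qed.

Lemma C1_flux_divergence c : C1_on (chart_im c) (flux_divergence c).
Proof.
have oc := open_chart_im (c := c); apply: C1N => //; apply: C1M => //; last exact: C1_cst.
by apply: C1_trace => //; apply: C1mx_mul => //; [exact: C1_bivector|exact: C1_ddc_fun].
Qed.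

(** An antisymmetric matrix pairs only with the antisymmetric part. *)
Lemma trace_antisym (m : nat) (Psi T : 'M[R]_m) : Psi^T = - Psi ->
  \sum_a \sum_b T a b * Psi a b = - (\tr (Psi *m (T - T^T)) / 2).
Proof.
move=> PT; have e : \sum_a \sum_b T a b * Psi a b = \tr (T *m Psi^T).
  by apply: eq_bigr => a _; rewrite mxE; apply: eq_bigr => b _; rewrite mxE.
have e1 : \tr (Psi *m T^T) = - \tr (Psi *m T).
  by rewrite -mxtrace_tr trmx_mul trmxK PT mulmxN linearN /= mxtrace_mulC.
rewrite e PT mulmxN linearN /= mxtrace_mulC mulmxBr linearB /= e1 opprK -mulr2n.
by rewrite -[X in X / 2]mulr_natr mulfK // pnatr_eq0.
Qed.

(** Since D Psi is divergence free, only the derivatives of theta_nu remain. By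
    antisymmetry of Psi they enter through d theta_nu = alpha_nu. *)
Lemma divergence_flux c x : chart_im c x ->
  \sum_a partial a (fun y => top_power (wphi c y) * flux c y 0 a) x =
  top_power (wphi c x) * flux_divergence c x.
Proof.
move=> cx; have oc := open_chart_im (c := c).
pose D y := top_power (wphi c y).
pose Psi y := bivector (wphi c y) (ddc eta c y).
pose theta y := dc_form (nu \o chart_inv c) y.
have CD : C1_on (chart_im c) D by exact: C1_top_power.
have CPsi : C1mx (chart_im c) Psi := @C1_bivector c.
have Cth : C1mx (chart_im c) theta by apply: C1_dc => //; exact: snu.
have CDPsi a b : C1_on (chart_im c) (fun y => D y * Psi y a b).
  by apply: C1M => //; exact: CPsi.
have fluxE a y : D y * flux c y 0 a = \sum_b theta y 0 b * (D y * Psi y a b).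
  rewrite /flux mxE big_distrr; apply: eq_bigr => b _.
  by rewrite /= mulrCA; congr (_ * (_ * _)); rewrite [LHS]mxE.
pose T a b := partial a (fun y => theta y 0 b) x.
have pE a : partial a (fun y => top_power (wphi c y) * flux c y 0 a) x =
    \sum_b (theta x 0 b * partial a (fun y => D y * Psi y a b) x + D x * Psi x a b * T a b).
  under [X in partial a X]eq_fun do rewrite -/(D _) fluxE.
  rewrite partial_sum; last first.
    by move=> b; apply: differentiableM; [have [] := Cth 0 b x cx|have [] := CDPsi a b x cx].
  apply: eq_bigr => b _.
  by rewrite partialM //; [have [] := Cth 0 b x cx|have [] := CDPsi a b x cx].
under eq_bigr => a _ do rewrite pE big_split.
rewrite big_split exchange_big /= big1 ?add0r; last first.
  move=> b _; rewrite -big_distrr /=.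
  rewrite (@divergence_bivector _ _ (chart_im c) (wphi c) (ddc eta c) D x b) ?mulr0 //.
  - exact: C1_perturb.
  - exact: C1_ddc_fun.
  - by move=> y; exact: perturb_unit.
  - by move=> y; exact: perturb_antisym.
  - by move=> y cy; exact: (ddc_antisym oc (seta (c := c)) cy).
  - by move=> y; exact: sqr_top_power.
  - by move=> a i k; exact: perturb_closed.
  - by move=> a i k; exact: (ddc_closed a i k oc (seta (c := c)) cx).
have dth a b : T a b - T b a = ddc nu c x a b := d_dc a b oc (snu (c := c)) cx.
have PsiT : (Psi x)^T = - Psi x.
  apply: bivector_antisym; [exact: perturb_unit|exact: perturb_antisym|].
  exact: (ddc_antisym oc (seta (c := c)) cx).
rewrite /flux_divergence -/(Psi x) -/(D x); clearbody T.
have -> : ddc nu c x = \matrix_(a, b) T a b - (\matrix_(a, b) T a b)^T.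
  by apply/matrixP => a b; rewrite -dth !mxE.
move: (D x) (Psi x) PsiT => d P PT.
rewrite -(trace_antisym _ PT) big_distrr; apply: eq_bigr => a _ /=.
rewrite big_distrr; apply: eq_bigr => b _ /=.
by rewrite mxE mulrAC mulrA.
Qed.

End Flux.

(** * Comparison of the two metrics *)
Section Ebin.
Context (R : realType) (n : nat) (M : ptopologicalType) (A : complex_atlas R n M).
Local Notation V := 'rV[R]_(n + n).
Local Notation J := (Jmx R n).
Implicit Types (c d : chart A) (x : V).
Variables (w : local A 'M[R]_(n + n)) (phi : M -> R).
Hypotheses (kw : kahler_form w) (kphi : kahler_potential w phi).
Local Notation wphi := (kahler_perturb w phi).

Lemma derive1_affine (a b : R) : derive1 (fun t : R => a + t * b) 0 = b.
Proof.
have h : is_derive (0 : R) 1 (fun t : R => a + t * b) (0 + (0 *: 0 + b *: 1)).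
  apply: is_deriveD; exact: is_deriveM.
by rewrite derive1E derive_val add0r scaler0 add0r [_ *: _]mulr1.
Qed.

(** The metric depends affinely on the potential. *)
Lemma nabla11E nu c x : smooth_fun A nu -> chart_im c x ->
  nabla11 w phi nu c x = ddc nu c x *m J^T.
Proof.
have [sphi _] := kphi => snu cx; have oc := open_chart_im (c := c).
have path t : kahler_metric w (fun p => phi p + t * nu p) c x =
    wphi c x *m J^T + t *: (ddc nu c x *m J^T).
  rewrite /kahler_metric /form_metric (perturbE kphi cx) /kahler_perturb ddcE //; last first.
    by move=> d; apply: smooth_linear; [exact: open_chart_im|exact: sphi|exact: snu].
  rewrite /ddc (ddc_linear t oc (sphi c) (snu c) cx).
  by rewrite addrA mulmxDl scalemxAl.
apply/matrixP => a b; rewrite mxE.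
under [X in derive1 X]eq_fun do rewrite path mxE [X in _ + X]mxE.
exact: derive1_affine.
Qed.

Lemma laplacianE nu c x : smooth_fun A nu -> chart_im c x ->
  laplacian w phi nu c x = half_trace w phi nu c x.
Proof.
move=> snu cx; have oc := open_chart_im (c := c).
rewrite /half_trace -(ddcE snu cx); apply: laplacian_half_trace.
- exact: perturb_Jinvariant.
- exact: (perturb_unit kphi cx).
- by move=> i j; exact: (levi_form_hermitian i j oc (snu c) cx).
Qed.

(** With g = w J^T the inverse of g is J W, and the factors J cancel in the
    trace by cyclicity. *)
Lemma ebin_integrandE nu eta c x : smooth_fun A nu -> smooth_fun A eta -> chart_im c x ->
  \tr (invmx (kahler_metric w phi c x) *m nabla11 w phi nu c x
         *m invmx (kahler_metric w phi c x) *m nabla11 w phi eta c x) =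
  2 * flux_divergence w phi nu eta c x +
  2 * (half_trace w phi nu c x * half_trace w phi eta c x).
Proof.
move=> snu seta cx; rewrite !nabla11E // /kahler_metric /form_metric.
rewrite /flux_divergence trace_bivector /half_trace.
have uW := perturb_unit kphi cx.
move: (wphi c x) (ddc nu c x) (ddc eta c x) uW => W C B uW.
have -> : invmx (W *m J^T) = J *m invmx W.
  have u : W *m J^T \in unitmx.
    rewrite unitmx_mul uW unitmx_tr; have [] // := mulmx1_unit (mul_JmxT R n).
  by rewrite -[RHS]mulmx1 -(mulmxV u) mulmxA -[J *m _ *m _]mulmxA (mulKmx uW) mul_JmxT mul1mx.
have -> : \tr (J *m invmx W *m (C *m J^T) *m (J *m invmx W) *m (B *m J^T)) =
    \tr (invmx W *m B *m invmx W *m C).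
  rewrite -!mulmxA mxtrace_mulC -!mulmxA mulT_Jmx mulmx1.
  rewrite (mulmxA J^T) mulT_Jmx mul1mx.
  by rewrite mulmxA mxtrace_mulC !mulmxA.
move: (\tr _) (\tr _) (\tr _) => p q r; by field.
Qed.

Lemma volumeE : riemannian_volume (kahler_metric w phi) = kahler_volume wphi.
Proof.
rewrite /riemannian_volume /kahler_volume /density_measure.
suff -> : has_density (fun c x => Num.sqrt (\det (kahler_metric w phi c x))) =
  has_density (fun c x => top_power (wphi c x)) by [].
apply/funext => mu; apply/propext; split => h c B mB Bc; rewrite (h c B mB Bc);
  congr integral_rV; apply/funext => x; congr EFin; rewrite !patchE; case: ifPn => //;
  rewrite inE => -[p Bp <-]; rewrite (volume_densityE kw kphi (chart_im_map (Bc _ Bp))) //.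
Qed.

Hypotheses (hM : hausdorff_space M) (cM : compact [set: M]).

(** The flux divergence integrates to zero and leaves the product of the
    Laplacians. *)
Lemma ebin_calabi nu eta : smooth_fun A nu -> smooth_fun A eta ->
  ebin (kahler_metric w phi) (nabla11 w phi nu) (nabla11 w phi eta)
    = 2 * calabi w phi nu eta.
Proof.
move=> snu seta; rewrite /ebin /calabi volumeE.
pose F := flux_divergence w phi nu eta.
pose L p := at_point (half_trace w phi nu) p * at_point (half_trace w phi eta) p.
have im p : chart_im (chart_at A p) (chart_map (chart_at A p) p).
  by apply: chart_im_map; exact: chart_at_dom.
rewrite (@eq_Rintegral _ (borel M) _ _ _ (fun p : M => 2 * at_point F p + 2 * L p)); last first.
  by move=> p _; exact: (ebin_integrandE snu seta (im p)).
rewrite [in RHS](@eq_Rintegral _ (borel M) _ _ _ L); last first.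
  by move=> p _; rewrite /at_point !laplacianE.
(* Without a measure having the density, the volume is the zero measure by
   convention and both sides vanish. *)
rewrite /kahler_volume /density_measure; case: pselect => [h|_]; last first.
  by rewrite /Rintegral !integral_measure_zero mulr0.
case: cid => mu mudens /=.
have densC1 c : C1_on (chart_im c) (fun x => top_power (wphi c x)) by exact: C1_top_power.
have dens0 c x : chart_im c x -> 0 <= top_power (wphi c x) by exact: top_power_ge0.
have F_inv : invariant F by exact: flux_divergence_invariant.
have F_cont c x : chart_im c x -> {for x, continuous (F c)}.
  by apply: C1_continuous; exact: C1_flux_divergence.
have cF : continuous (at_point F) by exact: continuous_at_point.
have cH f : smooth_fun A f -> continuous (at_point (half_trace w phi f)).
  move=> sf; apply: continuous_at_point; first exact: half_trace_invariant.
  by move=> c x; apply: C1_continuous; exact: C1_half_trace.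
have cL : continuous L by move=> p; apply: continuousM; exact: cH.
have iF := integrable_continuous hM cM mudens densC1 dens0 cF.
have iL := integrable_continuous hM cM mudens densC1 dens0 cL.
have c2 (G : M -> R) : continuous G -> continuous (fun p => 2 * G p).
  move=> cG p; apply: (@continuousM _ _ (cst 2) G p); first exact: cst_continuous.
  exact: cG.
rewrite RintegralD //; [|exact: (integrable_continuous hM cM mudens densC1 dens0 (c2 _ _))..].
rewrite !RintegralZl //.
suff -> : \int[mu]_(p in [set: borel M]) at_point F p = 0 by rewrite mulr0 add0r.
have C1X c a : C1_on (chart_im c) (fun x => flux w phi nu eta c x 0 a) by exact: C1_flux.
have X_inv rho : C1_fun A rho -> invariant (pairing (flux w phi nu eta) rho).
  exact: pairing_flux_invariant.
have divX c x : chart_im c x ->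
    \sum_a partial a (fun y => top_power (wphi c y) * flux w phi nu eta c y 0 a) x =
    top_power (wphi c x) * F c x by exact: divergence_flux.
have int0 := divergence_theorem hM cM mudens densC1 dens0 C1X X_inv F_inv F_cont divX.
by rewrite /Rintegral int0.
Qed.

End Ebin.

Theorem proposition2p1 (R : realType) (n : nat) (M : ptopologicalType)
    (A : complex_atlas R n M) (w : local A 'M[R]_(n + n)) :
  (1 <= n)%N ->
  hausdorff_space M -> compact [set: M] -> connected [set: M] ->
  kahler_form w ->
  forall phi nu eta : M -> R,
    kahler_potential w phi -> smooth_fun A nu -> smooth_fun A eta ->
    ebin (kahler_metric w phi) (nabla11 w phi nu) (nabla11 w phi eta)
      = 2 * calabi w phi nu eta.
Proof.
by move=> _ hM cM _ kw phi nu eta kphi snu seta; exact: ebin_calabi.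
Qed.
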